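(* Let $n>1$. In a Darboux chart of dimension $2n+1$ (in particular in the standard $S^{2n+1}$) there exists an arbitrarily small compact connected oriented embedded hypersurface $\Sigma$ with contact-type boundary which violates the Thurston–Bennequin inequality $\sum_{p\in S_-(\Sigma)}\mathrm{Ind}\,p\le0$, i.e. for which $$\sum_{p\in S_-(\Sigma)}\mathrm{Ind}\,p>0,$$ and this hypersurface $\Sigma$ is not convex.
   Context: Let $\Sigma$ be a compact connected oriented hypersurface embedded in a contact manifold $(M^{2n+1},\ker\alpha)$. $S_+(\Sigma)$ (resp. $S_-(\Sigma)$) is the set of positive (resp. negative) tangent points of $\Sigma$ to $\ker\alpha$, the sign being that of $(d\alpha|_\Sigma)^n$ at the tangent point. It is assumed that $S_+(\Sigma)\cup S_-(\Sigma)$ is a discrete subset of $\mathrm{int}\,\Sigma$. The characteristic foliation of $\Sigma$ is the singular oriented foliation generated by the vector field $X$ on $\Sigma$ with $\iota_X\,dvol=\lambda\wedge(d\lambda)^{n-1}$, where $\lambda=\alpha|_\Sigma$ and $dvol$ is a volume form on $\Sigma$; its singular points are exactly the tangent points. $\mathrm{Ind}\,p$ is the vector field index of $X$ at the singular point $p$. $\Sigma$ has contact-type boundary if $\partial\Sigma\ne\emptyset$ and $X$ is outwardly transverse to $\partial\Sigma$. A contact vector field is a vector field $Z$ with $\alpha\wedge\mathcal{L}_Z\alpha=0$. A hypersurface $\Sigma$ with contact-type boundary is convex if there is a contact vector field $Z$ positively transverse to $\Sigma$ with $\alpha(Z)|_{\partial\Sigma}>0$. *)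

(* Defs.v *)
From HB Require Import structures.
From mathcomp Require Import all_boot all_order all_algebra all_fingroup.
From mathcomp Require Import all_classical all_reals all_analysis.

Set Implicit Arguments.
Unset Strict Implicit.
Unset Printing Implicit Defensive.

Import Order.TTheory GRing.Theory Num.Theory.
Import numFieldNormedType.Exports.

Local Open Scope classical_set_scope.
Local Open Scope ring_scope.

(* Contact geometry on a subset M of 'rV[R]_N which is a (2n+1)-dimensional
   submanifold.  A contact form on M is given by the restriction of a 1-form
   alpha of the ambient space; hypersurfaces of M are given by local
   parametrizations with values in 'rV[R]_N. *)

(* The k-th coordinate of u (0 when k is out of range). *)
Definition coord (R : realType) (m : nat) (u : 'rV[R]_m) (k : nat) : R :=
  oapp (u 0) 0 (insub k).

Definition basis (R : realType) (m : nat) (k : nat) : 'rV[R]_m :=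
  \row_j (j == k :> nat)%:R.

Section Smooth.
Variables (R : realType) (V W : normedModType R).

Fixpoint diff_order (k : nat) (U : set V) (f : V -> W) : Prop :=
  if k is k'.+1 then forall v, diff_order k' U ('D_v f)
  else forall x, U x -> differentiable f x.

(* For U open this is C^oo regularity: all iterated directional derivatives
   exist and are differentiable on U. *)
Definition smooth (U : set V) (f : V -> W) : Prop :=
  forall k, diff_order k U f.

End Smooth.

(* Alternating forms on E.  A form of degree k is a function of a sequence of
   vectors which only looks at the entries of index < k; the degree is passed
   explicitly to the wedge product. *)
Section Forms.
Variables (R : realType) (E : normedModType R).

Definition form := (nat -> E) -> R.

Definition form1 (b : E -> R) : form := fun v => b (v 0%N).
Definition form2 (w : E -> E -> R) : form := fun v => w (v 0%N) (v 1%N).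

Definition perm_nat (d : nat) (s : 'S_d) (i : nat) : nat :=
  oapp (fun j : 'I_d => val (s j)) i (insub i).

Definition wedge (k l : nat) (a b : form) : form := fun v =>
  ((k`! * l`!)%:R)^-1 *
  \sum_(s : 'S_(k + l)) (-1) ^+ s *
     a (fun i => v (perm_nat s i)) * b (fun i => v (perm_nat s (k + i))).

(* w ^ n for a form w of degree 2 *)
Fixpoint wedge_pow (w : form) (n : nat) : form :=
  if n is n'.+1 then wedge 2 n'.*2 w (wedge_pow w n') else fun=> 1.

(* (u, v_0, v_1, ...) *)
Definition vcons (u : E) (v : nat -> E) : nat -> E :=
  fun i => if i is j.+1 then v j else u.

(* d beta, for a 1-form beta; no factor 1/2 *)
Definition extd (beta : E -> E -> R) (x v w : E) : R :=
  'D_v (fun y => beta y w) x - 'D_w (fun y => beta y v) x.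

(* L_Z beta, for a 1-form beta and a vector field Z *)
Definition lie (Z : E -> E) (beta : E -> E -> R) (x v : E) : R :=
  'D_(Z x) (fun y => beta y v) x + beta x ('D_v Z x).

(* velocities at p of curves in M *)
Definition tangent (M : set E) (p v : E) : Prop :=
  exists c : R -> E, [/\ c 0 = p, \forall t \near (0 : R), M (c t)
    & is_derive (0 : R) (1 : R) c v].

(* Z is a contact vector field of (M, ker alpha), defined over M `&` W. *)
Definition contact_field (M : set E) (alpha : E -> E -> R)
    (W : set E) (Z : E -> E) : Prop :=
  [/\ smooth W Z,
      forall p, (M `&` W) p -> tangent M p (Z p)
    & forall p, (M `&` W) p -> forall v : nat -> E,
        tangent M p (v 0%N) -> tangent M p (v 1%N) ->
        wedge 1 1 (form1 (alpha p)) (form1 (lie Z alpha p)) v = 0].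

End Forms.

(* The index of a smooth vector field X on U at an isolated zero u0, i.e. the
   local degree of X at u0: the signed number of preimages, in a small ball, of
   any sufficiently small regular value. *)
Definition is_vf_index (R : realType) (m : nat) (U : set 'rV[R]_m)
    (X : 'rV[R]_m -> 'rV[R]_m) (u0 : 'rV[R]_m) (k : int) : Prop :=
  X u0 = 0 /\
  exists r d : R, [/\ 0 < r, 0 < d,
    forall x, `|x - u0| <= r -> U x /\ (X x = 0 -> x = u0)
  & forall y, `|y| < d ->
      (forall x, `|x - u0| < r -> X x = y -> \det ('J X x) != 0) ->
      \sum_(x \in [set x | `|x - u0| < r /\ X x = y]) sgz (\det ('J X x)) = k].

Section Hypersurface.
Variables (R : realType) (N n : nat).

(* (U, psi): a parametrization psi with U open; only the part of U in the
   half-space {u_0 <= 0} is mapped to the hypersurface. *)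
Definition chart := (set 'rV[R]_(n.*2) * ('rV[R]_(n.*2) -> 'rV[R]_N))%type.

Definition chart_dom (c : chart) : set 'rV[R]_(n.*2) :=
  c.1 `&` [set u | coord u 0 <= 0].

(* The last clause says that psi maps chart_dom homeomorphically onto a
   relatively open subset of S. *)
Definition is_chart (S : set 'rV[R]_N) (c : chart) : Prop :=
  [/\ open c.1, smooth c.1 c.2,
      forall u v, c.1 u -> c.1 v -> c.2 u = c.2 v -> u = v,
      forall u v, c.1 u -> 'D_v c.2 u = 0 -> v = 0
    & forall U, open U -> U `<=` c.1 ->
        exists2 W, open W & c.2 @` (U `&` chart_dom c) = S `&` W].

(* S is an embedded 2n-dimensional submanifold with boundary, and A is an
   atlas of S whose transition maps have positive Jacobian. *)
Definition oriented_hypersurface (S : set 'rV[R]_N) (A : set chart) : Prop :=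
  [/\ forall c, A c -> is_chart S c,
      forall p, S p -> exists c u, [/\ A c, chart_dom c u & c.2 u = p]
    & forall c c' u u', A c -> A c' -> chart_dom c u -> chart_dom c' u' ->
        c.2 u = c'.2 u' ->
        exists2 B : 'M[R]_(n.*2), 0 < \det B & 'J c.2 u = B *m 'J c'.2 u'].

Variable alpha : 'rV[R]_N -> 'rV[R]_N -> R.

(* lambda, the restriction of alpha to the hypersurface, in the chart c *)
Definition pullback (c : chart) (u v : 'rV[R]_(n.*2)) : R :=
  alpha (c.2 u) ('D_v c.2 u).

(* lambda /\ (d lambda)^(n-1) at u *)
Definition char_form (c : chart) (u : 'rV[R]_(n.*2)) : form 'rV[R]_(n.*2) :=
  wedge 1 n.-1.*2 (form1 (pullback c u))
    (wedge_pow (form2 (extd (pullback c) u)) n.-1).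

(* The vector field X with iota_X dvol = lambda /\ (d lambda)^(n-1), where
   dvol = du_0 /\ ... /\ du_(2n-1) is the volume form of the chart; for another
   positive volume form X is multiplied by a positive function.  The i-th
   component is obtained by evaluating both sides at
   (e_0, ..., e_(i-1), e_(i+1), ..., e_(2n-1)), see [char_fieldE]. *)
Definition char_field (c : chart) (u : 'rV[R]_(n.*2)) : 'rV[R]_(n.*2) :=
  \row_i ((-1) ^+ i * char_form c u (fun j => basis R n.*2 (bump i j))).

(* (d lambda)^n evaluated at the coordinate basis *)
Definition dlambda_pow (c : chart) (u : 'rV[R]_(n.*2)) : R :=
  wedge_pow (form2 (extd (pullback c) u)) n (basis R n.*2).

Variable A : set chart.

Definition pos_tangency : set 'rV[R]_N := [set p | exists c u,
  [/\ A c, chart_dom c u, c.2 u = p, forall v, pullback c u v = 0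
    & 0 < dlambda_pow c u]].

Definition neg_tangency : set 'rV[R]_N := [set p | exists c u,
  [/\ A c, chart_dom c u, c.2 u = p, forall v, pullback c u v = 0
    & dlambda_pow c u < 0]].

Definition hs_interior : set 'rV[R]_N := [set p | exists c u,
  [/\ A c, chart_dom c u, c.2 u = p & coord u 0 < 0]].

Definition hs_boundary : set 'rV[R]_N := [set p | exists c u,
  [/\ A c, chart_dom c u, c.2 u = p & coord u 0 = 0]].

Definition discrete_tangencies : Prop :=
  forall p, (pos_tangency `|` neg_tangency) p ->
    hs_interior p /\ isolated (pos_tangency `|` neg_tangency) p.

(* The index does not depend on the chart, nor on the volume form. *)
Definition Ind (p : 'rV[R]_N) : int := xget 0 [set k | exists c u,
  [/\ A c, chart_dom c u, c.2 u = p & is_vf_index c.1 (char_field c) u k]].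

Definition contact_type_boundary : Prop :=
  hs_boundary !=set0 /\
  forall c u, A c -> chart_dom c u -> coord u 0 = 0 ->
    0 < coord (char_field c u) 0.

(* M is oriented by alpha /\ (d alpha)^n.  The contact vector field is only
   required to exist near S: multiplying its contact Hamiltonian by a cut-off
   function gives a contact vector field on the whole of M. *)
Definition convex_hypersurface (M S : set 'rV[R]_N) : Prop :=
  exists (W : set 'rV[R]_N) (Z : 'rV[R]_N -> 'rV[R]_N),
  [/\ open W, S `<=` W, contact_field M alpha W Z,
      forall c u, A c -> chart_dom c u ->
        let p := c.2 u in
        0 < wedge 1 n.*2 (form1 (alpha p)) (wedge_pow (form2 (extd alpha p)) n)
              (vcons (Z p) (fun i => 'D_(basis R n.*2 i) c.2 u))
    & forall p, hs_boundary p -> 0 < alpha p (Z p)].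

End Hypersurface.

(* dz + \sum_i (x_i dy_i - y_i dx_i) on R^(2n+1), with coordinates ordered as
   (z, x_1, y_1, ..., x_n, y_n) *)
Definition darboux_form (R : realType) (n : nat) (p v : 'rV[R]_(n.*2.+1)) : R :=
  coord v 0 +
  \sum_(i < n) (coord p i.*2.+1 * coord v i.*2.+2
                - coord p i.*2.+2 * coord v i.*2.+1).

(* The unit sphere S^(2n+1) of R^(2n+2), and the form
   \sum_i (x_i dy_i - y_i dx_i), coordinates being (x_0, y_0, ..., x_n, y_n) *)
Definition sphere (R : realType) (n : nat) : set 'rV[R]_(n.*2.+2) :=
  [set p | \sum_i (p 0 i) ^+ 2 = 1].
Arguments sphere : clear implicits.

Definition sphere_form (R : realType) (n : nat) (p v : 'rV[R]_(n.*2.+2)) : R :=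
  \sum_(i < n.+1) (coord p i.*2 * coord v i.*2.+1
                   - coord p i.*2.+1 * coord v i.*2).

Lemma det_vcons (R : realType) (m : nat) (X : 'rV[R]_m) (i : 'I_m) :
  \det (\matrix_(j < m) vcons X (fun j => basis R m (bump i j)) j)
  = (-1) ^+ i * X 0 i.
Proof.
case: m X i => [|m] X i; first by case: i.
rewrite (expand_det_col _ i) (bigD1 ord0) //= big1 ?addr0 => [|j].
  rewrite mxE /= mulrC /cofactor add0n; congr (_ * _).
  rewrite (_ : row' _ _ = 1%:M) ?det1 ?mulr1 //.
  apply/matrixP => a b; rewrite !mxE /=.
  by rewrite (can_eq (bumpK i)) eq_sym.
rewrite mxE; case: j => -[//|j] ltj _ /=.
by rewrite mxE (negbTE (neq_bump _ _)) mul0r.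
Qed.

(* The equation defining [char_field], on the basic (2n-1)-vectors. *)
Lemma char_fieldE (R : realType) (N n : nat)
    (alpha : 'rV[R]_N -> 'rV[R]_N -> R) (c : chart R N n)
    (u : 'rV[R]_(n.*2)) (i : 'I_(n.*2)) :
  let w j := basis R n.*2 (bump i j) in
  \det (\matrix_(j < n.*2) vcons (char_field alpha c u) w j)
  = char_form alpha c u w.
Proof. by rewrite /= det_vcons mxE mulrA -expr2 sqrr_sign mul1r. Qed.

(* Main.v *)
From Pilot Require Import Defs.
From HB Require Import structures.
From mathcomp Require Import all_boot all_order all_algebra all_fingroup.
From mathcomp Require Import all_classical all_reals all_analysis.
From mathcomp Require Import ring lra zify.
Import Pilot.Defs.
Import Order.TTheory GRing.Theory Num.Theory.
Import numFieldNormedType.Exports.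
Local Open Scope classical_set_scope.
Local Open Scope ring_scope.

Set Implicit Arguments.
Unset Strict Implicit.
Unset Printing Implicit Defensive.

(** Write points of R^(2n+1) as (z, q, p, w), where q = (x_0, x_1),
    p = (y_0, y_1) and w collects the other coordinates, and put
    tau = z + q.p - |q|^2 / 2.  The model hypersurface [S0] is the part L <= 2 of
    |p|^2 + |w|^2 + tau^2 = 1, where L = tau + |q + tau p / 20|^2 / 2.  It is
    the product of a disc, in which q varies, and a sphere of dimension 2n - 2.
    Its characteristic foliation is generated by a field [Xf] with q' = p and
    p' = tau (q - 2 p), which vanishes only at the two poles q = p = w = 0,
    tau = 1 or -1.  The point of this choice is that L strictly increases along
    [Xf] outside the poles ([dL_Xf_gt0]): hence [Xf] points outwards along the
    boundary L = 2.  The pole tau = 1 is the only negative tangency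
    ([neg_tangencyE]).  There the linearization of [Xf] is a saddle in the two
    planes (q_i, p_i) and has positive determinant in each other plane
    (x_i, y_i), so that the index is (-1)^2 = 1 ([index_north]); n > 1 makes
    room for two saddles.

    The hypersurface is not convex ([atlas_nonconvex]).  Let Z be a contact
    vector field positively transverse to it, and f = alpha(Z).  At a tangency f
    has the sign of the tangency; on the boundary f > 0; and where f vanishes,
    it strictly decreases along the characteristic field.  So the set f <= 0 is
    compact, contains the negative tangency, and cannot be left by flowing
    forward along the characteristic foliation.  This contradicts the existence
    of a maximum of L on it, since L increases along the flow, and increases
    from the pole tau = 1 in the direction of q ([neg_part_increase]).

    All exterior algebra is done in the symplectic space R^(2n+2), with form
    [symp].  Both contact forms are symp(P, dP) for a map P into that space, so
    the powers of d lambda become Pfaffians of Gram matrices of [symp], that is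
    determinants of frames ([pfaff_symp], [bpfaff_det]).  In this language the
    characteristic field of a conformal image of the model is a positive multiple
    of [Xf] ([derive_char_field]).  A record [setting] collects what is used of the
    embedding.  In a Darboux chart this is a dilation followed by a left
    translation of the Heisenberg group; in the sphere it is a dilation followed by
    the radial projection of the affine hyperplane 1 x R^(2n+1).  A small
    factor of dilation makes the hypersurface as small as required. *)

(** * Alternating sums over permutations and wedge products *)

Section Pfaffian.
Variable R : numFieldType.
Implicit Types (T : (nat -> nat) -> R) (W : nat -> nat -> R) (a : nat -> R).

Lemma perm_nat_ord d (s : 'S_d) (i : 'I_d) : perm_nat s i = s i.
Proof. by rewrite /perm_nat valK. Qed.

Lemma perm_nat_out d (s : 'S_d) i : (d <= i)%N -> perm_nat s i = i.
Proof. by rewrite leqNgt /perm_nat => ?; rewrite insubN. Qed.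

Lemma perm_natM d (s t : 'S_d) : perm_nat (s * t) = perm_nat t \o perm_nat s.
Proof.
apply/funext => i /=; have [id|di] := ltnP i d; last by rewrite !perm_nat_out.
by rewrite !(perm_nat_ord _ (Ordinal id)) perm_nat_ord permM.
Qed.

Definition succ_fun (f : nat -> nat) (i : nat) : nat :=
  if i is j.+1 then (f j).+1 else 0.

Lemma perm_nat_lift d (s : 'S_d) :
  perm_nat (lift_perm ord0 ord0 s) = succ_fun (perm_nat s).
Proof.
apply/funext => -[|i] /=.
  by rewrite (perm_nat_ord _ ord0) lift_perm_id.
have [id|di] := ltnP i d; last by rewrite !perm_nat_out.
rewrite (perm_nat_ord _ (Ordinal id)).
by rewrite (perm_nat_ord _ (lift ord0 (Ordinal id))) lift_perm_lift.
Qed.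

Definition altsum d T : R := \sum_(s : 'S_d) (-1) ^+ s * T (perm_nat s).

(** For each t, composing with phi t permutes the terms of the alternating sum over s,
    with the sign of t. *)
Lemma altsum_nest d l (phi : 'S_l -> 'S_d) T :
    (forall t, odd_perm (phi t) = odd_perm t) ->
  \sum_(s : 'S_d) \sum_(t : 'S_l)
     (-1) ^+ s * (-1) ^+ t * T (perm_nat s \o perm_nat (phi t))
  = l`!%:R * altsum d T.
Proof.
move=> phis; rewrite exchange_big /=.
rewrite (eq_bigr (fun=> altsum d T)) => [|t _].
  by rewrite sumr_const card_Sn mulr_natl.
rewrite /altsum (reindex_inj (mulgI (phi t)^-1%g)); apply: eq_bigr => s _.
rewrite -perm_natM mulKVg odd_permM odd_permV phis signr_addb.
by rewrite (mulrAC _ _ ((-1) ^+ t)) -signr_addb addbb mul1r.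
Qed.

(** The Pfaffian of W, multiplied by 2^k k!. *)
Definition pfaff k W : R :=
  altsum k.*2 (fun f => \prod_(i < k) W (f i.*2) (f i.*2.+1)).

(** The bordered version, which is the value of the product of a linear form and
    of the k-th power of a 2-form, up to a factor. *)
Definition bpfaff k a W : R :=
  altsum k.*2.+1
    (fun f => a (f 0%N) * \prod_(i < k) W (f i.*2.+1) (f i.*2.+2)).
End Pfaffian.

Section WedgePfaffian.
Variables (R : realType) (E : normedModType R).

Lemma wedge_powE (w : E -> E -> R) k v :
  wedge_pow (form2 w) k v = 2^-1 ^+ k * pfaff k (fun i j => w (v i) (v j)).
Proof.
elim: k v => [|k IHk] v.
  rewrite /= expr0 mul1r /pfaff /altsum (bigD1 (1%g : 'S_0)) //=.
  rewrite big_ord0 odd_perm1 expr0 mulr1 big1 ?addr0 // => s.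
  by case/eqP; apply/permP => -[].
rewrite /= /wedge.
under eq_bigr do rewrite IHk /pfaff /altsum mulrCA mulr_sumr mulr_sumr.
under eq_bigr do rewrite -mulr_sumr.
rewrite -mulr_sumr mulrA exprS.
pose phi (t : 'S_(k.*2)) : 'S_(k.+1.*2) := lift_perm ord0 ord0 (lift_perm ord0 ord0 t).
have phis t : odd_perm (phi t) = odd_perm t by rewrite !odd_lift_perm.
pose T f := \prod_(i < k.+1) w (v (f i.*2)) (v (f i.*2.+1)).
have /= := altsum_nest T phis; rewrite /pfaff -/T => H.
transitivity (((2`! * (k.*2)`!)%:R)^-1 * 2^-1 ^+ k * ((k.*2)`!%:R * altsum k.+1.*2 T)).
  rewrite -H; congr (_ * _); apply: eq_bigr => s _; apply: eq_bigr => t _.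
  rewrite /T big_ord_recl /= !perm_nat_lift /= /form2 -!mulrA; congr (_ * _).
  by rewrite mulrCA; congr (_ * (_ * _)); apply: eq_bigr => i _.
have fac0 : ((k.*2)`!%:R : R) != 0 by rewrite pnatr_eq0 -lt0n fact_gt0.
by rewrite (_ : 2`! = 2%N) // natrM; field.
Qed.

Lemma wedge1E (l : E -> R) (w : E -> E -> R) k v :
  wedge 1 k.*2 (form1 l) (wedge_pow (form2 w) k) v
  = 2^-1 ^+ k * bpfaff k (fun j => l (v j)) (fun i j => w (v i) (v j)).
Proof.
rewrite /wedge.
under eq_bigr do rewrite wedge_powE /pfaff /altsum mulrCA mulr_sumr mulr_sumr.
under eq_bigr do rewrite -mulr_sumr.
rewrite -mulr_sumr mulrA.
pose phi (t : 'S_(k.*2)) : 'S_(k.*2.+1) := lift_perm ord0 ord0 t.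
have phis t : odd_perm (phi t) = odd_perm t by rewrite !odd_lift_perm.
pose T f := l (v (f 0%N)) * \prod_(i < k) w (v (f i.*2.+1)) (v (f i.*2.+2)).
have /= := altsum_nest T phis; rewrite /bpfaff -/T => H.
transitivity (((1`! * (k.*2)`!)%:R)^-1 * 2^-1 ^+ k * ((k.*2)`!%:R * altsum k.*2.+1 T)).
  rewrite -H; congr (_ * _); apply: eq_bigr => s _; apply: eq_bigr => t _.
  rewrite /T /= !perm_nat_lift /= /form1 -!mulrA; congr (_ * _).
  by rewrite mulrCA; congr (_ * (_ * _)).
have fac0 : ((k.*2)`!%:R : R) != 0 by rewrite pnatr_eq0 -lt0n fact_gt0.
by rewrite mul1n; field.
Qed.

End WedgePfaffian.

(** * Expansion of Pfaffians *)

Section PfaffianExpansion.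
Variable R : numFieldType.
Implicit Types (T : (nat -> nat) -> R) (W : nat -> nat -> R) (a : nat -> R).

Lemma altsum_fix0 d T :
  \sum_(s : 'S_d.+1 | s ord0 == ord0) (-1) ^+ s * T (perm_nat s)
  = altsum d (fun f => T (succ_fun f)).
Proof.
rewrite (reindex (lift_perm ord0 ord0)) /=; last first.
  pose shiftdown (s : 'S_d.+1) (k : 'I_d) := odflt k (unlift ord0 (s (lift ord0 k))).
  have shiftdownK (s : 'S_d.+1) k : s ord0 = ord0 ->
      lift ord0 (shiftdown s k) = s (lift ord0 k).
    move=> s0; rewrite /shiftdown; case: unliftP => [j ->//|].
    rewrite -[X in _ = X]s0 => /perm_inj /eqP.
    by rewrite eq_sym (negbTE (neq_lift _ _)).
  have shiftdown_inj (s : 'S_d.+1) : s ord0 = ord0 -> injective (shiftdown s).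
    move=> s0 k k' /(congr1 (lift ord0)); rewrite !shiftdownK //.
    by move/perm_inj/lift_inj.
  exists (fun s : 'S_d.+1 => if pselect (s ord0 = ord0) is left s0
                             then perm (shiftdown_inj s s0) else 1%g) => s.
    move=> _; case: pselect => [s0|]; last by rewrite lift_perm_id.
    apply/permP => k; apply/(@lift_inj _ ord0).
    by rewrite permE shiftdownK // lift_perm_lift.
  rewrite inE => /eqP; case: pselect => // s0 _; apply/permP => k.
  case: (unliftP ord0 k) => [k'|] ->; last by rewrite lift_perm_id s0.
  by rewrite lift_perm_lift permE shiftdownK.
apply: eq_big => [s|s _]; first by rewrite lift_perm_id eqxx.
by rewrite odd_lift_perm perm_nat_lift.
Qed.

Lemma e0_subproof k (i : 'I_k) : (i.*2 < k.*2)%N.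
Proof. by have := ltn_ord i; lia. Qed.

Lemma e1_subproof k (i : 'I_k) : (i.*2.+1 < k.*2)%N.
Proof. by have := ltn_ord i; lia. Qed.

(** The indices 2i and 2i+1 form the i-th block of a Pfaffian. *)
Definition e0 k (i : 'I_k) : 'I_k.*2 := Ordinal (e0_subproof i).
Definition e1 k (i : 'I_k) : 'I_k.*2 := Ordinal (e1_subproof i).

Lemma e0_inj k : injective (@e0 k).
Proof. by move=> i j /(congr1 val) /= ij; apply/ord_inj; lia. Qed.

Lemma e1_inj k : injective (@e1 k).
Proof. by move=> i j /(congr1 val) /= ij; apply/ord_inj; lia. Qed.

Lemma e01_neq k (i j : 'I_k) : e0 i != e1 j.
Proof. by apply/eqP => /(congr1 val) /= ij; lia. Qed.

Lemma e01P k (p : 'I_k.*2) : (exists i, p = e0 i) \/ (exists i, p = e1 i).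
Proof.
have pk : (p./2 < k)%N by have := ltn_ord p; lia.
by case: (boolP (odd p)) => op; [right|left]; exists (Ordinal pk);
  apply/val_inj => /=; lia.
Qed.

Lemma big_ord_double (A : Type) (idx : A) (op : Monoid.com_law idx) k
    (G : 'I_k.*2 -> A) :
  \big[op/idx]_j G j = \big[op/idx]_(i < k) (op (G (e0 i)) (G (e1 i))).
Proof.
elim: k G => [|k IHk] G; first by rewrite !big_ord0.
rewrite [LHS]big_ord_recl [X in op _ X]big_ord_recl big_ord_recl Monoid.mulmA.
congr (op _ _); first by congr (op (G _) (G _)); apply/val_inj.
rewrite (IHk (fun j => G (lift ord0 (lift ord0 j)))); apply: eq_bigr => i _.
by congr (op (G _) (G _)); apply/val_inj.
Qed.

Definition blockprod k W (s : 'S_k.*2) := \prod_(i < k) W (s (e0 i)) (s (e1 i)).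

Lemma pfaffE k W : pfaff k W = \sum_(s : 'S_k.*2) (-1) ^+ s * blockprod W s.
Proof.
apply: eq_bigr => s _; congr (_ * _); apply: eq_bigr => i _.
by rewrite (perm_nat_ord _ (e0 i)) (perm_nat_ord _ (e1 i)).
Qed.

(** The Laplace expansion of a Pfaffian along its first row. The blocks of a
   permutation can be permuted and reversed freely, so each of the 2(k+1)
   possible positions of the index 0 contributes the same amount. *)
Lemma pfaffS k W : (forall i j, W i j = - W j i) ->
  pfaff k.+1 W = k.+1.*2%:R
    * bpfaff k (fun j => W 0%N j.+1) (fun i j => W i.+1 j.+1).
Proof.
move=> Wanti; pose F (s : 'S_k.+1.*2) := (-1) ^+ s * blockprod W s.
have F0 : \sum_(s : 'S_k.+1.*2 | s ord0 == ord0) F s =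
    bpfaff k (fun j => W 0%N j.+1) (fun i j => W i.+1 j.+1).
  pose T f := \prod_(i < k.+1) W (f i.*2) (f i.*2.+1).
  transitivity (\sum_(s : 'S_k.+1.*2 | s ord0 == ord0) (-1) ^+ s * T (perm_nat s)).
    apply: eq_bigr => s _; congr (_ * _); apply: eq_bigr => i _.
    by rewrite (perm_nat_ord _ (e0 i)) (perm_nat_ord _ (e1 i)).
  rewrite altsum_fix0; apply: eq_bigr => s _; congr (_ * _).
  by rewrite /T big_ord_recl.
have Fe0 i : \sum_(s : 'S_k.+1.*2 | s (e0 i) == ord0) F s = \sum_(s : 'S_k.+1.*2 | s ord0 == ord0) F s.
  have -> : ord0 = e0 ord0 :> 'I_k.+1.*2 by apply/val_inj.
  set pi := (tperm (e0 ord0) (e0 i) * tperm (e1 ord0) (e1 i))%g.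
  have pi0 j : pi (e0 j) = e0 (tperm ord0 i j).
    rewrite /pi permM; case: (tpermP ord0 i j) => [->|->|/eqP j0 /eqP ji].
    - by rewrite tpermL tpermD // eq_sym e01_neq.
    - by rewrite tpermR tpermD // eq_sym e01_neq.
    - rewrite [X in tperm _ _ X]tpermD ?(inj_eq (@e0_inj _)) 1?eq_sym //.
      by rewrite tpermD // eq_sym e01_neq.
  have pi1 j : pi (e1 j) = e1 (tperm ord0 i j).
    rewrite /pi permM [X in tperm _ _ X]tpermD ?e01_neq //.
    case: (tpermP ord0 i j) => [->|->|/eqP j0 /eqP ji].
    - by rewrite tpermL.
    - by rewrite tpermR.
    - by rewrite tpermD // (inj_eq (@e1_inj _)) eq_sym.
  rewrite (reindex_inj (mulgI pi)); apply: eq_big => [s|s _].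
    by rewrite permM pi0 tpermR.
  rewrite /F odd_permM odd_permM !odd_tperm.
  rewrite (inj_eq (@e0_inj _)) (inj_eq (@e1_inj _)) addbb addFb; congr (_ * _).
  rewrite /blockprod [RHS](reindex_inj (@perm_inj _ (tperm ord0 i))).
  by apply: eq_bigr => j _; rewrite -pi0 -pi1 -!(permM pi).
have Fe1 i : \sum_(s : 'S_k.+1.*2 | s (e1 i) == ord0) F s = \sum_(s : 'S_k.+1.*2 | s (e0 i) == ord0) F s.
  set pi := tperm (e0 i) (e1 i).
  rewrite (reindex_inj (mulgI pi)); apply: eq_big => [s|s _].
    by rewrite permM tpermR.
  rewrite /F odd_permM odd_tperm e01_neq addTb signrN mulNr -mulrN.
  congr (_ * _); rewrite /blockprod [in LHS](bigD1 i) // [in RHS](bigD1 i) //=.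
  rewrite !permM tpermL tpermR Wanti mulNr opprK; congr (_ * _).
  apply: eq_bigr => j ji; rewrite !permM !tpermD ?e01_neq // 1?eq_sym ?e01_neq //.
  - by rewrite (inj_eq (@e1_inj _)).

  - by rewrite (inj_eq (@e0_inj _)).
rewrite pfaffE (partition_big (fun s : 'S_k.+1.*2 => s^-1%g ord0) predT) //=.
rewrite (eq_bigr (fun=> \sum_(s : 'S_k.+1.*2 | s ord0 == ord0) F s)) => [|p _].
  by rewrite sumr_const card_ord F0 mulr_natl.
have -> : \sum_(s : 'S_k.+1.*2 | s^-1%g ord0 == p) F s
    = \sum_(s : 'S_k.+1.*2 | s p == ord0) F s.
  by apply: eq_bigl => s; rewrite -(inj_eq (@perm_inj _ s)) permKV eq_sym.
by case: (e01P p) => -[i ->]; rewrite ?Fe1 Fe0.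
Qed.

(** Only the permutations fixing 0 contribute. *)
Lemma bpfaff0 k a W : (forall j, a j.+1 = 0) ->
  bpfaff k a W = a 0%N * pfaff k (fun i j => W i.+1 j.+1).
Proof.
move=> a0; rewrite /bpfaff /altsum (bigID (fun s : 'S_k.*2.+1 => s ord0 == ord0)) /=.
rewrite [X in _ + X]big1 ?addr0 => [|s s0]; last first.
  rewrite (perm_nat_ord _ ord0); case: (unliftP ord0 (s ord0)) s0 => [j ->|->].
    by rewrite a0 mul0r mulr0.
  by rewrite eqxx.
rewrite (altsum_fix0 _ (fun f => a (f 0%N) * \prod_(i < k) W (f i.*2.+1) (f i.*2.+2))).
by rewrite /altsum mulr_sumr; apply: eq_bigr => s _; rewrite mulrCA.
Qed.

Lemma pfaff_peel k W : (forall i j, W i j = - W j i) ->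
    (forall j, W 0%N j.+2 = 0) ->
  pfaff k.+1 W = k.+1.*2%:R * (W 0%N 1%N * pfaff k (fun i j => W i.+2 j.+2)).
Proof. by move=> Wanti W0; rewrite pfaffS // bpfaff0. Qed.

(** Congruence W = V O V^T multiplies the Pfaffian by det V: after expanding all
    entries, alternation kills the choices with a repeated index. *)
Lemma pfaff_det k (V : 'M[R]_k.*2) (W O : nat -> nat -> R) :
    (forall i j : 'I_k.*2, W i j = \sum_a \sum_b V i a * V j b * O a b) ->
  pfaff k W = \det V * pfaff k O.
Proof.
pose col (f : {ffun 'I_k -> 'I_k.*2 * 'I_k.*2}) (j : 'I_k.*2) :=
  if odd j then (f (Ordinal (ltac:(have := ltn_ord j; lia) : (j./2 < k)%N))).2
  else (f (Ordinal (ltac:(have := ltn_ord j; lia) : (j./2 < k)%N))).1.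
have col0 f i : col f (e0 i) = (f i).1.
  by rewrite /col /= odd_double; congr (f _).1; apply/val_inj => /=; lia.
have col1 f i : col f (e1 i) = (f i).2.
  by rewrite /col /= odd_double; congr (f _).2; apply/val_inj => /=; lia.
have expand (V' : 'M[R]_k.*2) W' :
    (forall i j : 'I_k.*2, W' i j = \sum_a \sum_b V' i a * V' j b * O a b) ->
    pfaff k W' = \sum_(f : {ffun 'I_k -> 'I_k.*2 * 'I_k.*2}) (\prod_i O (f i).1 (f i).2) * \det (rowsub (col f) V'^T).
  move=> W'E; rewrite pfaffE.
  under eq_bigr => s _.
    rewrite /blockprod; under eq_bigr do rewrite W'E pair_big.
    rewrite bigA_distr_bigA mulr_sumr; over.
  rewrite exchange_big /=; apply: eq_bigr => f _.
  rewrite mulr_sumr; apply: eq_bigr => s _.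
  rewrite mulrCA; congr (_ * _); rewrite big_ord_double -big_split /=.
  by apply: eq_bigr => i _; rewrite !mxE col0 col1 mulrC.
move=> WE; rewrite (expand _ _ WE) (expand 1%:M O) => [|i j]; last first.
  rewrite (bigD1 i) //= (bigD1 j) //= !mxE !eqxx !mul1r.
  rewrite !big1 ?addr0 // => [a ai|b bj].
    by rewrite big1 // => b _; rewrite !mxE eq_sym (negbTE ai) !mul0r.
  by rewrite !mxE (eq_sym j) (negbTE bj) mulr0 mul0r.
rewrite mulr_sumr; apply: eq_bigr => f _; rewrite mulrCA; congr (_ * _).
have -> : rowsub (col f) V^T = rowsub (col f) 1%:M^T *m V^T.
  by rewrite trmx1 mul_rowsub_mx mul1mx.
by rewrite det_mulmx det_tr mulrC.
Qed.

End PfaffianExpansion.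

(** * Coordinates and the standard symplectic form *)

Section Coord.
Variables (R : realType) (m : nat).
Implicit Types u v : 'rV[R]_m.

Lemma coord_ord u (i : 'I_m) : coord u i = u 0 i.
Proof. by rewrite /coord valK. Qed.

Lemma coord_out u k : (m <= k)%N -> coord u k = 0.
Proof. by rewrite leqNgt /coord => mk; rewrite insubN. Qed.

Lemma coordP u v : (forall k, (k < m)%N -> coord u k = coord v k) <-> u = v.
Proof.
split=> [uv|-> //]; apply/rowP => i.
by rewrite -!coord_ord; apply: uv.
Qed.

Lemma coord0 k : coord (0 : 'rV[R]_m) k = 0.
Proof. by rewrite /coord; case: insub => //= i; rewrite mxE. Qed.

Lemma coordD u v k : coord (u + v) k = coord u k + coord v k.
Proof. by rewrite /coord; case: insub => [i|] /=; rewrite ?mxE ?addr0. Qed.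

Lemma coordN u k : coord (- u) k = - coord u k.
Proof. by rewrite /coord; case: insub => [i|] /=; rewrite ?mxE ?oppr0. Qed.

Lemma coordB u v k : coord (u - v) k = coord u k - coord v k.
Proof. by rewrite coordD coordN. Qed.

Lemma coordZ a u k : coord (a *: u) k = a * coord u k.
Proof. by rewrite /coord; case: insub => [i|] /=; rewrite ?mxE ?mulr0. Qed.

Lemma coord_sum I (r : seq I) (F : I -> 'rV[R]_m) k :
  coord (\sum_(i <- r) F i) k = \sum_(i <- r) coord (F i) k.
Proof.
by elim/big_rec2: _ => [|i y1 y2 _ <-]; rewrite ?coord0 // coordD.
Qed.

Definition rowf (f : nat -> R) : 'rV[R]_m := \row_i f i.

Lemma coord_rowf f k : coord (rowf f) k = if (k < m)%N then f k else 0.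
Proof. by rewrite /coord; case: insubP => [i -> <-|/negbTE ->] //=; rewrite mxE. Qed.

Lemma coord_basis k j : coord (basis R m k) j = (j == k)%:R *+ (j < m)%N.
Proof.
by rewrite [basis _ _ _](_ : _ = rowf (fun j => (j == k)%:R)) // coord_rowf; case: ltnP.
Qed.

Lemma basis_out k : (m <= k)%N -> basis R m k = 0.
Proof.
move=> mk; apply/rowP => j; rewrite !mxE; case: eqP => // jk.
by have := ltn_ord j; lia.
Qed.

Lemma row_sum_basis u : u = \sum_(i < m) u 0 i *: basis R m i.
Proof.
apply/rowP => j; rewrite summxE (bigD1 j) //= !mxE eqxx mulr1 big1 ?addr0 //.
by move=> i ij; rewrite !mxE eq_sym (negbTE ij : (i == j :> nat) = false) mulr0.
Qed.

End Coord.

Section Symplectic.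
Variable R : realType.

(** The standard symplectic form on R^2m, coordinates being paired as
   (0, 1), (2, 3), and so on. *)
Definition symp m (a b : 'rV[R]_(m.*2)) : R :=
  \sum_(i < m) (coord a i.*2 * coord b i.*2.+1 - coord a i.*2.+1 * coord b i.*2).

(** The Gram matrix of [symp] on the standard basis. *)
Definition symp_coef (i j : nat) : R :=
  ((i.+1 == j) && ~~ odd i)%:R - ((j.+1 == i) && ~~ odd j)%:R.

Lemma sympC m (a b : 'rV[R]_(m.*2)) : symp a b = - symp b a.
Proof.
rewrite /symp -sumrN; apply: eq_bigr => i _.
by rewrite opprB ![coord b _ * _]mulrC.
Qed.

Lemma symp_self m (a : 'rV[R]_(m.*2)) : symp a a = 0.
Proof. by rewrite /symp big1 // => i _; rewrite [coord a _.+1 * _]mulrC subrr. Qed.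

Lemma sympDl m (a b c : 'rV[R]_(m.*2)) : symp (a + b) c = symp a c + symp b c.
Proof.
rewrite /symp -big_split; apply: eq_bigr => i _.
by rewrite !coordD /=; ring.
Qed.

Lemma sympZl m k (a b : 'rV[R]_(m.*2)) : symp (k *: a) b = k * symp a b.
Proof.
rewrite /symp mulr_sumr; apply: eq_bigr => i _.
by rewrite !coordZ; ring.
Qed.

Lemma sympDr m (a b c : 'rV[R]_(m.*2)) : symp a (b + c) = symp a b + symp a c.
Proof. by rewrite sympC sympDl opprD -!sympC. Qed.

Lemma sympZr m k (a b : 'rV[R]_(m.*2)) : symp a (k *: b) = k * symp a b.
Proof. by rewrite sympC sympZl -mulrN -sympC. Qed.

Lemma symp0r m (a : 'rV[R]_(m.*2)) : symp a 0 = 0.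
Proof. by rewrite -(scale0r 0) sympZr mul0r. Qed.

Lemma symp_coef_even i j : symp_coef i.*2 j = (j == i.*2.+1)%:R.
Proof.
rewrite /symp_coef odd_double andbT eq_sym.
have -> : (j.+1 == i.*2) && ~~ odd j = false.
  by apply/negP => /andP[/eqP ji oj]; have := odd_double i; rewrite -ji /= oj.
by rewrite subr0.
Qed.

Lemma symp_coef_odd i j : symp_coef i.*2.+1 j = - (j == i.*2)%:R.
Proof.
rewrite /symp_coef /= odd_double andbF sub0r eqSS.
by case: (j =P i.*2) => [->|] //; rewrite odd_double.
Qed.

Lemma symp_coefE m (a b : 'rV[R]_(m.*2)) :
  symp a b = \sum_i \sum_j a 0 i * b 0 j * symp_coef i j.
Proof.
rewrite big_ord_double; apply: eq_bigr => i _.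
rewrite (bigD1 (e1 i)) //= big1 ?addr0 => [|j ji]; last first.
  by rewrite symp_coef_even (negbTE ji : (j == i.*2.+1 :> nat) = false) mulr0.
rewrite (bigD1 (e0 i)) //= big1 ?addr0 => [|j ji]; last first.
  by rewrite symp_coef_odd (negbTE ji : (j == i.*2 :> nat) = false) oppr0 mulr0.
by rewrite -!coord_ord /= symp_coef_even symp_coef_odd !eqxx mulr1 mulrN1.
Qed.

Definition pfaff_std m : R := pfaff m symp_coef.

Lemma pfaff_std_gt0 m : 0 < pfaff_std m.
Proof.
rewrite /pfaff_std; elim: m => [|m IHm].
  rewrite /pfaff /altsum (bigD1 (1%g : 'S_0)) //=.
  rewrite big_ord0 odd_perm1 expr0 mulr1 big1 ?addr0 // => s.
  by case/eqP; apply/permP => -[].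
rewrite pfaff_peel => [|i j|j].
- have -> : (fun i j => symp_coef i.+2 j.+2) = symp_coef.
    by apply/funext => i; apply/funext => j; rewrite /symp_coef /= !negbK.
  have -> : symp_coef 0 1 = 1 by rewrite /symp_coef /= subr0.
  by rewrite mul1r; apply: mulr_gt0 => //; rewrite ltr0n.
- by rewrite /symp_coef opprB.
- by rewrite /symp_coef /= subr0.
Qed.

Section Gram.
Variable m : nat.
Implicit Type v : nat -> 'rV[R]_(m.*2).

Lemma pfaff_symp v :
  pfaff m (fun i j => symp (v i) (v j))
  = \det (\matrix_(i < m.*2) v i) * pfaff_std m.
Proof.
apply: pfaff_det => i j; rewrite symp_coefE.
by apply: eq_bigr => a _; apply: eq_bigr => b _; rewrite !mxE.
Qed.

End Gram.

Section Expansions.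
Variable n : nat.
Implicit Types (p b c r : 'rV[R]_(n.+1.*2)) (v : nat -> 'rV[R]_(n.+1.*2)).

Lemma symp_anti v i j : symp (v i) (v j) = - symp (v j) (v i).
Proof. exact: sympC. Qed.

Lemma bpfaff_det p v :
  n.+1.*2%:R * bpfaff n (fun j => symp p (v j)) (fun i j => symp (v i) (v j))
  = \det (\matrix_(i < n.+1.*2) vcons p v i) * pfaff_std n.+1.
Proof. by rewrite -pfaff_symp pfaffS // => i j; apply: symp_anti. Qed.

(** If p is orthogonal to the v_i, the first row of the Gram matrix of
    (p, r, v_0, v_1, ...) has a single nonzero entry. *)
Lemma pfaff_kernel p r v : (forall j, symp p (v j) = 0) ->
  n.+1.*2%:R * (symp p r * pfaff n (fun i j => symp (v i) (v j)))
  = \det (\matrix_(i < n.+1.*2) vcons p (vcons r v) i) * pfaff_std n.+1.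
Proof.
move=> pv; rewrite -pfaff_symp pfaff_peel //= => i j; exact: symp_anti.
Qed.

End Expansions.

(** Two successive expansions of the Gram matrix of (b, c, p, v_0, ...), whose
    first row has a single nonzero entry. *)
Lemma bpfaff_hyperplane n (b c p : 'rV[R]_(n.+2.*2)) v :
    symp b p = 0 -> (forall j, symp b (v j) = 0) ->
  n.+2.*2%:R * (symp b c * (n.+1.*2%:R *
     bpfaff n (fun j => symp p (v j)) (fun i j => symp (v i) (v j))))
  = \det (\matrix_(i < n.+2.*2) vcons b (vcons c (vcons p v)) i) * pfaff_std n.+2.
Proof.
move=> bp bv; rewrite -pfaff_symp pfaff_peel => [|i j|[|j]] //=.
- by rewrite pfaffS // => i j; apply: sympC.
- by apply: sympC.
Qed.

End Symplectic.

(** * Smooth functions *)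

Lemma near_eq_differentiable (R : numFieldType) (V W : normedModType R)
    (f g : V -> W) (x : V) :
  (\forall y \near x, f y = g y) -> differentiable f x -> differentiable g x.
Proof.
move=> fg /diffP[dfc fE]; apply/diffP.
apply: (@getPex _ (fun (df : {linear V -> W}) => continuous df /\
  forall y, g y = g (lim (nbhs x)) + df (y - lim (nbhs x))
                  +o_(y \near x) (y - lim (nbhs x)))).
exists ('d f x); split=> //.
suff H : g = (fun y => g (lim (nbhs x)) + 'd f x (y - lim (nbhs x)))
             +o_x (fun y => y - lim (nbhs x)).
  by move=> y; rewrite {1}H.
have F : f = (fun y => f (lim (nbhs x)) + 'd f x (y - lim (nbhs x)))
             +o_x (fun y => y - lim (nbhs x)).
  by apply/funext => y; exact: fE.
apply/eqaddoP => e e0; have /eqaddoP /(_ e e0) := F.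
rewrite !lim_id //= (nbhs_singleton fg); apply: filterS2 fg => y.
by move=> fgy; rewrite !fctE -fgy.
Qed.

Section Ck.
Variables (R : realType) (V : normedModType R).
Implicit Types (U : set V) (k : nat).

(** Unlike [diff_order], every level of this hierarchy contains the
    differentiability of the function itself, which inductions on products need. *)
Fixpoint Ck (W : normedModType R) k U (f : V -> W) : Prop :=
  (forall x, U x -> differentiable f x) /\
  (if k is k'.+1 then forall v, Ck k' U ('D_v f) else True).

Lemma Ck_diff (W : normedModType R) k U (f : V -> W) x :
  Ck k U f -> U x -> differentiable f x.
Proof. by case: k => [|k] [+ _]; apply. Qed.

Lemma CkW (W : normedModType R) k U U' (f : V -> W) :
  U' `<=` U -> Ck k U f -> Ck k U' f.
Proof.
move=> UU; elim: k f => [|k IHk] f [df kf]; split=> //.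
- by move=> x /UU; apply: df.
- by move=> x /UU; apply: df.
- by move=> v; exact: IHk (kf v).
Qed.

Lemma CkS (W : normedModType R) k U (f : V -> W) : Ck k.+1 U f -> Ck k U f.
Proof.
elim: k f => [|k IHk] f [df kf]; split=> // v.
by apply: IHk; apply: kf.
Qed.

Lemma smooth_Ck (W : normedModType R) U (f : V -> W) :
  smooth U f <-> forall k, Ck k U f.
Proof.
split=> [+ k|kf k]; last first.
  elim: k f kf => [|k IHk] f kf; first by have [] := kf 0%N.
  by move=> v; apply: IHk => j; have [_] := kf j.+1; apply.
elim: k f => [|k IHk] f sf; split=> //; try exact: (sf 0%N).
by move=> v; apply: IHk => j; apply: (sf j.+1).
Qed.

Lemma Ck_ext (W : normedModType R) k U (f g : V -> W) : open U ->
  (forall x, U x -> f x = g x) -> Ck k U f -> Ck k U g.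
Proof.
move=> oU; have near_ext (h h' : V -> W) x : (forall x, U x -> h x = h' x) ->
    U x -> \forall y \near x, h y = h' y.
  by move=> hh' Ux; apply: filterS hh' _; apply: open_nbhs_nbhs.
elim: k f g => [|k IHk] f g fg [df kf]; split=> //.
- by move=> x Ux; apply: near_eq_differentiable (df x Ux); apply: near_ext.
- by move=> x Ux; apply: near_eq_differentiable (df x Ux); apply: near_ext.
move=> v; apply: IHk (kf v) => x Ux; apply: near_eq_derive.
exact: near_ext.
Qed.

Lemma Ck_cst (W : normedModType R) k U (a : W) : Ck k U (fun=> a).
Proof.
elim: k a => [|k IHk] a; split=> //; try by move=> x _; apply: differentiable_cst.
move=> v; have -> : 'D_v (fun=> a) = fun=> 0 :> W by apply/funext => x; exact: derive_cst.
exact: IHk.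
Qed.

Lemma CkD (W : normedModType R) k U (f g : V -> W) : open U ->
  Ck k U f -> Ck k U g -> Ck k U (fun x => f x + g x).
Proof.
move=> oU; elim: k f g => [|k IHk] f g [df kf] [dg kg]; split=> //;
  try by move=> x Ux; apply: differentiableD; [apply: df|apply: dg].
move=> v; apply: Ck_ext (IHk _ _ (kf v) (kg v)) => // x Ux.
by rewrite -deriveD //; apply: diff_derivable; [apply: df|apply: dg].
Qed.

Lemma CkM k U (f g : V -> R) : open U ->
  Ck k U f -> Ck k U g -> Ck k U (fun x => f x * g x).
Proof.
move=> oU; elim: k f g => [|k IHk] f g kf kg.
  split=> // x Ux; apply: differentiableM; [exact: Ck_diff kf _|exact: Ck_diff kg _].
split=> [x Ux|v].
  by apply: differentiableM; [exact: Ck_diff kf _|exact: Ck_diff kg _].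
have H : Ck k U (fun x => f x * 'D_v g x + g x * 'D_v f x).
  by apply: CkD => //; apply: IHk; try exact: CkS; [exact: (proj2 kg v)|exact: (proj2 kf v)].
apply: Ck_ext H => // x Ux; rewrite [RHS]deriveM //.
- exact/diff_derivable/(Ck_diff kf).
- exact/diff_derivable/(Ck_diff kg).
Qed.

Lemma CkV k U (f : V -> R) : open U -> (forall x, U x -> f x != 0) ->
  Ck k U f -> Ck k U (fun x => (f x)^-1).
Proof.
move=> oU f0; elim: k => [|k IHk] kf.
  by split=> // x Ux; apply: differentiableV; [exact: Ck_diff kf _|exact: f0].
split=> [x Ux|v].
  by apply: differentiableV; [exact: Ck_diff kf _|exact: f0].
have kV := IHk (CkS kf).
have H : Ck k U (fun x => -1 * ((f x)^-1 * (f x)^-1) * 'D_v f x).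
  apply: CkM => //; last exact: (proj2 kf v).
  by apply: CkM => //; [exact: Ck_cst|exact: CkM].
apply: Ck_ext H => // x Ux.
rewrite [RHS]deriveV ?f0 //; last exact/diff_derivable/(Ck_diff kf).
by rewrite mulN1r -invfM -expr2.
Qed.

Lemma derive_sqrt (f : V -> R) x v : 0 < f x -> differentiable f x ->
  differentiable (fun y => Num.sqrt (f y)) x /\
  'D_v (fun y => Num.sqrt (f y)) x = (2 * Num.sqrt (f x))^-1 * 'D_v f x.
Proof.
move=> f0 df; have ds := is_derive1_sqrt f0.
have sd : differentiable (Num.sqrt : R -> R) (f x).
  exact/derivable1_diffP/ex_derive.
have dsf : differentiable (Num.sqrt \o f) x by apply: differentiable_comp.
split=> //; rewrite (deriveE _ dsf) diff_comp //= (deriveE _ df).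
rewrite -[in LHS](mulr1 ('d f x v)) -[_ * 1]/(_ *: 1) linearZ /=.
have -> : 'd Num.sqrt (f x) 1 = (2 * Num.sqrt (f x))^-1 :> R.
  by rewrite -deriveE //; case: ds.
by rewrite [LHS]mulrC.
Qed.

Lemma Ck_sqrt k U (f : V -> R) : open U -> (forall x, U x -> 0 < f x) ->
  Ck k U f -> Ck k U (fun x => Num.sqrt (f x)).
Proof.
move=> oU f0; elim: k => [|k IHk] kf.
  by split=> // x Ux; have [] := derive_sqrt 0 (f0 x Ux) (Ck_diff kf Ux).
split=> [x Ux|v]; first by have [] := derive_sqrt 0 (f0 x Ux) (Ck_diff kf Ux).
have kV := IHk (CkS kf).
have H : Ck k U (fun x => (2 * Num.sqrt (f x))^-1 * 'D_v f x).
  apply: CkM => //; last exact: (proj2 kf v).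
  apply: CkV => [//|x Ux|]; first by rewrite mulf_neq0 // gt_eqF // sqrtr_gt0 f0.
  by apply: CkM => //; exact: Ck_cst.
apply: Ck_ext H => // x Ux.
by have [_ ->] := derive_sqrt v (f0 x Ux) (Ck_diff kf Ux).
Qed.

End Ck.

Section CoordCalculus.
Variables (R : realType) (V : normedModType R) (m : nat).
Implicit Types (U : set V) (c : V -> 'rV[R]_m).

Lemma differentiable_coordn k (u : 'rV[R]_m) :
  differentiable (fun u => coord u k) u.
Proof.
rewrite /coord; case: insub => [i|] /=; last exact: differentiable_cst.
exact: differentiable_coord.
Qed.

Lemma differentiable_coord_comp c k x : differentiable c x ->
  differentiable (fun y => coord (c y) k) x.
Proof.
move=> dc; apply: (@differentiable_comp _ _ _ _ c (fun u => coord u k)) => //.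
exact: differentiable_coordn.
Qed.

Lemma derive_coord c k x v : differentiable c x ->
  'D_v (fun y => coord (c y) k) x = coord ('D_v c x) k.
Proof.
move=> dc; rewrite derive_mx; last exact: diff_derivable.
rewrite /coord; case: insub => [i|] /=; last exact: derive_cst.
by rewrite mxE.
Qed.

Lemma differentiable_rowP c x :
  (forall i, differentiable (fun y => coord (c y) i) x) -> differentiable c x.
Proof.
move=> dc; have -> : c = \sum_(i < m) (fun y => coord (c y) i *: basis R m i).
  apply/funext => y; rewrite fct_sumE {1}[c y]row_sum_basis.
  by apply: eq_bigr => i _; rewrite coord_ord.
apply: differentiable_sum => i; exact: differentiableZl.
Qed.

Lemma Ck_rowP k U c : open U ->
  Ck k U c <-> forall i, Ck k U (fun y => coord (c y) i).
Proof.
move=> oU; split=> [+ i|].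
  elim: k c => [|k IHk] c kc.
    by split=> // x Ux; apply: differentiable_coord_comp; exact: Ck_diff kc _.
  split=> [x Ux|v].
    by apply: differentiable_coord_comp; exact: Ck_diff kc _.
  have /IHk := proj2 kc v.
  by apply: Ck_ext => // x Ux; rewrite derive_coord //; exact: Ck_diff kc _.
elim: k c => [|k IHk] c kc.
  split=> // x Ux; apply: differentiable_rowP => i; exact: Ck_diff (kc i) _.
have dc x : U x -> differentiable c x.
  by move=> Ux; apply: differentiable_rowP => i; exact: Ck_diff (kc i) _.
split=> // v; apply: IHk => i; have [_ /(_ v)] := kc i.
by apply: Ck_ext => // x Ux; rewrite derive_coord //; exact: dc.
Qed.

End CoordCalculus.

Section SmoothAPI.
Variables (R : realType) (V : normedModType R) (U : set V).
Hypothesis oU : open U.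

Lemma smooth_ext (W : normedModType R) (f g : V -> W) :
  (forall x, U x -> f x = g x) -> smooth U f -> smooth U g.
Proof. by move=> fg /smooth_Ck sf; apply/smooth_Ck => k; apply: Ck_ext (sf k). Qed.

Lemma smoothW (W : normedModType R) (f : V -> W) U' :
  U' `<=` U -> smooth U f -> smooth U' f.
Proof. by move=> UU /smooth_Ck sf; apply/smooth_Ck => k; apply: CkW (sf k). Qed.

Lemma smooth_diff (W : normedModType R) (f : V -> W) x :
  smooth U f -> U x -> differentiable f x.
Proof. by move=> sf; apply: (sf 0%N). Qed.

Lemma smooth_derive (W : normedModType R) (f : V -> W) v :
  smooth U f -> smooth U ('D_v f).
Proof. by move=> sf k; apply: (sf k.+1). Qed.

Lemma smooth_cst (W : normedModType R) (a : W) : smooth U (fun=> a).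
Proof. by apply/smooth_Ck => k; exact: Ck_cst. Qed.

Lemma smoothD (W : normedModType R) (f g : V -> W) :
  smooth U f -> smooth U g -> smooth U (fun x => f x + g x).
Proof. by move=> /smooth_Ck sf /smooth_Ck sg; apply/smooth_Ck => k; apply: CkD. Qed.

Lemma smoothM (f g : V -> R) :
  smooth U f -> smooth U g -> smooth U (fun x => f x * g x).
Proof. by move=> /smooth_Ck sf /smooth_Ck sg; apply/smooth_Ck => k; apply: CkM. Qed.

Lemma smoothN (f : V -> R) : smooth U f -> smooth U (fun x => - f x).
Proof.
move=> sf; apply: (smooth_ext (f := fun x => -1 * f x)) => [x _|].
  by rewrite mulN1r.
by apply: smoothM => //; exact: smooth_cst.
Qed.

Lemma smoothB (f g : V -> R) :
  smooth U f -> smooth U g -> smooth U (fun x => f x - g x).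
Proof. by move=> sf sg; apply: smoothD => //; exact: smoothN. Qed.

Lemma smoothX (f : V -> R) k : smooth U f -> smooth U (fun x => f x ^+ k).
Proof.
move=> sf; elim: k => [|k IHk].
  apply: (smooth_ext (f := fun=> 1 : R)) => [x _|]; last exact: smooth_cst.
  by rewrite expr0.
apply: (smooth_ext (f := fun x => f x * f x ^+ k)) => [x _|].
  by rewrite exprS.
exact: smoothM.
Qed.

Lemma smoothV (f : V -> R) : (forall x, U x -> f x != 0) ->
  smooth U f -> smooth U (fun x => (f x)^-1).
Proof. by move=> f0 /smooth_Ck sf; apply/smooth_Ck => k; apply: CkV. Qed.

Lemma smooth_sqrt (f : V -> R) : (forall x, U x -> 0 < f x) ->
  smooth U f -> smooth U (fun x => Num.sqrt (f x)).
Proof. by move=> f0 /smooth_Ck sf; apply/smooth_Ck => k; apply: Ck_sqrt. Qed.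

Lemma smooth_sum I (r : seq I) (P : pred I) (F : I -> V -> R) :
  (forall i, smooth U (F i)) -> smooth U (fun x => \sum_(i <- r | P i) F i x).
Proof.
move=> sF; elim: r => [|i r IHr].
  apply: (smooth_ext (f := fun=> 0 : R)) => [x _|]; last exact: smooth_cst.
  by rewrite big_nil.
case Pi : (P i).
  apply: (smooth_ext _ (smoothD (sF i) IHr)) => x _; by rewrite big_cons Pi.
by apply: (smooth_ext _ IHr) => x _; rewrite big_cons Pi.
Qed.

Lemma smooth_rowP m (c : V -> 'rV[R]_m) :
  smooth U c <-> forall i, smooth U (fun y => coord (c y) i).
Proof.
split=> [/smooth_Ck sc i|sc]; apply/smooth_Ck => k.
  exact: (Ck_rowP k c oU).1 (sc k) i.
by apply/Ck_rowP => // i; have /smooth_Ck := sc i; apply.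
Qed.

Lemma smooth_rowf m (f : V -> nat -> R) :
  (forall i, smooth U (fun y => f y i)) -> smooth U (fun y => rowf m (f y)).
Proof.
move=> sf; apply/smooth_rowP => i.
apply: (smooth_ext (f := fun y => if (i < m)%N then f y i else 0)) => [x _|].
  by rewrite coord_rowf.
by case: (i < m)%N; [exact: sf|exact: smooth_cst].
Qed.

End SmoothAPI.

Lemma smooth_coord (R : realType) m (U : set 'rV[R]_m) i : open U ->
  smooth U (fun u => coord u i).
Proof.
move=> oU; apply/smooth_Ck => -[|k].
  by split=> // x _; exact: differentiable_coordn.
split=> [x _|v]; first exact: differentiable_coordn.
apply: (Ck_ext oU (f := fun=> coord v i)); last exact: Ck_cst.
move=> x _; have := @derive_coord _ _ _ (@id 'rV[R]_m) i x v; rewrite /= => -> //.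
by rewrite derive_id.
Qed.

Lemma smooth_id (R : realType) m (U : set 'rV[R]_m) : open U -> smooth U id.
Proof. by move=> oU; apply/smooth_rowP => // i; exact: smooth_coord. Qed.

(** * Chain rule, mean value theorem and symmetry of second derivatives *)

Section MoreCalculus.
Variable R : realType.

Lemma derive_comp (U V W : normedModType R) (c : U -> V) (f : V -> W) u v :
  differentiable c u -> differentiable f (c u) ->
  'D_v (fun x => f (c x)) u = 'D_('D_v c u) f (c u).
Proof.
move=> dc df; have dfc : differentiable (f \o c) u by exact: differentiable_comp.
transitivity ('d (f \o c) u v); first exact: deriveE.
by rewrite (diff_comp dc df) (deriveE v dc) (deriveE _ df).
Qed.

Lemma derive_sum_basis m (W : normedModType R) (f : 'rV[R]_m -> W) x v :
  differentiable f x -> 'D_v f x = \sum_(j < m) v 0 j *: 'D_(basis R m j) f x.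
Proof.
move=> df; rewrite deriveE // {1}[v]row_sum_basis linear_sum.
by apply: eq_bigr => j _; rewrite linearZ deriveE.
Qed.

Lemma deriveDv (V W : normedModType R) (f : V -> W) x v w :
  differentiable f x -> 'D_(v + w) f x = 'D_v f x + 'D_w f x.
Proof. by move=> df; rewrite !deriveE // linearD. Qed.

Lemma deriveZv (V W : normedModType R) (f : V -> W) x a v :
  differentiable f x -> 'D_(a *: v) f x = a *: 'D_v f x.
Proof. by move=> df; rewrite !deriveE // linearZ. Qed.

Lemma is_derive_line (V W : normedModType R) (f : V -> W) x v t :
  differentiable f (x + t *: v) ->
  is_derive t 1 (fun s : R => f (x + s *: v)) ('D_v f (x + t *: v)).
Proof.
move=> df; pose c (s : R) : V := x + s *: v.
have dc : is_diff t c (fun s => s *: v).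
  have -> : (fun s => s *: v) = 0 + ( *:%R^~ v) :> (R -> V).
    by apply/funext => s; rewrite fctE add0r.
  by apply: is_diffD.
have dct : differentiable c t by case: dc.
have dfc : differentiable (f \o c) t by exact: differentiable_comp.
apply: DeriveDef; first exact: diff_derivable.
rewrite -[LHS]/('D_1 (f \o c) t) deriveE // diff_comp //= diff_val /=.
by rewrite scale1r -deriveE.
Qed.

Lemma MVT_line (V : normedModType R) (f : V -> R) x v : 
  (forall t : R, 0 <= t <= 1 -> differentiable f (x + t *: v)) ->
  exists2 t : R, 0 <= t <= 1 & f (x + v) - f x = 'D_v f (x + t *: v).
Proof.
move=> df; pose g (t : R) := f (x + t *: v).
have dg (t : R) : 0 <= t <= 1 -> is_derive t 1 g ('D_v f (x + t *: v)).
  by move=> t01; apply: is_derive_line; exact: df.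
have cg : {within `[0, 1], continuous g}.
  apply: derivable_within_continuous => t; rewrite in_itv /= => t01.
  by have [] := dg t t01.
have dg' (t : R) : t \in `]0, 1[%R -> is_derive t 1 g ('D_v f (x + t *: v)).
  by rewrite in_itv /= => /andP[t0 t1]; apply: dg; rewrite !ltW.
have [t] := MVT ltr01 dg' cg.
rewrite in_itv /= => /andP[t0 t1]; rewrite /g scale1r scale0r addr0 subr0 mulr1.
by move=> E; exists t => //; rewrite !ltW.
Qed.

(** Both iterated derivatives are limits of the same second difference
   f (x + v + w) - f (x + v) - f (x + w) + f x, rescaled. *)
Lemma second_difference (V : normedModType R) (f : V -> R) x v w :
    (forall s t : R, 0 <= s <= 1 -> 0 <= t <= 1 ->
       differentiable f (x + s *: v + t *: w) /\
       differentiable ('D_v f) (x + s *: v + t *: w)) ->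
  exists s t : R, [/\ 0 <= s <= 1, 0 <= t <= 1 &
    f (x + v + w) - f (x + v) - (f (x + w) - f x)
    = 'D_w ('D_v f) (x + s *: v + t *: w)].
Proof.
move=> df; pose g y := f (y + w) - f y.
have i0 : 0 <= (0 : R) <= 1 by rewrite lexx ler01.
have i1 : 0 <= (1 : R) <= 1 by rewrite lexx ler01.
have dfs (s : R) : 0 <= s <= 1 -> differentiable f (x + s *: v).
  by move=> s01; have [+ _] := df s 0 s01 i0; rewrite scale0r addr0.
have dfsw (s : R) : 0 <= s <= 1 -> differentiable f (x + s *: v + w).
  by move=> s01; have [+ _] := df s 1 s01 i1; rewrite scale1r.
have dsh y : differentiable (fun y : V => y + w) y.
  by apply: differentiableD => //; exact: differentiable_cst.
have dfc (s : R) : 0 <= s <= 1 -> differentiable (fun y => f (y + w)) (x + s *: v).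
  move=> s01; apply: (@differentiable_comp _ _ _ _ (fun y => y + w) f) => //.
  exact: dfsw.
have dg (s : R) : 0 <= s <= 1 -> differentiable g (x + s *: v).
  by move=> s01; apply: differentiableB; [exact: dfc|exact: dfs].
have [s s01 gE] := MVT_line dg.
have [t t01 hE] : exists2 t : R, 0 <= t <= 1 &
    'D_v f (x + s *: v + w) - 'D_v f (x + s *: v)
    = 'D_w ('D_v f) (x + s *: v + t *: w).
  by apply: (@MVT_line _ ('D_v f) (x + s *: v) w) => t t01; have [] := df s t s01 t01.
exists s, t; split=> //.
rewrite -hE; transitivity (g (x + v) - g x) => //; rewrite gE.
rewrite [LHS]deriveB; [|exact/diff_derivable/dfc|exact/diff_derivable/dfs].
congr (_ - _); rewrite (@derive_comp _ _ _ (fun y => y + w) f) //; last exact: dfsw.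
have -> // : 'D_v (fun y : V => y + w) (x + s *: v) = v.
rewrite [LHS](@deriveD _ _ _ id (cst w)) ?derive_id ?derive_cst ?addr0 //.
Qed.

(** If the two derivatives differed, they would still be close to a common second
    difference on a small enough parallelogram. *)
Theorem derive_sym (V : normedModType R) (U : set V) (f : V -> R) x v w :
  open U -> U x -> smooth U f -> 'D_v ('D_w f) x = 'D_w ('D_v f) x.
Proof.
move=> oU Ux sf; apply/eqP; rewrite -subr_eq0 -normr_le0 leNgt; apply/negP => e0.
set e := `| _ | in e0.
have cvw : {for x, continuous ('D_v ('D_w f))}.
  exact/differentiable_continuous/(smooth_diff (smooth_derive v (smooth_derive w sf))).
have cwv : {for x, continuous ('D_w ('D_v f))}.
  exact/differentiable_continuous/(smooth_diff (smooth_derive w (smooth_derive v sf))).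
have e20 : 0 < e / 2 by rewrite divr_gt0.
have Un : \forall y \near x, U y by apply: open_nbhs_nbhs.
have : \forall y \near x, [/\ U y,
    `|'D_v ('D_w f) x - 'D_v ('D_w f) y| < e / 2 &
    `|'D_w ('D_v f) x - 'D_w ('D_v f) y| < e / 2].
  move/cvgrPdist_lt : cvw => /(_ _ e20); move/cvgrPdist_lt : cwv => /(_ _ e20).
  move=> nwv nvw; apply: filterS (filterI Un (filterI nvw nwv)).
  by move=> y [Uy [Hvw Hwv]]; split; [exact: Uy|exact: Hvw|exact: Hwv].
move=> /nbhs_ballP [d /= d0]; rewrite -ball_normE /= => near_x.
have vw0 : 0 < `|v| + `|w| + 1 by rewrite ltr_wpDl // addr_ge0.
have [h h0 hd] : exists2 h, 0 < h & h * (`|v| + `|w| + 1) < d.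
  exists (d / 2 / (`|v| + `|w| + 1)); first by rewrite !divr_gt0.
  by rewrite divfK ?gt_eqF // ltr_pdivrMr // ltr_pMr // ltr1n.
have inball (s t : R) : 0 <= s <= 1 -> 0 <= t <= 1 ->
    `|x - (x + s *: (h *: v) + t *: (h *: w))| < d.
  move=> /andP[s0 s1] /andP[t0 t1].
  rewrite -addrA opprD addNKr normrN (le_lt_trans (ler_normD _ _)) //.
  rewrite !normrZ !(ger0_norm s0, ger0_norm t0, gtr0_norm h0).
  apply: le_lt_trans hd.
  have sv : s * (h * `|v|) <= h * `|v| by rewrite ler_piMl // mulr_ge0 // ltW.
  have tw : t * (h * `|w|) <= h * `|w| by rewrite ler_piMl // mulr_ge0 // ltW.
  by lra.
have dh (a b : V) (s t : R) : 0 <= s <= 1 -> 0 <= t <= 1 ->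
    (a, b) = (v, w) \/ (a, b) = (w, v) ->
    differentiable f (x + s *: (h *: a) + t *: (h *: b)) /\
    differentiable ('D_(h *: a) f) (x + s *: (h *: a) + t *: (h *: b)).
  move=> s01 t01 ab.
  have Uy : U (x + s *: (h *: a) + t *: (h *: b)).
    case: ab => -[-> ->]; first by case: (near_x _ (inball s t s01 t01)).
    by rewrite addrAC; case: (near_x _ (inball t s t01 s01)).
  by split; [exact: smooth_diff sf _|exact: smooth_diff (smooth_derive _ sf) _].
have scale (a b : V) y : U y ->
    'D_(h *: a) ('D_(h *: b) f) y = h * h * 'D_a ('D_b f) y.
  move=> Uy; rewrite deriveZv; last exact: smooth_diff (smooth_derive _ sf) _.
  have -> : 'D_a ('D_(h *: b) f) y = 'D_a (h \*: 'D_b f) y.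
    apply: near_eq_derive; apply: filterS (open_nbhs_nbhs (conj oU Uy)) => z Uz.
    by rewrite deriveZv //; exact: smooth_diff sf _.
  rewrite deriveZ /=; first by rewrite -[LHS]/(_ * (_ * _)) mulrA.
  by apply: diff_derivable; exact: smooth_diff (smooth_derive _ sf) _.
have [s1 [t1 [s1i t1i E1]]] :=
  second_difference (fun s t s01 t01 => dh v w s t s01 t01 (or_introl erefl)).
have [s2 [t2 [s2i t2i E2]]] :=
  second_difference (fun s t s01 t01 => dh w v s t s01 t01 (or_intror erefl)).
have B1 := inball _ _ s1i t1i; have B2 := inball _ _ t2i s2i.
have [U1 _ C1] := near_x _ B1; have [U2 C2 _] := near_x _ B2.
rewrite (addrAC x (s2 *: _)) in E2.
rewrite scale // in E1; rewrite scale // in E2.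
have E : 'D_w ('D_v f) (x + s1 *: (h *: v) + t1 *: (h *: w))
       = 'D_v ('D_w f) (x + t2 *: (h *: v) + s2 *: (h *: w)).
  have hh0 : h * h != 0 by rewrite mulf_neq0 // gt_eqF.
  apply: (mulfI hh0); rewrite -E1 -E2 (addrAC x (h *: w)).
  by rewrite !opprB; ring.
have : e < e / 2 + e / 2; last by rewrite -splitr ltxx.
rewrite /e; apply: le_lt_trans (ltrD C2 C1).
rewrite E [X in _ <= _ + X]distrC; apply: le_trans (ler_normD _ _).
by rewrite addrA subrK.
Qed.

End MoreCalculus.

(** * Local inversion and the index of a nondegenerate zero *)

Section Norms.
Variables (R : realType) (m : nat).
Implicit Type x : 'rV[R]_m.

Lemma normr_coord x k : `|coord x k| <= `|x|.
Proof.
rewrite /coord; case: insub => [i|] /=; last by rewrite normr0.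
rewrite [leRHS]/Num.Def.normr /= mx_normrE.
exact: (le_bigmax _ (fun ij => `|x ij.1 ij.2|) (ord0, i)).
Qed.

Lemma normr_rowP x e : 0 <= e -> (forall k, (k < m)%N -> `|coord x k| <= e) -> `|x| <= e.
Proof.
move=> e0 xe; rewrite [leLHS]/Num.Def.normr /= mx_normrE.
apply/bigmax_leP; split=> // -[i j] _ /=.
by rewrite (ord1 i) -coord_ord; apply: xe.
Qed.

End Norms.

Lemma smooth_prod (R : realType) (V : normedModType R) (U : set V) I (r : seq I)
    (F : I -> V -> R) : open U ->
  (forall i, smooth U (F i)) -> smooth U (fun x => \prod_(i <- r) F i x).
Proof.
move=> oU sF; elim: r => [|i r IHr].
  apply: (smooth_ext oU (f := fun=> 1 : R)) => [x _|]; last exact: smooth_cst.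
  by rewrite big_nil.
by apply: (smooth_ext oU _ (smoothM oU (sF i) IHr)) => x _; rewrite big_cons.
Qed.

Lemma smooth_det (R : realType) (V : normedModType R) (U : set V) k
    (F : V -> 'M[R]_k) : open U ->
  (forall i j, smooth U (fun x => F x i j)) -> smooth U (fun x => \det (F x)).
Proof.
move=> oU sF; apply: smooth_sum => // s.
by apply: smoothM => //; [exact: smooth_cst|apply: smooth_prod].
Qed.

Lemma jacobianE (R : realType) m k (f : 'rV[R]_m -> 'rV[R]_k) x :
  differentiable f x -> 'J f x = \matrix_(i < m) 'D_(basis R m i) f x.
Proof.
move=> df; apply/row_matrixP => i; rewrite rowK rowE.
rewrite -(deriveEjacobian (delta_mx 0 i) df); congr ('D_ _ f x).
by apply/rowP => j; rewrite !mxE eqxx.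
Qed.

Section LinearMaps.
Variables (R : realType) (m k : nat) (T : {linear 'rV[R]_m -> 'rV[R]_k}).

Lemma coord_linear u i :
  coord (T u) i = \sum_(j < m) coord u j * coord (T (basis R m j)) i.
Proof.
rewrite {1}[u]row_sum_basis linear_sum coord_sum.
by apply: eq_bigr => j _; rewrite linearZ coordZ coord_ord.
Qed.

Lemma smooth_linear_comp (V : normedModType R) (U : set V) (c : V -> 'rV[R]_m) :
  open U -> smooth U c -> smooth U (fun x => T (c x)).
Proof.
move=> oU sc; apply/smooth_rowP => // i.
apply: (smooth_ext oU
  (f := fun y => \sum_(j < m) coord (c y) j * coord (T (basis R m j)) i)) => [y _|].
  by rewrite [RHS]coord_linear.
apply: smooth_sum => // j; apply: smoothM => //; last exact: smooth_cst.
by move: j; apply/smooth_rowP.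
Qed.

Lemma differentiable_linear u : differentiable T u.
Proof.
exact: (smooth_diff (smooth_linear_comp openT (smooth_id openT))).
Qed.

Lemma derive_linear u v : 'D_v T u = T v.
Proof.
rewrite deriveE; last exact: differentiable_linear.
by rewrite diff_lin // => x; exact/differentiable_continuous/differentiable_linear.
Qed.

Lemma derive_linear_comp (V : normedModType R) (c : V -> 'rV[R]_m) x v :
  differentiable c x -> 'D_v (fun y => T (c y)) x = T ('D_v c x).
Proof.
by move=> dc; rewrite derive_comp ?derive_linear //; exact: differentiable_linear.
Qed.

End LinearMaps.

Lemma closed_ball_compact (R : realType) m (u : 'rV[R]_m) r :
  compact [set x | `|x - u| <= r].
Proof.
apply: bounded_closed_compact.
  exists (r + `|u|); split; first by rewrite num_real.
  move=> M rM x /= xr; rewrite (le_trans _ (ltW rM)) //.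
  by rewrite -[x](subrK u) (le_trans (ler_normD _ _)) // lerD2r.
have -> : [set x | `|x - u| <= r] = (fun x => `|x - u|) @^-1` [set t | t <= r] by [].
apply: closed_comp => [x _|]; last exact: closed_le.
by apply: continuous_comp; [apply: continuousB => //; exact: cst_continuous|exact: norm_continuous].
Qed.

(* A map which is close to an invertible linear map near a zero takes every
   small value exactly once there: after normalisation the map is a
   1/2-Lipschitz perturbation of the identity. *)
Section InverseFunction.
Variables (R : realType) (m : nat) (U : set 'rV[R]_m) (Y : 'rV[R]_m -> 'rV[R]_m).
Variable u0 : 'rV[R]_m.
Hypotheses (oU : open U) (Uu0 : U u0) (sY : smooth U Y).
Hypotheses (Y0 : Y u0 = 0) (J0 : 0 < \det ('J Y u0)).

Let A := invmx ('J Y u0).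
Let h (x : 'rV[R]_m) : 'rV[R]_m := x - mulmxr A (Y x).

Let J0unit : 'J Y u0 \in unitmx.
Proof. by rewrite unitmxE unitfE gt_eqF. Qed.

Let sh : smooth U h.
Proof.
apply/smooth_rowP => // i.
apply: (smooth_ext oU (f := fun x => coord x i - coord (mulmxr A (Y x)) i)).
  by move=> x _; rewrite coordB.
apply: smoothB => //; first exact: smooth_coord.
by move: i; apply/smooth_rowP => //; exact: smooth_linear_comp.
Qed.

Let dh0 v : 'D_v h u0 = 0.
Proof.
have dY : differentiable Y u0 by exact: smooth_diff sY _.
have dTY : differentiable (fun x => mulmxr A (Y x)) u0.
  exact: (smooth_diff (smooth_linear_comp (mulmxr A) oU sY)).
rewrite [LHS]deriveB; [|exact: derivable_id|exact: diff_derivable].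
rewrite derive_id derive_linear_comp //= deriveEjacobian // mulmxK ?subrr //.
Qed.

Let lipschitz_nbhs : exists2 r, 0 < r & 
  forall x, `|x - u0| <= r -> [/\ U x, 0 < \det ('J Y x)
    & forall j i, `|coord ('D_(basis R m j) h x) i| <= (2 * m%:R)^-1].
Proof.
have nU : \forall x \near u0, U x by apply: open_nbhs_nbhs.
have ndet : \forall x \near u0, 0 < \det (\matrix_(i < m) 'D_(basis R m i) Y x).
  have sdet : smooth U (fun x => \det (\matrix_(i < m) 'D_(basis R m i) Y x)).
    apply: smooth_det => // i j.
    apply: (smooth_ext oU (f := fun x => coord ('D_(basis R m i) Y x) j)).
      by move=> x _; rewrite mxE coord_ord.
    exact: ((smooth_rowP oU _).1 (smooth_derive _ sY) j).
  have J0' : 0 < \det (\matrix_(i < m) 'D_(basis R m i) Y u0).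
    by have <- := jacobianE (smooth_diff sY Uu0).
  have /differentiable_continuous := smooth_diff sdet Uu0.
  move=> /cvgrPdist_lt/(_ _ J0'); apply: filterS => x.
  by rewrite ltr_distlC subrr => /andP[].
have nD (j i : 'I_m) : \forall x \near u0,
    `|coord ('D_(basis R m j) h x) i| <= (2 * m%:R)^-1.
  have sD : smooth U (fun x => coord ('D_(basis R m j) h x) i).
    exact: ((smooth_rowP oU _).1 (smooth_derive _ sh) i).
  have c0 : 0 < (2 * m%:R : R)^-1.
    by rewrite invr_gt0 mulr_gt0 // ltr0n (leq_ltn_trans _ (ltn_ord i)).
  have /differentiable_continuous := smooth_diff sD Uu0.
  move=> /cvgrPdist_lt/(_ _ c0); apply: filterS => x.
  by rewrite dh0 coord0 sub0r normrN => /ltW.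
have nDall : \forall x \near u0, forall (j i : 'I_m),
    `|coord ('D_(basis R m j) h x) i| <= (2 * m%:R)^-1.
  pose f (j : 'I_m) x := forall i : 'I_m, `|coord ('D_(basis R m j) h x) i| <= (2 * m%:R)^-1.
  apply: (@filter_forall _ _ f (nbhs u0)) => j.
  exact: (@filter_forall _ _ _ (nbhs u0) _ (nD j)).
have [d /= d0] := (nbhs_ballP _ _).1 (filterI nU (filterI ndet nDall)).
rewrite -ball_normE /= => near_u0.
exists (d / 2) => [|x xd]; first by rewrite divr_gt0.
have [|Ux [detx Dx]] := near_u0 x.
  by rewrite /= distrC (le_lt_trans xd) // ltr_pdivrMr // ltr_pMr // ltr1n.
split=> [//||j i].
  by have -> := jacobianE (smooth_diff sY Ux).
have [mj|jm] := leqP m j.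
  by rewrite basis_out // derive0 coord0 normr0 invr_ge0 mulr_ge0.
have [mi|im] := leqP m i.
  by rewrite coord_out // normr0 invr_ge0 mulr_ge0.
exact: (Dx (Ordinal jm) (Ordinal im)).
Qed.

(** The solution of Y x = y is a minimum point of the distance between x and its
    image by the contraction attached to y. *)
Lemma inverse_function : exists r d : R, [/\ 0 < r, 0 < d,
   forall x, `|x - u0| <= r -> U x /\ 0 < \det ('J Y x),
   forall x x', `|x - u0| <= r -> `|x' - u0| <= r -> Y x = Y x' -> x = x'
 & forall y, `|y| < d -> exists2 x, `|x - u0| < r & Y x = y].
Proof.
have [r r0 rP] := lipschitz_nbhs.
have lip x x' : `|x - u0| <= r -> `|x' - u0| <= r ->
    `|h x - h x'| <= 2^-1 * `|x - x'|.
  move=> xr x'r; apply: normr_rowP => [|k km]; first by rewrite mulr_ge0 ?invr_ge0.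
  have seg (t : R) : 0 <= t <= 1 -> `|x' + t *: (x - x') - u0| <= r.
    move=> /andP[t0 t1].
    have -> : x' + t *: (x - x') - u0 = (1 - t) *: (x' - u0) + t *: (x - u0).
      by rewrite !scalerBr !scalerBl !scale1r; apply/rowP => i; rewrite !mxE; ring.
    rewrite (le_trans (ler_normD _ _)) // !normrZ !ger0_norm ?subr_ge0 //.
    have -> : r = (1 - t) * r + t * r by ring.
    by rewrite lerD // ler_wpM2l // subr_ge0.
  have dhs (t : R) : 0 <= t <= 1 -> differentiable h (x' + t *: (x - x')).
    by move=> /seg /rP[Ux _ _]; exact: smooth_diff sh _.
  have [t t01] := @MVT_line _ _ (fun y => coord (h y) k) x' (x - x')
    (fun t t01 => differentiable_coord_comp k (dhs t t01)).
  rewrite (addrC x') subrK -coordB => ->.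
  rewrite derive_coord; last exact: dhs.
  rewrite derive_sum_basis; last exact: dhs.
  have [_ _ Dt] := rP _ (seg t t01).
  rewrite coord_sum (le_trans (ler_norm_sum _ _ _)) //.
  apply: (@le_trans _ _ (\sum_(j < m) (2 * m%:R)^-1 * `|x - x'|)).
    apply: ler_sum => j _; rewrite coordZ normrM mulrC.
    by apply: ler_pM => //; rewrite -coord_ord normr_coord.
  have m0 : (m%:R : R) != 0 by rewrite pnatr_eq0 -lt0n (leq_ltn_trans _ km).
  rewrite sumr_const card_ord -mulr_natl le_eqVlt; apply/orP; left; apply/eqP.
  by field.
have hinj x x' : `|x - u0| <= r -> `|x' - u0| <= r -> Y x = Y x' -> x = x'.
  move=> xr x'r Yxx'; apply/eqP; rewrite -subr_eq0 -normr_le0.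
  have := lip _ _ xr x'r.
  have -> : h x - h x' = x - x' by rewrite /h Yxx' opprB addrA subrK.
  by have := normr_ge0 (x - x'); lra.
have hu0 : h u0 = u0 by rewrite /h Y0 linear0 subr0.
have r40 : 0 < r / 4 by rewrite divr_gt0.
have /differentiable_continuous := @differentiable_linear R m m (mulmxr A) 0.
move=> /cvgrPdist_lt/(_ _ r40)/nbhs_ballP [d /= d0].
rewrite -ball_normE /= => dP.
exists r, d; split; [exact: r0|exact: d0| |exact: hinj|move=> y yd].
  by move=> x /rP[Ux detx _]; split; [exact: Ux|exact: detx].
pose k (x : 'rV[R]_m) : 'rV[R]_m := h x + mulmxr A y.
have ysmall : `|mulmxr A y| < r / 4.
  by have := dP y; rewrite /= !sub0r normrN mul0mx sub0r normrN; apply.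
have kr x : `|x - u0| <= r -> `|k x - u0| <= r / 2 + r / 4.
  move=> xr; have -> : k x - u0 = (h x - h u0) + mulmxr A y by rewrite hu0 /k addrAC.
  rewrite (le_trans (ler_normD _ _)) // lerD //; last exact: ltW.
  have u0r : `|u0 - u0| <= r by rewrite subrr normr0 ltW.
  by rewrite (le_trans (lip _ _ xr u0r)) // mulrC ler_pM2r.
have krr x : `|x - u0| <= r -> `|k x - u0| <= r.
  by move=> /kr /le_trans; apply; lra.
have [x] : exists2 x : 'rV[R]_m, x \in [set x : 'rV[R]_m | `|x - u0| <= r] &
    forall t, t \in [set x : 'rV[R]_m | `|x - u0| <= r] -> `|x - k x| <= `|t - k t|.
  apply: EVT_min_rV; first by exists u0; rewrite /= subrr normr0 ltW.
    exact: closed_ball_compact.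
  apply: continuous_in_subspaceT => x; rewrite inE /= => /rP[Ux _ _].
  have dkx : {for x, continuous (fun x : 'rV[R]_m => x - k x)}.
    apply: differentiable_continuous; apply: differentiableB => //.
    by apply: differentiableD; [exact: smooth_diff sh _|exact: differentiable_cst].
  by apply: continuous_comp; [exact: dkx|exact: norm_continuous].
rewrite inE /= => xr xmin.
have xkx : x = k x.
  apply/eqP; rewrite -subr_eq0 -normr_le0.
  have := xmin (k x); rewrite inE /= => /(_ (krr _ xr)).
  have := lip _ _ xr (krr _ xr).
  have -> : k x - k (k x) = h x - h (k x) by rewrite {1 3}/k opprD addrACA subrr addr0.
  by have := normr_ge0 (x - k x); lra.
exists x; first by rewrite xkx (le_lt_trans (kr _ xr)) //; lra.
have : mulmxr A (Y x) = mulmxr A y.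
  apply/subr0_eq; rewrite -[RHS](subrr x) {3}xkx /k /h.
  by rewrite opprD opprB addrA addrCA subrr addr0.
by move=> /= /(congr1 (mulmx^~ ('J Y u0))); rewrite !mulmxKV.
Qed.

Lemma is_vf_index1 : is_vf_index U Y u0 1.
Proof.
have [r [d [r0 d0 rP Yinj Ysurj]]] := inverse_function.
split=> //; exists r, d; split=> //.
  move=> x xr; have [Ux _] := rP x xr; split=> // Yx0.
  by apply: Yinj => //; [rewrite subrr normr0 ltW|rewrite Yx0].
move=> y yd _; have [x xr Yx] := Ysurj y yd.
have -> : [set x | `|x - u0| < r /\ Y x = y] = [set x].
  apply/seteqP; split=> [x' [x'r Yx']|_ ->]; last by split.
  by apply: Yinj; rewrite ?ltW // Yx'.
have [_ detx] := rP x (ltW xr).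
by rewrite fsbig_set1; exact: gtr0_sgz detx.
Qed.

(** Evaluating an index at the regular value 0 determines it. *)
Lemma is_vf_index_uniq k : is_vf_index U Y u0 k -> k = 1.
Proof.
move=> [_ [r [d [r0 d0 rP /(_ 0)]]]]; rewrite normr0 => /(_ d0).
have -> : [set x | `|x - u0| < r /\ Y x = 0] = [set u0].
  apply/seteqP; split=> [x [xr Yx]|_ ->]; last by rewrite /= subrr normr0.
  by have [_] := rP x (ltW xr); apply.
rewrite fsbig_set1 (gtr0_sgz J0) => <-; first by [].
move=> x xr Yx; have [_ /(_ Yx) ->] := rP x (ltW xr).
exact: lt0r_neq0 J0.
Qed.

End InverseFunction.

(** * Frames of the symplectic space and the characteristic field *)

Lemma basis_mul (R : realType) m d (v : nat -> 'rV[R]_d) k : (k < m)%N ->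
  basis R m k *m (\matrix_(i < m) v i) = v k.
Proof.
move=> km; have -> : basis R m k = delta_mx 0 (Ordinal km).
  by apply/rowP => j; rewrite !mxE eqxx.
by rewrite -rowE rowK.
Qed.

Lemma row_mul_sum (R : realType) m d (V : 'rV[R]_m) (v : nat -> 'rV[R]_d) :
  V *m (\matrix_(i < m) v i) = \sum_(k < m) V 0 k *: v k.
Proof. by rewrite mulmx_sum_row; apply: eq_bigr => k _; rewrite rowK. Qed.

Section CharacteristicField.
Variables (R : realType) (n : nat).
Hypothesis n_gt0 : (0 < n)%N.
Let E := 'rV[R]_(n.+1.*2).
Implicit Types (p X N : E) (v : nat -> E) (V : 'rV[R]_(n.*2)).

Definition framemx p N v : 'M[R]_(n.+1.*2) :=
  \matrix_(i < n.+1.*2) vcons p (vcons N v) i.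

Definition headmx p N : 'M[R]_(2, n.+1.*2) := \matrix_(i < 2) vcons p (fun=> N) i.

Lemma framemxE p N v :
  framemx p N v = col_mx (headmx p N) (\matrix_(i < n.*2) v i) :> 'M[R]_(2 + n.*2, n.+1.*2).
Proof.
apply/row_matrixP => i; rewrite [LHS]rowK.
case: (@split_ordP 2 n.*2 i) => j ->; rewrite ?rowKu ?rowKd rowK //.
by case: j => -[|[|j]].
Qed.

Lemma det_swap02 (b c d : E) v :
  \det (framemx b c (vcons d v)) = - \det (framemx d c (vcons b v)).
Proof.
move: n_gt0; rewrite /E /framemx in b c d v *; case: (n) b c d v => // k b c d v _.
pose i2 : 'I_k.+2.*2 := lift ord0 (lift ord0 ord0).
have -> : \matrix_(i < k.+2.*2) vcons b (vcons c (vcons d v)) i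
   = xrow ord0 i2 (\matrix_(i < k.+2.*2) vcons d (vcons c (vcons b v)) i).
  apply/matrixP => i j; rewrite !mxE.
  case: (tpermP ord0 i2 i) => [->|->|] //=.
  case: i => -[|[|[|i]]] lti i0 ii2 //=; first by case: i0; apply/val_inj.
  by case: ii2; apply/val_inj.
by rewrite xrowE det_mulmx det_perm odd_tperm mulN1r.
Qed.

(** Cramer's rule in the frame (p, N, v_0, v_1, ...). *)
Lemma det_frame_subst (p X N : E) v V a (i : 'I_n.*2) :
    X = a *: p + \sum_(k < n.*2) V 0 k *: v k ->
  \det (framemx p N (vcons X (fun j => v (bump i j))))
  = (-1) ^+ i * V 0 i * \det (framemx p N v).
Proof.
move=> XE; pose B := \matrix_(j < n.*2) vcons V (fun j => basis R n.*2 (bump i j)) j.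
pose C : 'M[R]_(n.*2, 2) :=
  \matrix_(k, j) if (k == 0 :> nat) && (j == 0 :> nat) then a else 0.
have bottom : \matrix_(j < n.*2) vcons X (fun j => v (bump i j)) j
    = C *m headmx p N + B *m (\matrix_(j < n.*2) v j).
  apply/row_matrixP => j; rewrite rowK linearD /= !row_mul rowK.
  case: j => -[|j] ltj /=.
    rewrite row_mul_sum XE; congr (_ + _).
    rewrite mulmx_sum_row !big_ord_recl big_ord0.
    by rewrite !rowK !mxE /= scale0r !addr0.
  rewrite basis_mul; last by move: ltj; rewrite /bump; case: leqP => /=; lia.
  rewrite mulmx_sum_row big1 ?add0r // => k _.
  by rewrite !mxE /= scale0r.
have -> : framemx p N (vcons X (fun j => v (bump i j)))
    = (block_mx 1%:M 0 C B : 'M[R]_(2 + n.*2)) *m (framemx p N v).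
  by rewrite !framemxE bottom mul_block_col mul1mx mul0mx addr0.
by rewrite det_mulmx (@det_lblock _ 2 n.*2) det1 mul1r det_vcons.
Qed.

(** A vector orthogonal to p and to all v_j, but not to N, has no component along N.
    This uses its orthogonality to itself. *)
Lemma det_frame0 p N v (X : E) : symp X N != 0 -> symp X p = 0 ->
    (forall j, symp X (v j) = 0) -> \det (framemx p N v) != 0 ->
  exists V a, X = a *: p + \sum_(k < n.*2) V 0 k *: v k.
Proof.
move=> XN Xp Xv detM; set M := framemx p N v.
have Mu : M \in unitmx by rewrite unitmxE unitfE.
pose Y : 'rV[R]_(2 + n.*2) := X *m invmx M.
have XE : X = lsubmx Y *m headmx p N + \sum_(k < n.*2) rsubmx Y 0 k *: v k.
  rewrite -row_mul_sum -mul_row_col hsubmxK -framemxE -/M.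
  by rewrite /Y mulmxKV.
have {}XE : X = lsubmx Y 0 0 *: p + lsubmx Y 0 (lift ord0 ord0) *: N
    + \sum_(k < n.*2) rsubmx Y 0 k *: v k.
  rewrite {1}XE; congr (_ + _); rewrite mulmx_sum_row !big_ord_recl big_ord0 addr0.
  by rewrite !rowK.
have b0 : lsubmx Y 0 (lift ord0 ord0) = 0.
  have := symp_self X; rewrite {2}XE !sympDr !sympZr Xp mulr0 add0r.
  have -> : symp X (\sum_(k < n.*2) rsubmx Y 0 k *: v k) = 0.
    elim/big_rec: _ => [|k y _ IH]; first exact: symp0r.
    by rewrite sympDr IH sympZr Xv mulr0 addr0.
  by rewrite addr0 => /eqP; rewrite mulf_eq0 (negbTE XN) orbF => /eqP.
exists (rsubmx Y), (lsubmx Y 0 0).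
by rewrite {1}XE b0 scale0r addr0.
Qed.

(** The heart of the computation of the characteristic field: [X] is dual to
   a covector vanishing on the tangent space, and [V] is its expression in the
   chart. *)
Lemma char_coef (p X N : E) v V a (i : 'I_n.*2) :
    symp X N != 0 -> symp X p = 0 -> (forall j, symp X (v j) = 0) ->
    X = a *: p + \sum_(k < n.*2) V 0 k *: v k ->
  (-1) ^+ i * bpfaff n.-1 (fun j => symp p (v (bump i j)))
                (fun j k => symp (v (bump i j)) (v (bump i k)))
  = - \det (framemx p N v) * pfaff_std R n.+1
      / (n.+1.*2%:R * n.*2%:R * symp X N) * V 0 i.
Proof.
move=> XN Xp Xv XE.
have H : n.+1.*2%:R * (symp X N * (n.*2%:R *
     bpfaff n.-1 (fun j => symp p (v (bump i j)))
       (fun j k => symp (v (bump i j)) (v (bump i k)))))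
  = \det (framemx X N (vcons p (fun j => v (bump i j)))) * pfaff_std R n.+1.
  move: n_gt0 i; rewrite /framemx /E in p X N v V Xp Xv XN XE *.
  case: (n) p X N v V Xp Xv XN XE => // k p X N v V Xp Xv XN XE _ i.
  by apply: (@bpfaff_hyperplane R k X N p (fun j => v (bump i j))) => // j; exact: Xv.
rewrite det_swap02 (det_frame_subst N i XE) in H.
have n0 : (n.*2%:R : R) != 0 by rewrite pnatr_eq0 double_eq0 -lt0n.
have n10 : (n.+1.*2%:R : R) != 0 by rewrite pnatr_eq0.
set S := (-1) ^+ i in H *; have SS : S * S = 1 by rewrite -expr2 sqrr_sign.
set B := bpfaff _ _ _ in H *.
apply: (mulfI (mulf_neq0 n10 (mulf_neq0 XN n0))).
transitivity (S * (n.+1.*2%:R * (symp X N * (n.*2%:R * B)))); first by ring.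
by rewrite H; field: SS; rewrite XN n0 n10.
Qed.

End CharacteristicField.

(** * The model hypersurface: equation, characteristic field, normal field *)

Section IsD.
Variables (R : realType) (V : normedModType R) (x v : V).
Implicit Types f g : V -> R.

(** Stating both parts together lets derivatives be computed by applying rules. *)
Definition isD f d := differentiable f x /\ 'D_v f x = d.

Lemma isD_eq f d d' : isD f d -> d = d' -> isD f d'.
Proof. by move=> fd <-. Qed.

Lemma isD_cst (a : R) : isD (fun=> a) 0.
Proof. by split; [exact: differentiable_cst|exact: derive_cst]. Qed.

Lemma isD_add f g df dg : isD f df -> isD g dg -> isD (fun y => f y + g y) (df + dg).
Proof.
move=> [f1 <-] [g1 <-]; split; first exact: differentiableD.
by rewrite [LHS]deriveD //; exact: diff_derivable.
Qed.

Lemma isD_opp f df : isD f df -> isD (fun y => - f y) (- df).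
Proof.
move=> [f1 <-]; split; first exact: differentiableN.
by rewrite [LHS]deriveN //; exact: diff_derivable.
Qed.

Lemma isD_mul f g df dg :
  isD f df -> isD g dg -> isD (fun y => f y * g y) (df * g x + f x * dg).
Proof.
move=> [f1 <-] [g1 <-]; split; first exact: differentiableM.
rewrite [LHS]deriveM; [|exact: diff_derivable|exact: diff_derivable].
by rewrite -[LHS]/(_ * _ + _ * _) addrC [g x * _]mulrC.
Qed.

Lemma isD_sqr f df : isD f df -> isD (fun y => f y ^+ 2) (2 * (f x * df)).
Proof.
move=> fd; have := isD_mul fd fd.
rewrite (_ : (fun y => f y * f y) = (fun y => f y ^+ 2)); last first.
  by apply/funext => y; rewrite expr2.
by move=> H; apply: isD_eq H _; ring.
Qed.

Lemma isD_sum m (F : 'I_m -> V -> R) dF :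
  (forall i, isD (F i) (dF i)) -> isD (fun y => \sum_(i < m) F i y) (\sum_(i < m) dF i).
Proof.
elim: m F dF => [|m IHm] F dF FdF.
  rewrite big_ord0 (_ : (fun y => _) = fun=> 0); first exact: isD_cst.
  by apply/funext => y; rewrite big_ord0.
rewrite big_ord_recl (_ : (fun y => _) =
  fun y => F ord0 y + \sum_(i < m) F (lift ord0 i) y); last first.
  by apply/funext => y; rewrite big_ord_recl.
by apply: isD_add => //; apply: IHm.
Qed.

Lemma isD_coord m (c : V -> 'rV[R]_m) w k : differentiable c x -> 'D_v c x = w ->
  isD (fun y => coord (c y) k) (coord w k).
Proof.
by move=> dc <-; split; [exact: differentiable_coord_comp|exact: derive_coord].
Qed.

End IsD.

Section Base.
Variables (R : realType) (k : nat).
Let n := k.+2.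
Let E := 'rV[R]_(n.*2.+1).
Local Notation "x $ i" := (coord x i) (at level 5, format "x $ i").
Implicit Types x y X Y : E.

(** The pairing of the (x_i, y_i) components; [darboux_form] is dz plus this form. *)
Definition om X Y : R :=
  \sum_(i < n) (X$(i.*2.+1) * Y$(i.*2.+2) - X$(i.*2.+2) * Y$(i.*2.+1)).

Lemma darbouxE x Y : darboux_form x Y = Y$0 + om x Y.
Proof. by []. Qed.

Lemma sum_first2 (f : nat -> R) :
  \sum_(i < n) f i = f 0%N + f 1%N + \sum_(i < k) f i.+2.
Proof. by rewrite !big_ord_recl /= addrA. Qed.

Definition lift1 (a : R) x : 'rV[R]_(n.+1.*2) := row_mx (a%:M : 'rV_1) x.

Lemma coord_lift1 a x j : (lift1 a x)$j = if j is j'.+1 then x$j' else a.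
Proof.
have [jn|nj] := ltnP j n.+1.*2; last first.
  rewrite coord_out //; case: j nj => // j nj; rewrite coord_out //.
rewrite (coord_ord (lift1 a x) (Ordinal jn)).
case: j jn => [|j] jn.
  have -> : Ordinal jn = (@lshift 1 n.*2.+1 ord0 : 'I_(1 + n.*2.+1)) by exact/val_inj.
  by rewrite /lift1 (@row_mxEl _ _ 1) !mxE eqxx.
have jn' : (j < n.*2.+1)%N by [].
have -> : Ordinal jn = (@rshift 1 n.*2.+1 (Ordinal jn') : 'I_(1 + n.*2.+1)) by exact/val_inj.
by rewrite /lift1 (@row_mxEr _ _ 1) -coord_ord.
Qed.

Lemma symp_lift1 a b x y : symp (lift1 a x) (lift1 b y) = a * y$0 - x$0 * b + om x y.
Proof.
rewrite /symp big_ord_recl !coord_lift1 /=; congr (_ + _).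
by apply: eq_bigr => i _; rewrite !coord_lift1.
Qed.

Definition eps : R := 20^-1.

(* Coordinates: z = x$0 and, for i < n, x_i = x$(2i+1), y_i = x$(2i+2); below q
   stands for (x_0, x_1), p for (y_0, y_1), and w for all the other x_i, y_i. *)
(** This function replaces z among the coordinates of the model. *)
Definition tau x : R :=
  x$0 + x$1 * x$2 + x$3 * x$4 - (x$1 ^+ 2 + x$3 ^+ 2) / 2.

Definition dtau x Y : R :=
  Y$0 + (Y$1 * x$2 + x$1 * Y$2) + (Y$3 * x$4 + x$3 * Y$4)
  - (x$1 * Y$1 + x$3 * Y$3).

(** |p|^2 + |w|^2; the factor (1 < i) removes x_0 and x_1. *)
Definition wsq x : R :=
  \sum_(i < n) ((1 < i)%N%:R * x$(i.*2.+1) ^+ 2 + x$(i.*2.+2) ^+ 2).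

Definition dwsq x Y : R :=
  \sum_(i < n) ((1 < i)%N%:R * (x$(i.*2.+1) * Y$(i.*2.+1)) + x$(i.*2.+2) * Y$(i.*2.+2)).

Definition Ffun x : R := wsq x + tau x ^+ 2 - 1.

Definition dF x Y : R := 2 * (dwsq x Y + tau x * dtau x Y).

Definition Lfun x : R :=
  tau x + ((x$1 + eps * tau x * x$2) ^+ 2 + (x$3 + eps * tau x * x$4) ^+ 2) / 2.

Definition dL x Y : R :=
  dtau x Y
  + (x$1 + eps * tau x * x$2) * (Y$1 + eps * (dtau x Y * x$2 + tau x * Y$2))
  + (x$3 + eps * tau x * x$4) * (Y$3 + eps * (dtau x Y * x$4 + tau x * Y$4)).

Definition Xx x (i : nat) : R :=
  x$(i.*2.+2) - (1 < i)%N%:R * (tau x * x$(i.*2.+1)).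

Definition Xy x (i : nat) : R :=
  - tau x * x$(i.*2.+2)
  + (if (1 < i)%N then - x$(i.*2.+1) else tau x * (x$(i.*2.+1) - x$(i.*2.+2))).

(** The generator of the characteristic foliation of the level sets of [Ffun]. *)
Definition Xf x : E := rowf n.*2.+1 (fun j =>
  if j is j'.+1 then (if odd j' then Xy x j'./2 else Xx x j'./2)
  else - \sum_(i < n) (x$(i.*2.+1) * Xy x i - x$(i.*2.+2) * Xx x i)).

(** A field on which dF is -2 along F = 0. *)
Definition Nf x : E := rowf n.*2.+1 (fun j =>
  if j is j'.+1 then
    (if odd j' then - x$j else - ((1 < j'./2)%N%:R * x$j))
  else x$1 * x$2 + x$3 * x$4 - tau x).

Lemma Xf_x x i : (i < n)%N -> (Xf x)$(i.*2.+1) = Xx x i.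
Proof.
move=> ni; rewrite coord_rowf ltnS ltn_double ni odd_double.
by rewrite -(addn0 i.*2) halfD odd_double /= doubleK addn0.
Qed.

Lemma Xf_y x i : (i < n)%N -> (Xf x)$(i.*2.+2) = Xy x i.
Proof.
move=> ni; rewrite coord_rowf (_ : (_ < _)%N = true); last by lia.
by rewrite /= odd_double /= uphalf_double.
Qed.

Lemma Xf_0 x : (Xf x)$0 = - om x (Xf x).
Proof.
rewrite coord_rowf; congr (- _); apply: eq_bigr => i _.
by rewrite Xf_x // Xf_y.
Qed.

Lemma Nf_x x i : (i < n)%N -> (Nf x)$(i.*2.+1) = - ((1 < i)%N%:R * x$(i.*2.+1)).
Proof.
move=> ni; rewrite coord_rowf ltnS ltn_double ni odd_double.
by rewrite doubleK.
Qed.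

Lemma Nf_y x i : (i < n)%N -> (Nf x)$(i.*2.+2) = - x$(i.*2.+2).
Proof.
move=> ni; rewrite coord_rowf (_ : (_ < _)%N = true); last by lia.
by rewrite /= odd_double.
Qed.

Lemma Nf_0 x : (Nf x)$0 = x$1 * x$2 + x$3 * x$4 - tau x.
Proof. by rewrite coord_rowf. Qed.

(** dF is the contraction of d(alpha) with [Xf], modulo alpha:
    this is why [Xf] directs the characteristic foliation. *)
Lemma dF_om x Y : dF x Y = 2 * (om (Xf x) Y + tau x * darboux_form x Y).
Proof.
congr (2 * _); rewrite darbouxE /dwsq /dtau /om.
rewrite (sum_first2 (fun i => (1 < i)%N%:R * (x$(i.*2.+1) * Y$(i.*2.+1)) + x$(i.*2.+2) * Y$(i.*2.+2))).
rewrite (sum_first2 (fun i => (Xf x)$(i.*2.+1) * Y$(i.*2.+2) - (Xf x)$(i.*2.+2) * Y$(i.*2.+1))).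
rewrite (sum_first2 (fun i => x$(i.*2.+1) * Y$(i.*2.+2) - x$(i.*2.+2) * Y$(i.*2.+1))) /=.
have -> : (Xf x)$1 = Xx x 0 by exact: (@Xf_x x 0).
have -> : (Xf x)$2 = Xy x 0 by exact: (@Xf_y x 0).
have -> : (Xf x)$3 = Xx x 1 by exact: (@Xf_x x 1).
have -> : (Xf x)$4 = Xy x 1 by exact: (@Xf_y x 1).
have -> : \sum_(i < k) ((Xf x)$(i.+2.*2.+1) * Y$(i.+2.*2.+2)
      - (Xf x)$(i.+2.*2.+2) * Y$(i.+2.*2.+1))
    = \sum_(i < k) (Xx x i.+2 * Y$(i.+2.*2.+2) - Xy x i.+2 * Y$(i.+2.*2.+1)).
  apply: eq_bigr => i _; have ni : (i.+2 < n)%N by rewrite !ltnS.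
  by rewrite Xf_x // Xf_y.
set A := \sum_(i < k) _; set B := \sum_(i < k) _; set C := \sum_(i < k) _.
have -> : A = B + tau x * C.
  rewrite mulr_sumr -big_split; apply: eq_bigr => i _ /=.
  by rewrite /Xx /Xy /=; ring.
by rewrite /Xx /Xy /=; ring.
Qed.

Lemma dF_Nf x : dF x (Nf x) = - 2 * (wsq x + tau x ^+ 2).
Proof.
rewrite /dF mulNr -mulrN; congr (2 * _).
have -> : dwsq x (Nf x) = - wsq x.
  rewrite /dwsq /wsq -sumrN; apply: eq_bigr => i _.
  by rewrite Nf_x // Nf_y //; case: (1 < i)%N => /=; ring.
have -> : dtau x (Nf x) = - tau x.
  rewrite /dtau Nf_0.
  have -> : (Nf x)$1 = 0 by rewrite (@Nf_x x 0) //= mul0r oppr0.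
  have -> : (Nf x)$3 = 0 by rewrite (@Nf_x x 1) //= mul0r oppr0.
  have -> : (Nf x)$2 = - x$2 by exact: (@Nf_y x 0).
  have -> : (Nf x)$4 = - x$4 by exact: (@Nf_y x 1).
  ring.
ring.
Qed.

Section Derivatives.
Variables (V : normedModType R) (c : V -> E) (u v : V).
Hypothesis dc : differentiable c u.
Let w := 'D_v c u.

Let isDc j : isD u v (fun t => (c t)$j) (w$j).
Proof. exact: isD_coord. Qed.

Lemma isD_tau : isD u v (fun t => tau (c t)) (dtau (c u) w).
Proof.
apply: isD_eq.
  apply: isD_add; last first.
    apply: isD_opp; apply: isD_mul; last exact: isD_cst.
    by apply: isD_add; apply: isD_sqr; exact: isDc.
  apply: isD_add; last by apply: isD_mul; exact: isDc.
  apply: isD_add; first exact: isDc.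
  by apply: isD_mul; exact: isDc.
by rewrite /dtau; field.
Qed.

Lemma isD_wsq : isD u v (fun t => wsq (c t)) (2 * dwsq (c u) w).
Proof.
apply: isD_eq.
  apply: isD_sum => i; apply: isD_add.
    by apply: isD_mul; [exact: isD_cst|apply: isD_sqr; exact: isDc].
  by apply: isD_sqr; exact: isDc.
by rewrite /dwsq mulr_sumr; apply: eq_bigr => i _; rewrite -/w; ring.
Qed.

Lemma isD_F : isD u v (fun t => Ffun (c t)) (dF (c u) w).
Proof.
apply: isD_eq.
  apply: isD_add; last exact: isD_cst.
  by apply: isD_add; [exact: isD_wsq|apply: isD_sqr; exact: isD_tau].
by rewrite /dF; ring.
Qed.

Lemma isD_L : isD u v (fun t => Lfun (c t)) (dL (c u) w).
Proof.
have isDet : isD u v (fun t => eps * tau (c t)) (eps * dtau (c u) w).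
  apply: isD_eq; first by apply: isD_mul; [exact: isD_cst|exact: isD_tau].
  by rewrite mul0r add0r.
apply: isD_eq.
  apply: isD_add; first exact: isD_tau.
  apply: isD_mul; last exact: isD_cst.
  by apply: isD_add; apply: isD_sqr; (apply: isD_add; first exact: isDc);
    (apply: isD_mul; last exact: isDc); exact: isDet.
by rewrite /dL /eps; field.
Qed.

End Derivatives.

End Base.

(** * The Lyapunov function *)

Section Lyapunov.
Variable R : realFieldType.

(** With t = tau and m = 2 |p|^2 + |w|^2, the derivative of tau along [Xf] is
    m - q.p, while that of |q|^2 / 2 is q.p; the term in e contributes the square of
    t q, which m does not control.  The remaining terms are absorbed because
    |q|^2 is at most 7 on the domain. *)
Lemma lyapunov_ineq (e q1 q2 p1 p2 W t m d : R) : e = 20^-1 -> 0 <= W ->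
    p1 ^+ 2 + p2 ^+ 2 + W + t ^+ 2 = 1 ->
    t + ((q1 + e * t * p1) ^+ 2 + (q2 + e * t * p2) ^+ 2) / 2 <= 2 ->
    m = 2 * (p1 ^+ 2 + p2 ^+ 2) + W ->
    d = m - (q1 * p1 + q2 * p2) ->
  m / 2 + t ^+ 2 * (q1 ^+ 2 + q2 ^+ 2) / 50
  <= d + (q1 + e * t * p1) * (p1 + e * (d * p1 + t * (t * (q1 - 2 * p1))))
       + (q2 + e * t * p2) * (p2 + e * (d * p2 + t * (t * (q2 - 2 * p2)))).
Proof.
move=> eE W0 sph dom mE dE.
set a := q1 * p1 + q2 * p2 in dE *.
set P := p1 ^+ 2 + p2 ^+ 2 in mE sph *.
set Q := q1 ^+ 2 + q2 ^+ 2.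
have -> : d + (q1 + e * t * p1) * (p1 + e * (d * p1 + t * (t * (q1 - 2 * p1))))
       + (q2 + e * t * p2) * (p2 + e * (d * p2 + t * (t * (q2 - 2 * p2))))
   = m + e * ((m - a) * a) + e * (t ^+ 2 * (Q - 2 * a)) + e * (t * P)
     + e ^+ 2 * (t * (m - a) * P) + e ^+ 2 * (t ^+ 3 * (a - 2 * P)).
  by rewrite dE /a /Q /P; ring.
have {}dom : t + (Q + 2 * e * (t * a) + e ^+ 2 * (t ^+ 2 * P)) / 2 <= 2.
  by apply: le_trans dom; rewrite le_eqVlt; apply/orP; left; apply/eqP;
    rewrite /Q /a /P; field.
have P0 : 0 <= P by rewrite addr_ge0 ?sqr_ge0.
have Q0 : 0 <= Q by rewrite addr_ge0 ?sqr_ge0.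
have t20 : 0 <= t ^+ 2 by exact: sqr_ge0.
have t21 : t ^+ 2 <= 1 by lra.
have [tm1 t1] : -1 <= t /\ t <= 1 by split; nra.
have P1 : P <= 1 by lra.
have m0 : 0 <= m by rewrite mE; lra.
have m2 : m <= 2 by rewrite mE; lra.
have CS : a ^+ 2 <= P * Q.
  have -> : P * Q = a ^+ 2 + (p1 * q2 - p2 * q1) ^+ 2 by rewrite /P /Q /a; ring.
  by rewrite lerDl sqr_ge0.
have ta : - (2 * (t * a)) <= Q + t ^+ 2 * P.
  have : 0 <= (q1 + t * p1) ^+ 2 + (q2 + t * p2) ^+ 2 by rewrite addr_ge0 ?sqr_ge0.
  have -> : (q1 + t * p1) ^+ 2 + (q2 + t * p2) ^+ 2 = Q + 2 * (t * a) + t ^+ 2 * P.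
    by rewrite /Q /a /P; ring.
  by lra.
have t2P : t ^+ 2 * P <= P by rewrite ler_piMl.
have t2P0 : 0 <= t ^+ 2 * P by rewrite mulr_ge0.
have Q7 : Q <= 7.
  have e0 : 0 <= e ^+ 2 * (t ^+ 2 * P) by rewrite mulr_ge0 // sqr_ge0.
  by move: dom e0; rewrite eE; lra.
have a27P : a ^+ 2 <= 7 * P by apply: le_trans CS _; rewrite mulrC ler_wpM2r.
have [am a1] : -(265 / 100) <= a /\ a <= 265 / 100 by split; nra.
have T1 : - (265 / 100 * m) <= m * a by nra.
have T3 : t ^+ 2 * (Q / 2) - 2 * (t ^+ 2 * P) <= t ^+ 2 * (Q - 2 * a).
  have : 0 <= Q / 2 - 2 * a + 2 * P.
    have -> : Q / 2 - 2 * a + 2 * P = ((q1 - 2 * p1) ^+ 2 + (q2 - 2 * p2) ^+ 2) / 2.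
      by rewrite /Q /a /P; field.
    by rewrite divr_ge0 // addr_ge0 ?sqr_ge0.
  by move=> /(mulr_ge0 t20); lra.
have T4 : - P <= t * P by nra.
have T5 : - (465 / 100 * P) <= t * (m - a) * P.
  have : - (465 / 100) <= t * (m - a) by nra.
  by move=> H; have := ler_wpM2r P0 H; lra.
have T6 : - (t ^+ 2 * Q / 2) - P / 2 - 2 * P <= t ^+ 3 * (a - 2 * P).
  have -> : t ^+ 3 * (a - 2 * P) = t ^+ 2 * (t * a) - 2 * (t * (t ^+ 2 * P)) by ring.
  have H1 : - (t ^+ 2 * (Q + t ^+ 2 * P)) <= 2 * (t ^+ 2 * (t * a)).
    by have := ler_wpM2l t20 ta; lra.
  have H2 : t ^+ 2 * (t ^+ 2 * P) <= P.
    by apply: le_trans t2P; rewrite ler_piMl.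
  have H3 : t * (t ^+ 2 * P) <= P.
    by apply: le_trans t2P; rewrite ler_piMl.
  by lra.
have T0 : 0 <= t ^+ 2 * Q by rewrite mulr_ge0.
have mP : 2 * P <= m by rewrite mE; lra.
rewrite (_ : e ^+ 2 = 400^-1); last by rewrite eE; field.
rewrite eE.
have -> : (m - a) * a = m * a - a ^+ 2 by ring.
clear ta CS sph dom; move: (m * a) (a ^+ 2) (t ^+ 2 * (Q - 2 * a)) (t * P)
  (t * (m - a) * P) (t ^+ 3 * (a - 2 * P)) a27P T1 T3 T4 T5 T6 => A B C D F G.
by lra.
Qed.

End Lyapunov.

Section BaseLyapunov.
Variables (R : realType) (k : nat).
Let n := k.+2.
Let E := 'rV[R]_(n.*2.+1).
Local Notation "x $ i" := (coord x i) (at level 5, format "x $ i").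
Implicit Types x y X Y : E.

Definition wsq2 x : R :=
  \sum_(i < k) (x$(i.+2.*2.+1) ^+ 2 + x$(i.+2.*2.+2) ^+ 2).

Lemma wsqE x : wsq x = x$2 ^+ 2 + x$4 ^+ 2 + wsq2 x.
Proof.
rewrite /wsq (sum_first2 _ (fun i => (1 < i)%N%:R * x$(i.*2.+1) ^+ 2 + x$(i.*2.+2) ^+ 2)).
by rewrite /= !mul0r !add0r; congr (_ + _); apply: eq_bigr => i _; rewrite mul1r.
Qed.

Lemma wsq2_ge0 x : 0 <= wsq2 x.
Proof. by apply: sumr_ge0 => i _; rewrite addr_ge0 ?sqr_ge0. Qed.

Lemma Xf_first x :
  ((Xf x)$1 = x$2) * ((Xf x)$2 = tau x * (x$1 - 2 * x$2)) *
  ((Xf x)$3 = x$4) * ((Xf x)$4 = tau x * (x$3 - 2 * x$4)).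
Proof.
have -> : (Xf x)$1 = Xx x 0 by exact: (@Xf_x _ _ x 0).
have -> : (Xf x)$2 = Xy x 0 by exact: (@Xf_y _ _ x 0).
have -> : (Xf x)$3 = Xx x 1 by exact: (@Xf_x _ _ x 1).
have -> : (Xf x)$4 = Xy x 1 by exact: (@Xf_y _ _ x 1).
by rewrite /Xx /Xy /=; split; [split; [split|]|]; ring.
Qed.

Lemma dtau_Xf x : dtau x (Xf x)
  = 2 * (x$2 ^+ 2 + x$4 ^+ 2) + wsq2 x - (x$1 * x$2 + x$3 * x$4).
Proof.
rewrite /dtau !Xf_first Xf_0 /om.
rewrite (sum_first2 _ (fun i => x$(i.*2.+1) * (Xf x)$(i.*2.+2) - x$(i.*2.+2) * (Xf x)$(i.*2.+1))).
have -> : \sum_(i < k) (x$(i.+2.*2.+1) * (Xf x)$(i.+2.*2.+2)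
      - x$(i.+2.*2.+2) * (Xf x)$(i.+2.*2.+1)) = - wsq2 x.
  rewrite -sumrN; apply: eq_bigr => i _; have ni : (i.+2 < n)%N by rewrite !ltnS.
  by rewrite Xf_x // Xf_y // /Xx /Xy /=; ring.
by rewrite /= !Xf_first; ring.
Qed.

Lemma dL_Xf_ge x : Ffun x = 0 -> Lfun x <= 2 ->
  (2 * (x$2 ^+ 2 + x$4 ^+ 2) + wsq2 x) / 2 + tau x ^+ 2 * (x$1 ^+ 2 + x$3 ^+ 2) / 50
  <= dL x (Xf x).
Proof.
rewrite /Ffun wsqE => F0 L2.
have sph : x$2 ^+ 2 + x$4 ^+ 2 + wsq2 x + tau x ^+ 2 = 1 by lra.
have := lyapunov_ineq (erefl _) (wsq2_ge0 x) sph L2 (erefl _) (erefl _).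
by rewrite /dL dtau_Xf !Xf_first.
Qed.

(** On the model there are two such points, which are the zeros of [Xf]. *)
Definition pole x := forall j, x$(j.+1) = 0.

(** If the lower bound vanishes then p = w = 0, hence tau^2 = 1, hence q = 0. *)
Lemma dL_Xf_gt0 x : Ffun x = 0 -> Lfun x <= 2 -> ~ pole x -> 0 < dL x (Xf x).
Proof.
move=> F0 L2 npx; rewrite ltNge; apply/negP => dL0; apply: npx.
have := le_trans (dL_Xf_ge F0 L2) dL0.
have W0 := wsq2_ge0 x; have q0 : 0 <= x$1 ^+ 2 + x$3 ^+ 2 by rewrite addr_ge0 ?sqr_ge0.
have p20 := sqr_ge0 (x$2); have p40 := sqr_ge0 (x$4).
have tq0 : 0 <= tau x ^+ 2 * (x$1 ^+ 2 + x$3 ^+ 2) by rewrite mulr_ge0 ?sqr_ge0.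
move=> H.
have W00 : wsq2 x = 0 by lra.
have p2 : x$2 ^+ 2 = 0 by lra.
have p4 : x$4 ^+ 2 = 0 by lra.
have t1 : tau x ^+ 2 = 1 by move: F0; rewrite /Ffun wsqE; lra.
have q1 : x$1 ^+ 2 + x$3 ^+ 2 = 0 by move: H; rewrite t1 mul1r; lra.
have q10 : x$1 ^+ 2 = 0 by have := sqr_ge0 (x$1); have := sqr_ge0 (x$3); lra.
have q30 : x$3 ^+ 2 = 0 by have := sqr_ge0 (x$1); have := sqr_ge0 (x$3); lra.
have sq0 (a : R) : a ^+ 2 = 0 -> a = 0 by move=> /eqP; rewrite sqrf_eq0 => /eqP.
have w0 (i : 'I_k) : x$(i.+2.*2.+1) = 0 /\ x$(i.+2.*2.+2) = 0.
  have Hi : x$(i.+2.*2.+1) ^+ 2 + x$(i.+2.*2.+2) ^+ 2 = 0.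
    by apply: (psumr_eq0P _ W00) => // j _; rewrite addr_ge0 ?sqr_ge0.
  have := sqr_ge0 (x$(i.+2.*2.+1)); have := sqr_ge0 (x$(i.+2.*2.+2)).
  by move: Hi => /= ? ? ?; split; apply: sq0; lra.
move=> j; have [nj|jn] := leqP n j./2.
  by rewrite coord_out //; rewrite /n in nj *; lia.
have : j.+1 = if odd j then j./2.*2.+2 else j./2.*2.+1 by case: ifP => oj; lia.
move: jn; case: (j./2) => [|[|i]] ik ->.
- by case: ifP => _ /=; apply: sq0.
- by case: ifP => _ /=; apply: sq0.
have ik' : (i < k)%N by [].
by have [wx wy] := w0 (Ordinal ik'); case: ifP.
Qed.

Lemma pole_wsq x : pole x -> wsq x = 0.
Proof.
move=> px; rewrite /wsq big1 // => i _.
by rewrite (px i.*2) (px i.*2.+1) expr0n mulr0 addr0.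
Qed.

Lemma pole_tau x : pole x -> tau x = x$0.
Proof.
move=> px; rewrite /tau (px 0%N) (px 1%N) (px 2%N) (px 3%N).
by rewrite expr0n /= !mulr0 !addr0 mul0r subr0.
Qed.

Lemma pole_eq x y : pole x -> pole y -> x$0 = y$0 -> x = y.
Proof. by move=> px py xy; apply/coordP => -[|j] _; rewrite ?px ?py. Qed.

Lemma pole_Xf x : pole x -> Xf x = 0.
Proof.
move=> px; apply/coordP => j _; rewrite coord0 coord_rowf; case: ifP => // _.
have X0 i : Xx x i = 0 by rewrite /Xx (px i.*2) (px i.*2.+1) !mulr0 subr0.
have Y0 i : Xy x i = 0.
  by rewrite /Xy (px i.*2) (px i.*2.+1) mulr0 add0r oppr0 addr0 mulr0; case: ifP.
case: j => [|j]; last by case: ifP.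
by rewrite big1 ?oppr0 // => i _; rewrite X0 Y0 !mulr0 subr0.
Qed.

Lemma dL0 x : dL x 0 = 0.
Proof.
have t0 : dtau x 0 = 0 by rewrite /dtau !coord0; ring.
by rewrite /dL t0 !coord0; ring.
Qed.

End BaseLyapunov.

(** * The model as a product of a disc and a sphere *)

Lemma smooth_coordn (R : realType) (V : normedModType R) m (U : set V)
    (c : V -> 'rV[R]_m) j : open U -> smooth U c -> smooth U (fun u => coord (c u) j).
Proof. by move=> oU sc; exact: ((smooth_rowP oU c).1 sc j). Qed.

Section BaseCharts.
Variables (R : realType) (k : nat).
Let n := k.+2.
Let E := 'rV[R]_(n.*2.+1).
Let D := 'rV[R]_(n.*2).
Local Notation "x $ i" := (coord x i) (at level 5, format "x $ i").
Implicit Types (x y : E) (u v : D).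

(** Replaces tau by z and rescales q, so that L <= 2 becomes |Q|^2 <= 1. *)
Definition theta y : E :=
  let r := Num.sqrt (4 - 2 * y$0) in
  let q1 := r * y$1 - eps R * y$0 * y$2 in
  let q2 := r * y$3 - eps R * y$0 * y$4 in
  rowf n.*2.+1 (fun j => match j with
    | 0 => y$0 - (q1 * y$2 + q2 * y$4) + (q1 ^+ 2 + q2 ^+ 2) / 2
    | 1 => q1 | 3 => q2 | _ => y$j end).

Definition thetaV x : E :=
  let r := Num.sqrt (4 - 2 * tau x) in
  rowf n.*2.+1 (fun j => match j with
    | 0 => tau x
    | 1 => (x$1 + eps R * tau x * x$2) / r
    | 3 => (x$3 + eps R * tau x * x$4) / r
    | _ => x$j end).

Lemma wsq_coord x j : j \notin [:: 0; 1; 3]%N -> x$j ^+ 2 <= wsq x.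
Proof.
move=> j3; have [jn|nj] := ltnP j n.*2.+1; last first.
  rewrite coord_out // expr0n /=; apply: sumr_ge0 => i _.
  by apply: addr_ge0; rewrite ?sqr_ge0 //; apply: mulr_ge0; rewrite ?ler0n ?sqr_ge0.
have j0 : (0 < j)%N by case: j j3 {jn}.
have jh : (j.-1./2 < n)%N by lia.
rewrite /wsq (bigD1 (Ordinal jh)) //=; apply: ler_wpDr.
  apply: sumr_ge0 => i _; apply: addr_ge0; rewrite ?sqr_ge0 //.
  by apply: mulr_ge0; rewrite ?ler0n ?sqr_ge0.
have := odd_double_half j.-1; case: (odd j.-1) => /= jE.
  have -> : (j.-1./2.*2.+2 = j)%N by lia.
  by rewrite ler_wpDl // mulr_ge0 ?ler0n ?sqr_ge0.
have -> : (j.-1./2.*2.+1 = j)%N by lia.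
have -> : (1 < j.-1./2)%N by move: j3 jE; rewrite !inE; lia.
by rewrite mul1r ler_wpDr // sqr_ge0.
Qed.

Lemma wsq_scale a x y :
  (forall j, j \notin [:: 0; 1; 3]%N -> x$j = a * y$j) -> wsq x = a ^+ 2 * wsq y.
Proof.
move=> xy; rewrite /wsq mulr_sumr; apply: eq_bigr => i _.
rewrite (xy i.*2.+2); last by case: (val i) => [|[]].
by case: (val i) => [|[|j]] /=; rewrite ?mul0r ?add0r ?exprMn // (xy _.+1) //=; ring.
Qed.

Lemma wsq_ext x y : (forall j, j \notin [:: 0; 1; 3]%N -> x$j = y$j) -> wsq x = wsq y.
Proof.
by move=> xy; rewrite (@wsq_scale 1 x y) => [|j j3]; rewrite ?expr1n ?mul1r // xy.
Qed.

Lemma coord_rowfE m (f : nat -> R) j : (forall j, (m <= j)%N -> f j = 0) ->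
  (rowf m f)$j = f j.
Proof. by move=> f0; rewrite coord_rowf; case: ltnP => // /f0. Qed.

Lemma coord_theta y j : (theta y)$j =
  let r := Num.sqrt (4 - 2 * y$0) in
  let q1 := r * y$1 - eps R * y$0 * y$2 in
  let q2 := r * y$3 - eps R * y$0 * y$4 in
  match j with
    | 0 => y$0 - (q1 * y$2 + q2 * y$4) + (q1 ^+ 2 + q2 ^+ 2) / 2
    | 1 => q1 | 3 => q2 | _ => y$j end.
Proof. by rewrite /theta coord_rowfE // => -[|[|[|[|i]]]] // ni; exact: coord_out. Qed.

Lemma coord_thetaV x j : (thetaV x)$j =
  let r := Num.sqrt (4 - 2 * tau x) in
  match j with
    | 0 => tau x
    | 1 => (x$1 + eps R * tau x * x$2) / r
    | 3 => (x$3 + eps R * tau x * x$4) / r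
    | _ => x$j end.
Proof. by rewrite /thetaV coord_rowfE // => -[|[|[|[|i]]]] // ni; exact: coord_out. Qed.

Lemma tau_theta y : tau (theta y) = y$0.
Proof. by rewrite /tau !coord_theta /=; field. Qed.

Lemma wsq_theta y : wsq (theta y) = wsq y.
Proof. by apply: wsq_ext => -[|[|[|[|j]]]] // _; rewrite coord_theta. Qed.

Lemma wsq_thetaV x : wsq (thetaV x) = wsq x.
Proof. by apply: wsq_ext => -[|[|[|[|j]]]] // _; rewrite coord_thetaV. Qed.

Lemma F_theta y : Ffun (theta y) = wsq y + y$0 ^+ 2 - 1.
Proof. by rewrite /Ffun tau_theta wsq_theta. Qed.

Lemma L_theta y : y$0 < 2 ->
  Lfun (theta y) = y$0 + (2 - y$0) * (y$1 ^+ 2 + y$3 ^+ 2).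
Proof.
move=> y2; rewrite /Lfun tau_theta !coord_theta /= !subrK !exprMn sqr_sqrtr; last by lra.
by field.
Qed.

Lemma thetaK y : y$0 < 2 -> thetaV (theta y) = y.
Proof.
move=> y2; have r0 : Num.sqrt (4 - 2 * y$0) != 0 by rewrite gt_eqF // sqrtr_gt0; lra.
apply/coordP => j _; rewrite coord_thetaV tau_theta !coord_theta /=.
by case: j => [|[|[|[|j]]]] //; rewrite subrK mulrAC divff // mul1r.
Qed.

Lemma thetaVK x : tau x < 2 -> theta (thetaV x) = x.
Proof.
move=> x2; have r0 : Num.sqrt (4 - 2 * tau x) != 0 by rewrite gt_eqF // sqrtr_gt0; lra.
apply/coordP => j _; rewrite coord_theta !coord_thetaV /=.
rewrite ![Num.sqrt _ * (_ / _)]mulrC !divfK // !addrK.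
by case: j => [|[|[|[|j]]]] //; rewrite /tau; field.
Qed.

Lemma smooth_theta (V : normedModType R) (U : set V) (c : V -> E) : open U -> smooth U c ->
  (forall t, U t -> (c t)$0 < 2) -> smooth U (fun t => theta (c t)).
Proof.
move=> oU sc c2; have sj j : smooth U (fun t => (c t)$j) by exact: smooth_coordn.
have sr : smooth U (fun t => Num.sqrt (4 - 2 * (c t)$0)).
  apply: smooth_sqrt => // [t /c2|]; first by lra.
  by apply: smoothB => //; [|apply: smoothM => //]; exact: smooth_cst.
have sq i j : smooth U (fun t => Num.sqrt (4 - 2 * (c t)$0) * (c t)$i
                              - eps R * (c t)$0 * (c t)$j).
  apply: smoothB => //; apply: smoothM => //; apply: smoothM => //; exact: smooth_cst.
apply/smooth_rowP => // j.
have eqc := fun t => esym (coord_theta (c t) j).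
apply: (smooth_ext oU (fun t _ => eqc t)); case: j {eqc} => [|[|[|[|j]]]] //=.
apply: smoothD => //; last first.
  by apply: smoothM => //; [apply: smoothD => //; apply: smoothX|exact: smooth_cst].
by apply: smoothB => //; apply: smoothD => //; apply: smoothM.
Qed.

Lemma smooth_tau (V : normedModType R) (U : set V) (c : V -> E) : open U -> smooth U c -> smooth U (fun t => tau (c t)).
Proof.
move=> oU sc; have sj j : smooth U (fun t => (c t)$j) by exact: smooth_coordn.
apply: smoothB => //.
  by apply: smoothD => //; [apply: smoothD => //|]; apply: smoothM.
by apply: smoothM => //; [apply: smoothD => //; apply: smoothX|exact: smooth_cst].
Qed.

(** The squared norm of all coordinates but u_0 and u_2. *)
Definition ssq u : R :=
  \sum_(i < n) ((1 < i)%N%:R * u$(i.*2) ^+ 2 + u$(i.*2.+1) ^+ 2).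

Lemma ssq_ge0 u : 0 <= ssq u.
Proof. by apply: sumr_ge0 => i _; apply: addr_ge0; rewrite ?sqr_ge0 //; apply: mulr_ge0; rewrite ?ler0n ?sqr_ge0. Qed.

Lemma smooth_ssq U : open U -> smooth U ssq.
Proof.
move=> oU; apply: smooth_sum => // i; apply: smoothD => //.
  by apply: smoothM => //; [exact: smooth_cst|apply: smoothX => //; exact: smooth_coord].
by apply: smoothX => //; exact: smooth_coord.
Qed.

Lemma wsq_ssq a x u :
  (forall j, j \notin [:: 0; 2]%N -> x$(j.+1) = a * u$j) -> wsq x = a ^+ 2 * ssq u.
Proof.
move=> xu; rewrite /wsq /ssq mulr_sumr; apply: eq_bigr => i _.
rewrite (xu i.*2.+1); last by case: (val i).
case: (val i) => [|[|j]]; try by rewrite /= !mul0r !add0r exprMn.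
by rewrite (xu j.+2.*2) //=; ring.
Qed.

Definition den u : R := (1 - u$0) ^+ 2 + u$2 ^+ 2.

(** Stereographic projection of the sphere from the pole of sign -e0, and
    Cayley transform of the half-plane u_0 < 0 (coordinates u_0, u_2) on the disc. *)
Definition bch (e0 e1 : R) u : E := rowf n.*2.+1 (fun j => match j with
  | 0 => e0 * ((1 - ssq u) / (1 + ssq u))
  | 1 => e1 * ((1 - u$0 ^+ 2 - u$2 ^+ 2) / den u)
  | 3 => e1 * (2 * u$2 / den u)
  | j'.+1 => 2 / (1 + ssq u) * u$j' end).

Lemma coord_bch e0 e1 u j : (bch e0 e1 u)$j = match j with
  | 0 => e0 * ((1 - ssq u) / (1 + ssq u))
  | 1 => e1 * ((1 - u$0 ^+ 2 - u$2 ^+ 2) / den u)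
  | 3 => e1 * (2 * u$2 / den u)
  | j'.+1 => 2 / (1 + ssq u) * u$j' end.
Proof.
rewrite /bch coord_rowfE // => -[|[|[|[|i]]]] // ni.
by rewrite coord_out ?mulr0.
Qed.

(** The squared distance from the boundary point of the disc which the Cayley transform
    misses. *)
Definition dval e1 y : R := (1 + e1 * y$1) ^+ 2 + y$3 ^+ 2.

Definition bchV (e0 e1 : R) y : D := rowf n.*2 (fun j => match j with
  | 0 => (y$1 ^+ 2 + y$3 ^+ 2 - 1) / dval e1 y
  | 2 => 2 * (e1 * y$3) / dval e1 y
  | _ => y$(j.+1) / (1 + e0 * y$0) end).

Lemma coord_bchV e0 e1 y j : (bchV e0 e1 y)$j = match j with
  | 0 => (y$1 ^+ 2 + y$3 ^+ 2 - 1) / dval e1 y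
  | 2 => 2 * (e1 * y$3) / dval e1 y
  | _ => y$(j.+1) / (1 + e0 * y$0) end.
Proof.
rewrite /bchV coord_rowfE // => -[|[|[|i]]] // ni.
by rewrite coord_out ?mul0r.
Qed.

Section Signs.
Variables e0 e1 : R.
Hypotheses (e0e0 : e0 ^+ 2 = 1) (e1e1 : e1 ^+ 2 = 1).

Lemma wsq_bch u : wsq (bch e0 e1 u) = (2 / (1 + ssq u)) ^+ 2 * ssq u.
Proof. by apply: wsq_ssq => -[|[|[|j]]] // _; rewrite coord_bch. Qed.

Lemma den_gt0 u : u$0 < 1 -> 0 < den u.
Proof. by move=> u1; rewrite ltr_pwDl ?sqr_ge0 // exprn_even_gt0 //= subr_eq0 gt_eqF. Qed.

Lemma ssq1_neq0 u : 1 + ssq u != 0.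
Proof. by rewrite gt_eqF // ltr_wpDr // ssq_ge0. Qed.

Lemma bch_sphere u : wsq (bch e0 e1 u) + (bch e0 e1 u)$0 ^+ 2 = 1.
Proof.
have s0 := ssq1_neq0 u; rewrite wsq_bch coord_bch [(e0 * _) ^+ 2]exprMn e0e0 mul1r.
by field.
Qed.

Lemma bch_q2 u : u$0 < 1 ->
  (bch e0 e1 u)$1 ^+ 2 + (bch e0 e1 u)$3 ^+ 2 = 1 + u$0 * (4 / den u).
Proof.
move=> /den_gt0 d0; rewrite !coord_bch ![(e1 * _) ^+ 2]exprMn e1e1 !mul1r.
have d0' : den u != 0 by rewrite gt_eqF.
rewrite !expr_div_n -mulrDl; apply: (mulIf (expf_neq0 2 d0')).
rewrite divfK ?expf_neq0 //.
have -> : (1 + u$0 * (4 / den u)) * den u ^+ 2 = den u ^+ 2 + u$0 * 4 * den u by field.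
by rewrite /den; ring.
Qed.

Lemma sphere_le1 y : wsq y + y$0 ^+ 2 = 1 -> y$0 <= 1.
Proof.
move=> H; have : 0 <= wsq y by apply: sumr_ge0 => i _; apply: addr_ge0; rewrite ?sqr_ge0 //; apply: mulr_ge0; rewrite ?ler0n ?sqr_ge0.
nra.
Qed.

Lemma bch0_le1 u : (bch e0 e1 u)$0 <= 1.
Proof. exact: sphere_le1 (bch_sphere u). Qed.

Lemma bch_tau u : 1 + e0 * (bch e0 e1 u)$0 = 2 / (1 + ssq u).
Proof.
have s0 := ssq1_neq0 u; rewrite coord_bch [e0 * (e0 * _)]mulrA -expr2 e0e0 mul1r.
by field.
Qed.

Lemma dval_bch u : u$0 < 1 -> dval e1 (bch e0 e1 u) = 4 / den u.
Proof.
move=> u1; have d0 : den u != 0 by rewrite gt_eqF ?den_gt0.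
have q2 := bch_q2 u1.
have -> : dval e1 (bch e0 e1 u) = 1 + 2 * (e1 * (bch e0 e1 u)$1)
    + ((bch e0 e1 u)$1 ^+ 2 + (bch e0 e1 u)$3 ^+ 2).
  by rewrite /dval sqrrD expr1n mul1r exprMn e1e1 mul1r; ring.
rewrite q2 coord_bch [e1 * (e1 * _)]mulrA -expr2 e1e1 mul1r.
apply: (mulIf d0); rewrite divfK //.
have -> : (1 + 2 * ((1 - u$0 ^+ 2 - u$2 ^+ 2) / den u) + (1 + u$0 * (4 / den u))) * den u
  = 2 * den u + 2 * (1 - u$0 ^+ 2 - u$2 ^+ 2) + 4 * u$0 by field.
by rewrite /den; ring.
Qed.

Lemma bchK u : u$0 < 1 -> bchV e0 e1 (bch e0 e1 u) = u.
Proof.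
move=> u1; have d0 : den u != 0 by rewrite gt_eqF ?den_gt0.
have s0 := ssq1_neq0 u.
apply/coordP => j _; rewrite coord_bchV dval_bch // bch_tau.
case: j => [|[|[|j]]].
- by rewrite bch_q2 // addrC addKr; field.
- by rewrite coord_bch; field.
- by rewrite coord_bch [e1 * _]mulrA -expr2 e1e1 mul1r; field.
- by rewrite coord_bch; field.
Qed.

Lemma bchVK y : wsq y + y$0 ^+ 2 = 1 -> 1 + e0 * y$0 != 0 -> dval e1 y != 0 ->
  bch e0 e1 (bchV e0 e1 y) = y.
Proof.
move=> sph t0 d0.
have sE : ssq (bchV e0 e1 y) = (1 - e0 * y$0) / (1 + e0 * y$0).
  have : wsq y = (1 + e0 * y$0) ^+ 2 * ssq (bchV e0 e1 y).
    apply: wsq_ssq => -[|[|[|j]]] // _; rewrite coord_bchV mulrC divfK //.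
  move=> H; apply: (mulIf (expf_neq0 2 t0)).
  rewrite mulrC -H; have -> : wsq y = 1 - (e0 * y$0) ^+ 2.
    by rewrite exprMn e0e0 mul1r -sph addrK.
  by field.
have t2 : 1 + ssq (bchV e0 e1 y) = 2 / (1 + e0 * y$0) by rewrite sE; field.
have dE : den (bchV e0 e1 y) = 4 / dval e1 y.
  rewrite /den !coord_bchV.
  apply: (mulIf (expf_neq0 2 d0)).
  have -> : 4 / dval e1 y * dval e1 y ^+ 2 = 4 * dval e1 y by field.
  have -> : ((1 - (y$1 ^+ 2 + y$3 ^+ 2 - 1) / dval e1 y) ^+ 2
     + (2 * (e1 * y$3) / dval e1 y) ^+ 2) * dval e1 y ^+ 2
     = (dval e1 y - (y$1 ^+ 2 + y$3 ^+ 2 - 1)) ^+ 2 + 4 * (e1 ^+ 2 * y$3 ^+ 2).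
    by field.
  have -> : dval e1 y - (y$1 ^+ 2 + y$3 ^+ 2 - 1) = 2 * (1 + e1 * y$1).
    by rewrite /dval sqrrD exprMn e1e1 expr1n; ring.
  by rewrite e1e1 /dval; ring.
have y1E : (bchV e0 e1 y)$0 ^+ 2 + (bchV e0 e1 y)$2 ^+ 2
    = den (bchV e0 e1 y) + 2 * (bchV e0 e1 y)$0 - 1 by rewrite /den; ring.
apply/coordP => j _; rewrite coord_bch t2 dE; case: j => [|[|[|[|j]]]].
- rewrite sE; have -> : 1 - (1 - e0 * y$0) / (1 + e0 * y$0) = 2 * (e0 * y$0) / (1 + e0 * y$0).
    by field.
  by rewrite -[RHS]mul1r -[X in _ = X * _]e0e0; field.
- rewrite -addrA -opprD y1E dE coord_bchV.
  have -> : (1 - (4 / dval e1 y + 2 * ((y$1 ^+ 2 + y$3 ^+ 2 - 1) / dval e1 y) - 1)) / (4 / dval e1 y)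
    = (dval e1 y - (y$1 ^+ 2 + y$3 ^+ 2) - 1) / 2 by field.
  have -> : dval e1 y - (y$1 ^+ 2 + y$3 ^+ 2) - 1 = 2 * (e1 * y$1).
    by rewrite /dval sqrrD exprMn e1e1 expr1n; ring.
  by rewrite [2 * _]mulrC mulfK // mulrA -expr2 e1e1 mul1r.
- by rewrite coord_bchV; field.
- by rewrite coord_bchV -[RHS]mul1r -[X in _ = X * _]e1e1; field.
- by rewrite coord_bchV; field.
Qed.

End Signs.
End BaseCharts.

(** * Charts away from the poles *)

Lemma open_pos (R : realType) (V : normedModType R) (U : set V) (f : V -> R) :
  open U -> smooth U f -> open [set x | U x /\ 0 < f x].
Proof.
move=> oU sf; have -> : [set x | U x /\ 0 < f x] = U `&` f @^-1` [set t | 0 < t] by [].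
rewrite openE => x [Ux fx]; apply: filterI; first exact: open_nbhs_nbhs.
have /differentiable_continuous cf := smooth_diff sf Ux.
by apply: cf; apply: open_nbhs_nbhs; split => //; exact: open_gt.
Qed.

Lemma smooth_precomp (R : realType) m d (W : normedModType R) (U : set 'rV[R]_d)
    (f : 'rV[R]_d -> W) (T : {linear 'rV[R]_m -> 'rV[R]_d}) : open (T @^-1` U) ->
  smooth U f -> smooth (T @^-1` U) (fun x => f (T x)).
Proof.
move=> oTU /smooth_Ck sf; apply/smooth_Ck => j; elim: j f sf => [|j IHj] f sf.
  split=> // x Ux; apply: (@differentiable_comp _ _ _ _ T f).
    exact: differentiable_linear.
  exact: Ck_diff (sf 0%N) Ux.
have dfT x : (T @^-1` U) x -> differentiable f (T x) by exact: Ck_diff (sf 0%N).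
split=> [x Ux|v].
  by apply: (@differentiable_comp _ _ _ _ T f); [exact: differentiable_linear|exact: dfT].
have H := IHj ('D_(T v) f) (fun j => (proj2 (sf j.+1)) (T v)).
apply: Ck_ext H => // x Ux.
rewrite [RHS]derive_comp ?derive_linear //; last exact: dfT.
exact: differentiable_linear.
Qed.

Lemma preimage_linear_open (R : realType) m d (T : {linear 'rV[R]_m -> 'rV[R]_d})
    (U : set 'rV[R]_d) : open U -> open (T @^-1` U).
Proof.
move=> oU; apply: open_comp => // x _.
exact/differentiable_continuous/differentiable_linear.
Qed.

Section BaseChart.
Variables (R : realType) (k : nat).
Let n := k.+2.
Let E := 'rV[R]_(n.*2.+1).
Let D := 'rV[R]_(n.*2).
Local Notation "x $ i" := (coord x i) (at level 5, format "x $ i").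
Implicit Types (x y : E) (u v : D).

Definition S0 : set E := [set x | Ffun x = 0 /\ Lfun x <= 2].

(** A chart of the model, up to orientation.  It has a left inverse on an
    open set of the ambient space.  By [bc_bd], u_0 is a boundary defining function
    with the same differential as L up to a positive factor. *)
Record base_chart (U0 : set D) (c0 : D -> E) : Prop := BaseChart {
  bc_open : open U0;
  bc_smooth : smooth U0 c0;
  bc_F : forall u, U0 u -> Ffun (c0 u) = 0;
  bc_L : forall u, U0 u -> u$0 <= 0 -> Lfun (c0 u) <= 2;
  bc_inv : exists (O : set E) (r : E -> D), [/\ open O, smooth O r,
    forall u, U0 u -> O (c0 u) /\ r (c0 u) = u
    & forall x, S0 x -> O x -> U0 (r x) -> (r x)$0 <= 0 /\ c0 (r x) = x];
  bc_bd : forall u, U0 u -> u$0 = 0 ->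
    exists2 a : R, 0 < a & forall V, dL (c0 u) ('D_V c0 u) = a * V$0 }.

Section Reflection.
Variable e : R.

Definition refl_coef (j : nat) : R := if j == 1%N then e else 1.

Definition reflmx : 'M[R]_n.*2 := \matrix_(i, j) (if i == j then refl_coef i else 0).
(** Reflections in the coordinate u_1 correct the orientation of charts. *)
Definition refl : {linear D -> D} := mulmxr reflmx.
Arguments refl : simpl never.

Lemma coord_refl u j : (refl u)$j = refl_coef j * u$j.
Proof.
have [nj|jn] := leqP n.*2 j; first by rewrite !coord_out ?mulr0.
rewrite (coord_ord (refl u) (Ordinal jn)) (coord_ord u (Ordinal jn)) mxE.
rewrite (bigD1 (Ordinal jn)) //= big1 ?addr0 => [|i ij].
  by rewrite !mxE eqxx mulrC.
by rewrite !mxE (negbTE ij) mulr0.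
Qed.

Hypothesis ee : e ^+ 2 = 1.

Lemma refl_coefK j : refl_coef j * refl_coef j = 1.
Proof. by rewrite /refl_coef; case: ifP; rewrite ?mulr1 // -expr2. Qed.

Lemma reflK u : refl (refl u) = u.
Proof. by apply/coordP => j _; rewrite !coord_refl mulrA refl_coefK mul1r. Qed.

Lemma base_chart_refl U0 c0 : base_chart U0 c0 ->
  base_chart (refl @^-1` U0) (fun u => c0 (refl u)).
Proof.
move=> [oU sc cF cL [Or [r [oO sr rc cr]]] cb].
have oU' : open (refl @^-1` U0) by exact: preimage_linear_open.
split=> //.
- exact: smooth_precomp.
- by move=> u; exact: cF.
- by move=> u Uu u0; apply: cL => //; rewrite coord_refl mul1r.
- exists Or, (fun x => refl (r x)); split=> //.
  + exact: smooth_linear_comp.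
  + by move=> u Uu; have [Ou ->] := rc _ Uu; rewrite reflK.
  + move=> x Sx Ox Ux0; have rK : refl (refl (r x)) = r x by exact: reflK.
    have Ux : U0 (r x) by rewrite -rK.
    have [r0 rx] := cr x Sx Ox Ux; split; last by rewrite rK.
    by rewrite coord_refl mul1r.
- move=> u Uu u0; have u0r : (refl u)$0 = 0 by rewrite coord_refl u0 mulr0.
  have [a a0 aP] := cb _ Uu u0r.
  have dr : differentiable refl u by exact: differentiable_linear.
  have dc : differentiable c0 (refl u) := smooth_diff sc Uu.
  exists a => [//|V]; rewrite (derive_comp V dr dc) derive_linear aP.
  by rewrite coord_refl mul1r.
Qed.

End Reflection.

Lemma smooth_thetaV U : open U -> (forall x, U x -> tau x < 2) -> smooth U (@thetaV R k).
Proof.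
move=> oU U2; have sj j : smooth U (fun x : E => x$j) by exact: smooth_coord.
have st : smooth U (@tau R k).
  apply: smoothB => //.
    by apply: smoothD => //; [apply: smoothD => //|]; apply: smoothM.
  by apply: smoothM => //; [apply: smoothD => //; apply: smoothX|exact: smooth_cst].
have sr : smooth U (fun x : E => (Num.sqrt (4 - 2 * tau x))^-1).
  apply: smoothV => // [x /U2 x2|]; first by rewrite gt_eqF // sqrtr_gt0; lra.
  apply: smooth_sqrt => // [x /U2|]; first by lra.
  by apply: smoothB => //; [|apply: smoothM => //]; exact: smooth_cst.
have sq i j : smooth U (fun x : E => (x$i + eps R * tau x * x$j)
                                     / Num.sqrt (4 - 2 * tau x)).
  apply: smoothM => //; apply: smoothD => //; apply: smoothM => //.
  by apply: smoothM => //; exact: smooth_cst.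
apply/smooth_rowP => // j.
have eqc := fun x : E => esym (coord_thetaV x j).
by apply: (smooth_ext oU (fun x _ => eqc x)); case: j {eqc} => [|[|[|[|j]]]] //=.
Qed.

Lemma smooth_tau_id U : open U -> smooth U (@tau R k).
Proof. by move=> oU; exact: (smooth_tau oU (smooth_id oU)). Qed.

Section Rational.
Variables e0 e1 : R.
Hypotheses (e0e0 : e0 ^+ 2 = 1) (e1e1 : e1 ^+ 2 = 1).

(** The second condition removes the poles. *)
Definition bdom : set D :=
  [set u | u$0 < 1 /\ 0 < (1 + u$0) ^+ 2 + u$2 ^+ 2 + ssq u].

Lemma bdom_open : open bdom.
Proof.
have o1 : open [set u : D | setT u /\ 0 < 1 - u$0].
  apply: open_pos; first exact: openT.
  by apply: smoothB; [exact: openT|apply: smooth_cst|apply: smooth_coord; exact: openT].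
rewrite (_ : bdom = [set u | [set u : D | setT u /\ 0 < 1 - u$0] u
                          /\ 0 < (1 + u$0) ^+ 2 + u$2 ^+ 2 + ssq u]).
  apply: open_pos => //; have sj j : smooth [set u : D | setT u /\ 0 < 1 - u$0] (fun u => u$j).
    exact: smooth_coord.
  apply: smoothD => //; last exact: smooth_ssq.
  apply: smoothD => //; apply: smoothX => //; apply: smoothD => //; exact: smooth_cst.
by apply/seteqP; split=> u /=; rewrite subr_gt0 => -[]; [|case].
Qed.

Lemma smooth_bch (U : set D) : open U -> (forall u, U u -> u$0 < 1) -> smooth U (bch e0 e1).
Proof.
move=> oU U1; have sj j : smooth U (fun u => u$j) by exact: smooth_coord.
have sc (a : R) : smooth U (fun=> a) by exact: smooth_cst.
have ss : smooth U (fun u => 1 + ssq u) by apply: smoothD => //; exact: smooth_ssq.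
have sv : smooth U (fun u => (1 + ssq u)^-1).
  by apply: smoothV => // u _; exact: ssq1_neq0.
have sd : smooth U (fun u => (den u)^-1).
  apply: smoothV => // [u /U1 /den_gt0|]; first by rewrite lt0r => /andP[].
  by apply: smoothD => //; apply: smoothX => //; apply: smoothB.
apply/smooth_rowP => // j.
have eqc := fun u : D => esym (coord_bch e0 e1 u j).
apply: (smooth_ext oU (fun u _ => eqc u)); case: j {eqc} => [|[|[|[|j]]]] /=.
- by apply: smoothM => //; apply: smoothM => //; apply: smoothB => //; exact: smooth_ssq.
- apply: smoothM => //; apply: smoothM => //; apply: smoothB => //; last exact: smoothX.
  by apply: smoothB => //; exact: smoothX.
- by apply: smoothM => //; apply: smoothM.
- by apply: smoothM => //; apply: smoothM => //; apply: smoothM.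
- by apply: smoothM => //; apply: smoothM.
Qed.

Lemma smooth_bchV (U : set E) (c : E -> E) : open U -> smooth U c ->
  (forall x, U x -> dval e1 (c x) != 0 /\ 1 + e0 * (c x)$0 != 0) ->
  smooth U (fun x => bchV e0 e1 (c x)).
Proof.
move=> oU scc Un; have sj j : smooth U (fun x => (c x)$j) by exact: smooth_coordn.
have sc (a : R) : smooth U (fun=> a) by exact: smooth_cst.
have sd : smooth U (fun x => (dval e1 (c x))^-1).
  apply: smoothV => // [x /Un[]//|].
  by apply: smoothD => //; apply: smoothX => //; apply: smoothD => //; exact: smoothM.
have st : smooth U (fun x => (1 + e0 * (c x)$0)^-1).
  by apply: smoothV => // [x /Un[]//|]; apply: smoothD => //; exact: smoothM.
apply/smooth_rowP => // j.
have eqc := fun x : E => esym (coord_bchV e0 e1 (c x) j).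
apply: (smooth_ext oU (fun x _ => eqc x)); case: j {eqc} => [|[|[|j]]] /=.
- apply: smoothM => //; apply: smoothB => //; apply: smoothD => //; exact: smoothX.
- exact: smoothM.
- by apply: smoothM => //; apply: smoothM => //; exact: smoothM.
- exact: smoothM.
Qed.

Lemma S0_sphere x : S0 x -> wsq x + tau x ^+ 2 = 1.
Proof. by rewrite /S0 /Ffun /= => -[F0 _]; lra. Qed.

Lemma S0_tau x : S0 x -> tau x <= 1.
Proof.
move=> /S0_sphere sph; have := @sphere_le1 R k (thetaV x).
by rewrite wsq_thetaV coord_thetaV; apply.
Qed.

Lemma L_bch u : u$0 < 1 ->
  Lfun (theta (bch e0 e1 u))
  = 2 + u$0 * ((2 - (bch e0 e1 u)$0) * (4 / den u)).
Proof.
move=> u1; have b2 := bch0_le1 e1 e0e0 u.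
rewrite L_theta ?bch_q2 //; last by lra.
ring.
Qed.

Lemma base_chart_bch : base_chart bdom (fun u => theta (bch e0 e1 u)).
Proof.
have oU := bdom_open.
have b2 u : (bch e0 e1 u)$0 < 2 by have := bch0_le1 e1 e0e0 u; lra.
have U1 u : bdom u -> u$0 < 1 by case.
have sb : smooth bdom (bch e0 e1) by exact: smooth_bch.
have sc : smooth bdom (fun u => theta (bch e0 e1 u)) by apply: smooth_theta.
split=> //.
- by move=> u _; rewrite F_theta bch_sphere // subrr.
- move=> u [u1 _] u0; rewrite L_bch // gerDl.
  apply: mulr_le0_ge0 => //; apply: mulr_ge0; first by have := b2 u; lra.
  by rewrite divr_ge0 // ltW // den_gt0.
- pose O1 : set E := [set x | setT x /\ 0 < 2 - tau x].
  have oO1 : open O1.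
    apply: open_pos; first exact: openT.
    apply: smoothB; [exact: openT|exact: smooth_cst|apply: smooth_tau_id; exact: openT].
  have O12 x : O1 x -> tau x < 2 by rewrite /O1 /=; lra.
  have sth : smooth O1 (@thetaV R k) by exact: smooth_thetaV.
  pose f x := ((1 + e0 * (thetaV x)$0) * dval e1 (thetaV x)) ^+ 2.
  have sf : smooth O1 f.
    have sj j : smooth O1 (fun x => (thetaV x)$j) by exact: smooth_coordn.
    have scst (a : R) : smooth O1 (fun=> a) by exact: smooth_cst.
    apply: smoothX => //; apply: smoothM => //.
      by apply: smoothD => //; exact: smoothM.
    by apply: smoothD => //; apply: smoothX => //; apply: smoothD => //; exact: smoothM.
  have oO : open [set x | O1 x /\ 0 < f x] by exact: open_pos.
  have fP x : 0 < f x -> dval e1 (thetaV x) != 0 /\ 1 + e0 * (thetaV x)$0 != 0.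
    by rewrite /f exprn_even_gt0 //= mulf_eq0 negb_or => /andP[].
  exists [set x | O1 x /\ 0 < f x], (fun x => bchV e0 e1 (thetaV x)); split=> //.
  + apply: smooth_bchV => //; last by move=> x [_ /fP].
    by apply: (smoothW _ sth) => x [].
  + move=> u Uu; rewrite thetaK // bchK ?U1 //; split=> //; split.
      by rewrite /O1 /= tau_theta; split=> //; have := b2 u; lra.
    rewrite /f thetaK // bch_tau // dval_bch ?U1 // exprn_even_gt0 //= mulf_neq0 //.
      by rewrite mulf_neq0 // invr_eq0 ssq1_neq0.
    by rewrite mulf_neq0 // invr_eq0 gt_eqF // den_gt0 // U1.
  + move=> x Sx [/O12 x2 /fP[d0 t0]] [r1 _].
    have sph : wsq (thetaV x) + (thetaV x)$0 ^+ 2 = 1.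
      by rewrite wsq_thetaV coord_thetaV S0_sphere.
    have E1 : theta (bch e0 e1 (bchV e0 e1 (thetaV x))) = x by rewrite bchVK ?thetaVK.
    split=> //; have [_ L2] := Sx.
    move: L2; rewrite -{1}E1 L_bch // gerDl pmulr_lle0 //.
    rewrite mulr_gt0 //; first by have := b2 (bchV e0 e1 (thetaV x)); lra.
    by rewrite divr_gt0 // den_gt0.
- move=> u Uu u0; have u1 := U1 u Uu.
  pose m u := (2 - (bch e0 e1 u)$0) * (4 / den u).
  have sm : smooth bdom m.
    have scst (a : R) : smooth bdom (fun=> a) by exact: smooth_cst.
    have sj j : smooth bdom (fun u => u$j) by exact: smooth_coord.
    apply: smoothM => //; first by apply: smoothB => //; exact: smooth_coordn.
    apply: smoothM => //; apply: smoothV => // [v /U1 /den_gt0|].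
      by rewrite lt0r => /andP[].
    by apply: smoothD => //; apply: smoothX => //; apply: smoothB.
  exists (m u).
    rewrite mulr_gt0 //; first by have := b2 u; lra.
    by rewrite divr_gt0 // den_gt0.
  move=> V; have [_ <-] := isD_L V (smooth_diff sc Uu).
  have dm : differentiable m u by exact: smooth_diff sm Uu.
  have -> : 'D_V (fun t => Lfun (theta (bch e0 e1 t))) u = 'D_V (fun t => 2 + t$0 * m t) u.
    apply: near_eq_derive; apply: filterS (open_nbhs_nbhs (conj oU Uu)) => t Ut.
    by rewrite L_bch // U1.
  have H : isD u V (fun t : D => 2 + t$0 * m t) (0 + (V$0 * m u + u$0 * 'D_V m u)).
    apply: isD_add; first exact: isD_cst.
    apply: isD_mul; last by split.
    by apply: isD_coord; [by []|exact: derive_id].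
  by have [_ ->] := H; rewrite u0 mul0r addr0 add0r mulrC.
Qed.

End Rational.
End BaseChart.

(** * Charts around the poles *)

Section Atlas.
Variables (R : realType) (k : nat).
Let n := k.+2.
Let E := 'rV[R]_(n.*2.+1).
Let D := 'rV[R]_(n.*2).
Local Notation "x $ i" := (coord x i) (at level 5, format "x $ i").
Implicit Types (x y : E) (u v : D).

Lemma pole_intro x : wsq x = 0 -> x$1 = 0 -> x$3 = 0 -> pole x.
Proof.
move=> W0 x1 x3 j; case: (boolP (j.+1 \in [:: 0; 1; 3]%N)) => [|/(wsq_coord x)].
  by rewrite !inE => /or3P[] /eqP // ->.
by rewrite W0 => xj; apply/eqP; rewrite -sqrf_eq0 eq_le xj sqr_ge0.
Qed.

Lemma theta_bch_npole e0 e1 u : e0 ^+ 2 = 1 -> e1 ^+ 2 = 1 -> bdom u ->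
  ~ pole (theta (bch e0 e1 u)).
Proof.
move=> e0e0 e1e1 [u1 u0] px.
have b2 : (bch e0 e1 u)$0 < 2 by have := bch0_le1 e1 e0e0 u; lra.
have := pole_wsq px; rewrite wsq_theta wsq_bch => /eqP.
rewrite mulf_eq0 expf_eq0 /= mulf_eq0 invr_eq0 (negbTE (ssq1_neq0 u)) orbF pnatr_eq0 /=.
move=> /eqP s0.
have r0 : Num.sqrt (4 - 2 * (bch e0 e1 u)$0) != 0 by rewrite gt_eqF // sqrtr_gt0; lra.
have x2 : (bch e0 e1 u)$2 = 0 by have := px 1%N; rewrite coord_theta.
have x4 : (bch e0 e1 u)$4 = 0 by have := px 3%N; rewrite coord_theta.
have x1 : (bch e0 e1 u)$1 = 0.
  by have := px 0%N; rewrite coord_theta /= x2 mulr0 subr0 => /eqP; rewrite mulf_eq0 (negbTE r0) => /eqP.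
have x3 : (bch e0 e1 u)$3 = 0.
  by have := px 2%N; rewrite coord_theta /= x4 mulr0 subr0 => /eqP; rewrite mulf_eq0 (negbTE r0) => /eqP.
have := bch_q2 e0 e1e1 u1; rewrite x1 x3 expr0n /= addr0.
have d0 := den_gt0 u1; have d0' : den u != 0 by rewrite gt_eqF.
move=> /(congr1 (fun t => t * den u)); rewrite mul0r.
have -> : (1 + u$0 * (4 / den u)) * den u = den u + 4 * u$0 by field.
by move: u0; rewrite s0 addr0 /den; lra.
Qed.

(** The coordinate u_0 + 5 stands for q_0, so that u_0 < 0 on this chart. *)
Definition gdom : set D := [set u | ssq u < 1 /\ (u$0 + 5) ^+ 2 + u$2 ^+ 2 < 4^-1].

(** The graph of tau = e0 sqrt(1 - |p|^2 - |w|^2) over (q, p, w). *)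
Definition gch (e0 : R) u : E := rowf n.*2.+1 (fun j => match j with
  | 0 => e0 * Num.sqrt (1 - ssq u) - ((u$0 + 5) * u$1 + u$2 * u$3)
         + ((u$0 + 5) ^+ 2 + u$2 ^+ 2) / 2
  | 1 => u$0 + 5
  | j'.+1 => u$j' end).

Lemma coord_gch e0 u j : (gch e0 u)$j = match j with
  | 0 => e0 * Num.sqrt (1 - ssq u) - ((u$0 + 5) * u$1 + u$2 * u$3)
         + ((u$0 + 5) ^+ 2 + u$2 ^+ 2) / 2
  | 1 => u$0 + 5
  | j'.+1 => u$j' end.
Proof. by rewrite /gch coord_rowfE // => -[|[|i]] // ni; exact: coord_out. Qed.

Lemma wsq_gch e0 u : wsq (gch e0 u) = ssq u.
Proof.
by rewrite (wsq_ssq (a := 1) (u := u)) ?expr1n ?mul1r // => -[|[|[|j]]] // _;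
  rewrite coord_gch mul1r.
Qed.

Lemma tau_gch e0 u : tau (gch e0 u) = e0 * Num.sqrt (1 - ssq u).
Proof. by rewrite /tau !coord_gch; field. Qed.

Definition upole : D := -5 *: basis R n.*2 0.

Lemma coord_upole j : upole$j = if j == 0%N then -5 else 0.
Proof. by rewrite coordZ coord_basis; case: j => [|j]; rewrite /= ?mulr1 ?mul0rn ?mulr0. Qed.

Lemma ssq_upole : ssq upole = 0.
Proof.
rewrite /ssq big1 // => i _; rewrite !coord_upole /= expr0n addr0.
by case: (val i) => [|j]; rewrite ?mul0r //= expr0n mulr0.
Qed.

Lemma gdom_upole : gdom upole.
Proof.
split; first by rewrite ssq_upole.
by rewrite !coord_upole /= addNr expr0n addr0 invr_gt0.
Qed.

Lemma pole_gch e0 u : pole (gch e0 u) -> u = upole.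
Proof.
move=> px; apply/coordP => j _; rewrite coord_upole.
by have := px j; rewrite coord_gch; case: j => [|j] //=; lra.
Qed.

Lemma gch_upole e0 : pole (gch e0 upole) /\ (gch e0 upole)$0 = e0.
Proof.
split.
  move=> j; rewrite coord_gch; case: j => [|j]; rewrite !coord_upole //=; lra.
rewrite coord_gch ssq_upole !coord_upole /= subr0 sqrtr1; lra.
Qed.

Section Graph.
Variable e0 : R.
Hypothesis e0e0 : e0 ^+ 2 = 1.

Lemma gdom_open : open gdom.
Proof.
have oT := @openT D.
have sj (U : set D) j : open U -> smooth U (fun u => u$j) by move=> oU; exact: smooth_coord.
have scst (U : set D) (a : R) : open U -> smooth U (fun=> a) by move=> oU; exact: smooth_cst.
have o1 : open [set u : D | setT u /\ 0 < 1 - ssq u].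
  by apply: open_pos => //; apply: smoothB; [exact: oT|exact: scst|exact: smooth_ssq].
rewrite (_ : gdom = [set u | [set u : D | setT u /\ 0 < 1 - ssq u] u
                          /\ 0 < 4^-1 - ((u$0 + 5) ^+ 2 + u$2 ^+ 2)]).
  apply: open_pos => //; apply: smoothB => //; first exact: scst.
  apply: smoothD => //; apply: smoothX => //; last exact: sj.
  by apply: smoothD => //; [exact: sj|exact: scst].
by apply/seteqP; split=> u /=; rewrite !subr_gt0 => -[]; [|case].
Qed.

Lemma smooth_gch : smooth gdom (gch e0).
Proof.
have oU := gdom_open.
have sj j : smooth gdom (fun u => u$j) by exact: smooth_coord.
have scst (a : R) : smooth gdom (fun=> a) by exact: smooth_cst.
have sr : smooth gdom (fun u => Num.sqrt (1 - ssq u)).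
  apply: smooth_sqrt => // [u []|]; first by lra.
  by apply: smoothB => //; exact: smooth_ssq.
apply/smooth_rowP => // j.
have eqc := fun u : D => esym (coord_gch e0 u j).
apply: (smooth_ext oU (fun u _ => eqc u)); case: j {eqc} => [|[|j]] //=.
  apply: smoothD => //.
    apply: smoothB => //; first exact: smoothM.
    by apply: smoothD => //; apply: smoothM => //; exact: smoothD.
  by apply: smoothM => //; apply: smoothD => //; apply: smoothX => //; exact: smoothD.
exact: smoothD.
Qed.

Lemma gdom_neg u : gdom u -> u$0 < 0.
Proof.
move=> [_ H]; have := sqr_ge0 (u$2) => H2; have {}H : (u$0 + 5) ^+ 2 < 1 by lra.
by nra.
Qed.

Lemma gch_F u : gdom u -> Ffun (gch e0 u) = 0.
Proof.
move=> [s1 _]; rewrite /Ffun wsq_gch tau_gch exprMn e0e0 mul1r sqr_sqrtr; last by lra.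
ring.
Qed.

Lemma gch_L u : gdom u -> Lfun (gch e0 u) <= 2.
Proof.
move=> gu; have := gch_F gu; rewrite /Ffun /Lfun wsqE.
move: gu => [_]; have -> : u$0 + 5 = (gch e0 u)$1 by rewrite coord_gch.
have -> : u$2 = (gch e0 u)$3 by rewrite coord_gch.
have := wsq2_ge0 (gch e0 u).
move: (gch e0 u)$1 (gch e0 u)$3 (gch e0 u)$2 (gch e0 u)$4 (wsq2 _) (tau _)
  => q1 q2 p1 p2 W t W0 Q4 F0.
have tp (p : R) : p ^+ 2 + t ^+ 2 <= 1 -> (eps R * t * p) ^+ 2 <= 1 / 400.
  move=> pt; have -> : (eps R * t * p) ^+ 2 = (t ^+ 2 * p ^+ 2) / 400.
    by rewrite /eps; field.
  have tt := sqr_ge0 t; have pp := sqr_ge0 p; have t1 : t ^+ 2 <= 1 by lra.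
  have := ler_piMl pp t1; lra.
have H1 := tp p1; have H2 := tp p2.
have pp1 := sqr_ge0 p1; have pp2 := sqr_ge0 p2.
have {}H1 : (eps R * t * p1) ^+ 2 <= 1 / 400 by apply: H1; lra.
have {}H2 : (eps R * t * p2) ^+ 2 <= 1 / 400 by apply: H2; lra.
have t1 : t <= 1 by nra.
have S (a b : R) : (a + b) ^+ 2 <= 2 * a ^+ 2 + 2 * b ^+ 2.
  by have := sqr_ge0 (a - b); rewrite sqrrB sqrrD; lra.
have := S q1 (eps R * t * p1); have := S q2 (eps R * t * p2).
lra.
Qed.

Lemma base_chart_gch : base_chart gdom (gch e0).
Proof.
have oU := gdom_open; have sc := smooth_gch.
split=> //.
- exact: gch_F.
- by move=> u gu _; exact: gch_L.
- pose O1 : set E := [set x | setT x /\ 0 < e0 * tau x].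
  have oO1 : open O1.
    apply: open_pos; first exact: openT.
    by apply: smoothM; [exact: openT|exact: smooth_cst|apply: smooth_tau_id; exact: openT].
  pose r x : D := rowf n.*2 (fun j => if j == 0%N then x$1 - 5 else x$(j.+1)).
  have rE x j : (r x)$j = if j == 0%N then x$1 - 5 else x$(j.+1).
    by rewrite coord_rowfE // => -[|i] // ni; exact: coord_out.
  exists O1, r; split=> //.
  + apply: smooth_rowf => // j; case: (j == 0%N); last exact: smooth_coord.
    by apply: smoothB => //; [exact: smooth_coord|exact: smooth_cst].
  + move=> u [s1 _]; split.
      rewrite /O1 /= tau_gch mulrA -expr2 e0e0 mul1r sqrtr_gt0.
      by split=> //; lra.
    apply/coordP => j _; rewrite rE !coord_gch.
    by case: j => [|j] //=; rewrite addrK.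
  + move=> x Sx [_ t0] Ux; split; first exact: ltW (gdom_neg Ux).
    have sE : ssq (r x) = wsq x.
      by rewrite (wsq_ssq (a := 1) (u := r x)) ?expr1n ?mul1r // => -[|[|[|j]]] // _;
        rewrite rE mul1r.
    have tE : e0 * Num.sqrt (1 - wsq x) = tau x.
      have sph := S0_sphere Sx.
      have -> : 1 - wsq x = (e0 * tau x) ^+ 2 by rewrite exprMn e0e0 mul1r; lra.
      by rewrite sqrtr_sqr gtr0_norm // mulrA -expr2 e0e0 mul1r.
    apply/coordP => j _; rewrite coord_gch sE tE !rE /= subrK.
    by case: j => [|[|j]] //; rewrite /tau; field.
- by move=> u gu u0; have := gdom_neg gu; rewrite u0 ltxx.
Qed.

Lemma derive_gch u V j : gdom u -> ('D_V (gch e0) u)$(j.+1) = V$j.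
Proof.
move=> gu; have dg := smooth_diff smooth_gch gu.
rewrite -derive_coord //.
have -> : (fun t => (gch e0 t)$(j.+1)) = fun t : D => t$j + (if j == 0%N then 5 else 0).
  by apply/funext => t; rewrite coord_gch; case: j => //= j; rewrite addr0.
have H : isD u V (fun t : D => t$j + (if j == 0%N then 5 else 0)) (V$j + 0).
  apply: isD_add; last exact: isD_cst.
  by apply: isD_coord; [by []|exact: derive_id].
by have [_ ->] := H; rewrite addr0.
Qed.

End Graph.

(** The signs are chosen so as to stay away from the points at infinity of the
   stereographic projection and of the Cayley transform. *)
Lemma base_cover x : S0 x ->
  (exists e0 e1 u, [/\ e0 ^+ 2 = 1, e1 ^+ 2 = 1, bdom u, u$0 <= 0
     & theta (bch e0 e1 u) = x])
  \/ (exists2 e0, e0 ^+ 2 = 1 & gch e0 upole = x).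
Proof.
move=> Sx; have [px|npx] := pselect (pole x).
  right; exists (x$0).
    by have := S0_sphere Sx; rewrite pole_wsq // pole_tau // add0r.
  have [pg g0] := gch_upole (x$0); exact: pole_eq.
left; set y := thetaV x; have x1 := S0_tau Sx.
have yx : theta y = x by rewrite thetaVK //; lra.
have sph : wsq y + y$0 ^+ 2 = 1 by rewrite /y wsq_thetaV coord_thetaV S0_sphere.
have y0 : y$0 <= 1 by rewrite coord_thetaV.
have Q1 : y$1 ^+ 2 + y$3 ^+ 2 <= 1.
  have [_] := Sx; rewrite -yx L_theta; last by lra.
  by move=> H; nra.
have sgn (a : R) : exists2 e : R, e ^+ 2 = 1 & 0 <= e * a.
  have [a0|a0] := leP 0 a; [exists 1|exists (-1)]; rewrite ?sqrrN ?expr1n ?mul1r //.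
  by rewrite mulN1r oppr_ge0 ltW.
have [e0 e0e0 ey0] := sgn (y$0); have [e1 e1e1 ey1] := sgn (y$1).
have t0 : 1 + e0 * y$0 != 0 by rewrite gt_eqF // ltr_wpDr.
have d0 : 0 < dval e1 y.
  by rewrite /dval ltr_wpDr ?sqr_ge0 // exprn_even_gt0 //= gt_eqF // ltr_wpDr.
have d0' : dval e1 y != 0 by rewrite gt_eqF.
set u := bchV e0 e1 y; have uy : bch e0 e1 u = y by rewrite bchVK.
have u0 : u$0 <= 0 by rewrite coord_bchV pmulr_lle0 ?invr_gt0 // subr_le0.
have u1 : u$0 < 1 by lra.
exists e0, e1, u; split=> //; last by rewrite uy.
split=> //; have s0 := ssq_ge0 u.
have [//|H] := ltP 0 ((1 + u$0) ^+ 2 + u$2 ^+ 2 + ssq u).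
have H1 := sqr_ge0 (1 + u$0); have H2 := sqr_ge0 (u$2).
have s00 : ssq u = 0 by lra.
have H10 : (1 + u$0) ^+ 2 + u$2 ^+ 2 = 0 by lra.
have qq : y$1 ^+ 2 + y$3 ^+ 2 = 0.
  rewrite -uy bch_q2 //; have d1 : den u != 0 by rewrite gt_eqF // den_gt0.
  apply: (mulIf d1); rewrite mul0r.
  have -> : (1 + u$0 * (4 / den u)) * den u = den u + 4 * u$0 by field.
  by move: H10; rewrite /den; lra.
have wy : wsq y = 0 by rewrite -uy wsq_bch s00 mulr0.
have sq0 (a : R) : a ^+ 2 = 0 -> a = 0 by move=> /eqP; rewrite sqrf_eq0 => /eqP.
have q1 : y$1 = 0 by apply: sq0; have := sqr_ge0 (y$1); have := sqr_ge0 (y$3); lra.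
have q3 : y$3 = 0 by apply: sq0; have := sqr_ge0 (y$1); have := sqr_ge0 (y$3); lra.
have py := pole_intro wy q1 q3.
case: npx; apply: pole_intro; first by rewrite -yx wsq_theta.
  by rewrite -yx coord_theta /= q1 (py 1%N) !mulr0 subr0.
by rewrite -yx coord_theta /= q3 (py 3%N) !mulr0 subr0.
Qed.

End Atlas.

(** * Lifting frames to the symplectic space *)

Section ScalePfaffian.
Variable R : realType.

Lemma pfaffZ k (a : R) W : pfaff k (fun i j => a * W i j) = a ^+ k * pfaff k W.
Proof.
rewrite /pfaff /altsum mulr_sumr; apply: eq_bigr => s _.
by rewrite big_split /= prodr_const card_ord mulrCA.
Qed.

Lemma bpfaffZ k (a : R) l W : bpfaff k l (fun i j => a * W i j) = a ^+ k * bpfaff k l W.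
Proof.
rewrite /bpfaff /altsum mulr_sumr; apply: eq_bigr => s _.
rewrite big_split /= prodr_const card_ord (mulrCA (l _)). exact: mulrCA.
Qed.

(** Compare the Pfaffians of the Gram matrices of a basis and of its image. *)
Lemma det_conformal m (A : 'M[R]_(m.*2)) mu :
    (forall a b, symp (a *m A) (b *m A) = mu * symp a b) -> \det A = mu ^+ m.
Proof.
move=> sA; pose e i := basis R m.*2 i.
have eA : \matrix_(i < m.*2) (e i *m A) = A.
  apply/row_matrixP => i; rewrite rowK rowE; congr (_ *m _).
  by apply/rowP => j; rewrite !mxE eqxx.
have e1 : \matrix_(i < m.*2) e i = 1%:M.
  by apply/matrixP => i j; rewrite !mxE eq_sym.
have pA := pfaff_symp (fun i => e i *m A); have p1 := pfaff_symp e.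
rewrite eA in pA; rewrite e1 det1 mul1r in p1.
apply: (mulIf (lt0r_neq0 (pfaff_std_gt0 R m))).
rewrite -pA -p1 -pfaffZ; congr pfaff.
by apply/funext => i; apply/funext => j; exact: sA.
Qed.

Lemma isD_symp m (V : normedModType R) (x v : V) (a b : V -> 'rV[R]_(m.*2)) :
  differentiable a x -> differentiable b x ->
  isD x v (fun y => symp (a y) (b y)) (symp ('D_v a x) (b x) + symp (a x) ('D_v b x)).
Proof.
move=> da db; have ca j : isD x v (fun y => coord (a y) j) (coord ('D_v a x) j).
  exact: isD_coord.
have cb j : isD x v (fun y => coord (b y) j) (coord ('D_v b x) j) by exact: isD_coord.
apply: isD_eq.
  apply: isD_sum => i; apply: isD_add; last apply: isD_opp;
    by apply: isD_mul; [exact: ca|exact: cb].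
by rewrite /symp -big_split; apply: eq_bigr => i _ /=; ring.
Qed.

End ScalePfaffian.

Section Lift.
Variables (R : realType) (k : nat).
Let n := k.+2.
Let E := 'rV[R]_(n.*2.+1).
Let D := 'rV[R]_(n.*2).
Let L := 'rV[R]_(n.+1.*2).
Implicit Types (x y : E) (u v : D).

Lemma lift1D a b x y : lift1 (a + b) (x + y) = lift1 a x + lift1 b y :> L.
Proof. by apply/coordP => -[|j] _; rewrite coordD !coord_lift1 ?coordD. Qed.

Lemma lift1Z c a x : lift1 (c * a) (c *: x) = c *: lift1 a x :> L.
Proof. by apply/coordP => -[|j] _; rewrite coordZ !coord_lift1 ?coordZ. Qed.

Definition lift0 x : L := lift1 0 x.

Lemma lift0_is_linear : linear lift0.
Proof. by move=> c x y; rewrite /lift0 -lift1Z -lift1D mulr0 addr0. Qed.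

HB.instance Definition _ := GRing.isLinear.Build R E L _ lift0 lift0_is_linear.

Lemma lift1E x : lift1 1 x = lift1 1 0 + lift0 x.
Proof. by rewrite /lift0 -lift1D addr0 add0r. Qed.

(** Its sign tells whether the chart is positively oriented, the hypersurface being
    cooriented by [Nf]. *)
Definition dframe (c0 : D -> E) (u : D) : R :=
  \det (\matrix_(i < n.*2.+1) vcons (Nf (c0 u)) (fun j => 'D_(basis R n.*2 j) c0 u) i).

Lemma block_lift x (w : nat -> E) :
  (block_mx 1%:M x 0 (\matrix_(i < n.*2.+1) w i) : 'M[R]_(1 + n.*2.+1))
  = col_mx (lift1 1 x) (\matrix_(i < n.*2.+1) lift0 (w i)).
Proof.
congr col_mx; apply/row_matrixP => i; rewrite [RHS]rowK.
by rewrite row_row_mx rowK row0 /lift0 /lift1 raddf0.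
Qed.

(** The frame is obtained from (1, x), (0, N), (0, w_j) by a block triangular matrix,
    followed by A. *)
Lemma det_lift_frame (A : 'M[R]_(n.+1.*2)) (r : R) (x N : E) (d : nat -> R) (w : nat -> E) :
  \det (framemx (r *: (lift1 1 x *m A)) (lift0 N *m A)
          (fun j => r *: (lift0 (w j) *m A) + d j *: (lift1 1 x *m A)))
  = r * r ^+ n.*2 * \det (\matrix_(i < n.*2.+1) vcons N w i) * \det A.
Proof.
pose dcol : 'cV[R]_(n.*2.+1) := \col_i (if (i : nat) is j.+1 then d j else 0).
pose Dg : 'rV[R]_(n.*2.+1) := \row_i (if (i : nat) is _.+1 then r else 1).
pose B := \matrix_(i < n.*2.+1) lift0 (vcons N w i).
pose Q : 'M[R]_(1 + n.*2.+1) := block_mx r%:M 0 dcol (diag_mx Dg).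
have -> : framemx (r *: (lift1 1 x *m A)) (lift0 N *m A)
          (fun j => r *: (lift0 (w j) *m A) + d j *: (lift1 1 x *m A))
   = Q *m col_mx (lift1 1 x) B *m A.
  rewrite mul_block_col mul_col_mx.
  apply/row_matrixP => i; rewrite [LHS]rowK.
  case: (@split_ordP 1 n.*2.+1 i) => j ->.
    rewrite mul_scalar_mx mul0mx addr0 -scalemxAl (ord1 j).
    by rewrite (@rowKu _ 1 n.*2.+1) row_id.
  rewrite (@rowKd _ 1 n.*2.+1).
  rewrite mulmxDl linearD /= !row_mul row_diag_mx -scalemxAl -rowE rowK.
  have -> : row j dcol = (if (j : nat) is j'.+1 then d j' else 0)%:M.
    by apply/matrixP => a b; rewrite !mxE !ord1 eqxx mulr1n.
  rewrite mul_scalar_mx -!scalemxAl mxE addrC.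
  by case: j => -[|j] ltj //=; rewrite scale1r scale0r addr0.
rewrite !det_mulmx -block_lift (@det_ublock _ 1) (@det_lblock _ 1) det1 mul1r.
congr (_ * _ * _); rewrite det_scalar1; congr (_ * _).
rewrite det_diag big_ord_recl mxE /= mul1r (eq_bigr (fun=> r)) => [|j _].
  by rewrite prodr_const card_ord.
by rewrite mxE.
Qed.

End Lift.

(** * The characteristic field of the embedded hypersurface *)

Lemma derive_row_sym (R : realType) (V : normedModType R) m (U : set V)
    (f : V -> 'rV[R]_m) u v w : open U -> smooth U f -> U u ->
  'D_v ('D_w f) u = 'D_w ('D_v f) u.
Proof.
move=> oU sf Uu.
have step v' w' j : coord ('D_v' ('D_w' f) u) j = 'D_v' ('D_w' (fun t => coord (f t) j)) u.
  rewrite -derive_coord; last exact: smooth_diff (smooth_derive _ sf) Uu.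
  apply: near_eq_derive; apply: filterS (open_nbhs_nbhs (conj oU Uu)) => t Ut.
  by rewrite derive_coord //; exact: smooth_diff sf Ut.
apply: (coordP _ _).1 => j _.
transitivity ('D_v ('D_w (fun t => coord (f t) j)) u); first exact: step v w j.
transitivity ('D_w ('D_v (fun t => coord (f t) j)) u); last exact/esym/(step w v j).
exact: (derive_sym v w oU Uu (smooth_coordn j oU sf)).
Qed.

Lemma symp_alt (R : realType) m (a b c d e : 'rV[R]_(m.*2)) (r s : R) :
  r = symp a b + symp c d -> s = symp b a + symp c e -> d = e ->
  r - s = 2 * symp a b.
Proof. by move=> -> -> ->; rewrite (sympC b a); ring. Qed.

(** An embedding of R^(2n+1) in a contact manifold M of R^N, conformal for the
    contact structures.  It is described through the cone over M: the affine
    map [st_h0 + st_H] puts M in the symplectic space R^(2n+2), transversely to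
    the radial direction, and up to the positive factor [st_rho] the embedding
    is the linear map [st_A], applied to the affine hyperplane 1 x R^(2n+1). *)
Record setting (R : realType) (k N : nat) := Setting {
  st_alpha : 'rV[R]_N -> 'rV[R]_N -> R;
  st_M : set 'rV[R]_N;
  st_Phi : 'rV[R]_(k.+2.*2.+1) -> 'rV[R]_N;
  st_PhiV : 'rV[R]_N -> 'rV[R]_(k.+2.*2.+1);
  st_O : set 'rV[R]_N;
  st_h0 : 'rV[R]_(k.+3.*2);
  st_H : {linear 'rV[R]_N -> 'rV[R]_(k.+3.*2)};
  st_rho : 'rV[R]_(k.+2.*2.+1) -> R;
  st_A : 'M[R]_(k.+3.*2);
  st_mu : R;
  st_alphaE : forall p v, st_alpha p v = symp (st_h0 + st_H p) (st_H v);
  st_lift : forall x, st_h0 + st_H (st_Phi x) = st_rho x *: (lift1 1 x *m st_A);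
  st_rho_gt0 : forall x, 0 < st_rho x;
  st_mu_gt0 : 0 < st_mu;
  st_conf : forall a b, symp (a *m st_A) (b *m st_A) = st_mu * symp a b;
  st_rho_smooth : forall (U : set 'rV[R]_(k.+2.*2)) c, open U -> smooth U c ->
    smooth U (fun u => st_rho (c u));
  st_Phi_smooth : forall (U : set 'rV[R]_(k.+2.*2)) c, open U -> smooth U c ->
    smooth U (fun u => st_Phi (c u));
  st_Phi_diff : forall x, differentiable st_Phi x;
  st_O_open : open st_O;
  st_PhiV_diff : forall p, st_O p -> differentiable st_PhiV p;
  st_PhiO : forall x, st_O (st_Phi x);
  st_PhiK : forall x, st_PhiV (st_Phi x) = x;
  st_MPhi : forall x, S0 x -> st_M (st_Phi x);
  st_tangent : forall x v, S0 x -> tangent st_M (st_Phi x) ('D_v st_Phi x) }.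

Section Master.
Variables (R : realType) (k N : nat) (s : setting R k N).
Let n := k.+2.
Let E := 'rV[R]_(n.*2.+1).
Let D := 'rV[R]_(n.*2).
Let L := 'rV[R]_(n.+1.*2).
Local Notation "x $ i" := (coord x i) (at level 5, format "x $ i").
Local Notation alpha := (st_alpha s).
Local Notation Phi := (st_Phi s).
Local Notation rho := (st_rho s).
Local Notation A := (st_A s).
Local Notation mu := (st_mu s).
Local Notation H := (st_H s).
Local Notation h0 := (st_h0 s).
Implicit Types (x y : E) (u v w : D).

Definition hypersurface : set 'rV[R]_N := Phi @` @S0 R k.

(** Restricting the domain to positively oriented points gives an oriented chart. *)
Definition chart_of (U0 : set D) (c0 : D -> E) : chart R N n :=
  ([set u | U0 u /\ 0 < dframe c0 u], fun u => Phi (c0 u)).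

Lemma detA : \det A = mu ^+ n.+1.
Proof. exact: det_conformal (@st_conf _ _ _ s). Qed.

Lemma om_anti x y : om x y = - om y x.
Proof.
rewrite /om -sumrN; apply: eq_bigr => i _; ring.
Qed.

(** The lift to R^(2n+2) of the dual of dF. *)
Definition Xhat x : L := lift0 (Xf x) + tau x *: lift1 1 x.

Lemma symp_Xhat x Y : symp (Xhat x) (lift0 Y) = dF x Y / 2.
Proof.
rewrite /Xhat sympDl sympZl /lift0 !symp_lift1 dF_om darbouxE.
by field.
Qed.

Lemma symp_Xhat1 x : symp (Xhat x) (lift1 1 x) = 0.
Proof.
rewrite /Xhat sympDl sympZl symp_self mulr0 addr0 /lift0 symp_lift1.
by rewrite Xf_0 om_anti; ring.
Qed.

Section Chart.
Variables (U0 : set D) (c0 : D -> E).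
Hypothesis bc : base_chart U0 c0.
Let oU : open U0 := bc_open bc.

(** The chart, followed by the map to the symplectic space in which the contact form is
    symp(P, dP). *)
Definition chat u : L := rho (c0 u) *: (lift1 1 (c0 u) *m A).

Lemma chatE u : chat u = h0 + H (Phi (c0 u)).
Proof. by rewrite st_lift. Qed.

Lemma smooth_PhiC : smooth U0 (fun u => Phi (c0 u)).
Proof. exact: st_Phi_smooth (bc_open bc) (bc_smooth bc). Qed.

Lemma smooth_chat : smooth U0 chat.
Proof.
apply: (smooth_ext oU (f := fun u => h0 + H (Phi (c0 u)))) => [u _|].
  by rewrite chatE.
have sH := smooth_linear_comp H oU smooth_PhiC.
apply/smooth_rowP => // j.
apply: (smooth_ext oU (f := fun u => h0$j + (H (Phi (c0 u)))$j)) => [u _|].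
  by rewrite coordD.
by apply: smoothD => //; [exact: smooth_cst|exact: smooth_coordn].
Qed.

Lemma derive_chat u v : U0 u -> 'D_v chat u = H ('D_v (fun t => Phi (c0 t)) u).
Proof.
move=> Uu; have dP := smooth_diff smooth_PhiC Uu.
rewrite -derive_linear_comp //.
have -> : chat = (fun=> h0) + (fun t => H (Phi (c0 t))).
  by apply/funext => t; rewrite chatE.
rewrite deriveD ?derive_cst ?add0r //; apply: diff_derivable.
by apply: (@differentiable_comp _ _ _ _ _ H) => //; exact: differentiable_linear.
Qed.

Lemma derive_chat_lift u v : U0 u -> 'D_v chat u
  = rho (c0 u) *: (lift0 ('D_v c0 u) *m A)
    + 'D_v (fun t => rho (c0 t)) u *: (lift1 1 (c0 u) *m A).
Proof.
move=> Uu; have dc := smooth_diff (bc_smooth bc) Uu.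
have dr := smooth_diff (st_rho_smooth s (bc_open bc) (bc_smooth bc)) Uu.
have dch := smooth_diff smooth_chat Uu.
apply/coordP => j _; rewrite -derive_coord // coordD !coordZ.
pose T := mulmxr A \o @lift0 R k.
pose b : L := lift1 1 0 *m A.
have liftE t : (lift1 1 (c0 t) *m A)$j = b$j + (T (c0 t))$j.
  by rewrite lift1E mulmxDl coordD.
have -> : (fun t => (chat t)$j) = fun t => rho (c0 t) * (b$j + (T (c0 t))$j).
  by apply/funext => t; rewrite coordZ liftE.
have HH : isD u v (fun t => rho (c0 t) * (b$j + (T (c0 t))$j))
   ('D_v (fun t => rho (c0 t)) u * (b$j + (T (c0 u))$j)
    + rho (c0 u) * (0 + (T ('D_v c0 u))$j)).
  apply: isD_mul; first by split.
  apply: isD_add; first exact: isD_cst.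
  apply: isD_coord; last exact: derive_linear_comp.
  by apply: (@differentiable_comp _ _ _ _ _ T) => //; exact: differentiable_linear.
by have [_ ->] := HH; rewrite add0r addrC -liftE.
Qed.

Lemma chart_tangent u v : U0 u -> dF (c0 u) ('D_v c0 u) = 0.
Proof.
move=> Uu; have [_ <-] := isD_F v (smooth_diff (bc_smooth bc) Uu).
rewrite -(derive_cst (0 : R) u v); apply: near_eq_derive.
by apply: filterS (open_nbhs_nbhs (conj oU Uu)) => t /(bc_F bc).
Qed.

Lemma pullbackE u v : U0 u -> pullback alpha (chart_of U0 c0) u v
  = symp (chat u) ('D_v chat u).
Proof. by move=> Uu; rewrite /pullback /= st_alphaE -chatE -derive_chat. Qed.

Lemma derive_chat_sym u v w : U0 u -> 'D_v ('D_w chat) u = 'D_w ('D_v chat) u.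
Proof.
by move=> Uu; exact: derive_row_sym oU smooth_chat Uu.
Qed.

Lemma extdE u v w : U0 u -> extd (pullback alpha (chart_of U0 c0)) u v w
  = 2 * symp ('D_v chat u) ('D_w chat u).
Proof.
move=> Uu; have sc := smooth_chat; have dch := smooth_diff sc Uu.
have step v' w' : 'D_v' (fun t => pullback alpha (chart_of U0 c0) t w') u
    = symp ('D_v' chat u) ('D_w' chat u) + symp (chat u) ('D_v' ('D_w' chat) u).
  have dD := smooth_diff (smooth_derive w' sc) Uu.
  have [_ <-] := isD_symp v' dch dD.
  apply: near_eq_derive; apply: filterS (open_nbhs_nbhs (conj oU Uu)) => t Ut.
  by rewrite pullbackE.
exact: (symp_alt (step v w) (step w v) (derive_chat_sym v w Uu)).
Qed.

Lemma char_formE u e : U0 u -> char_form alpha (chart_of U0 c0) u e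
  = bpfaff n.-1 (fun j => symp (chat u) ('D_(e j) chat u))
      (fun i j => symp ('D_(e i) chat u) ('D_(e j) chat u)).
Proof.
move=> Uu; rewrite /char_form wedge1E.
have -> : (fun j => pullback alpha (chart_of U0 c0) u (e j))
    = (fun j => symp (chat u) ('D_(e j) chat u)).
  by apply/funext => j; rewrite pullbackE.
have -> : (fun i j => extd (pullback alpha (chart_of U0 c0)) u (e i) (e j))
    = (fun i j => 2 * symp ('D_(e i) chat u) ('D_(e j) chat u)).
  by apply/funext => i; apply/funext => j; rewrite extdE.
by rewrite bpfaffZ mulrA -exprMn mulVf // expr1n mul1r.
Qed.

Let v u j := 'D_(basis R n.*2 j) chat u.

Lemma frame_det u : U0 u ->
  \det (framemx (chat u) (lift0 (Nf (c0 u)) *m A) (v u))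
  = rho (c0 u) * rho (c0 u) ^+ n.*2 * dframe c0 u * mu ^+ n.+1.
Proof.
move=> Uu; rewrite -detA /dframe -(det_lift_frame A (rho (c0 u)) (c0 u) _
  (fun j => 'D_(basis R n.*2 j) (fun t => rho (c0 t)) u)).
congr (\det (framemx _ _ _)); apply/funext => j.
by rewrite /v derive_chat_lift.
Qed.

Definition kappa0 : R :=
  mu ^+ n.+1 * pfaff_std R n.+1 / (n.+1.*2%:R * n.*2%:R * mu).

Lemma kappa0_gt0 : 0 < kappa0.
Proof.
have n0 m : 0 < (m.+1.*2%:R : R) by rewrite ltr0n.
have p0 := pfaff_std_gt0 R n.+1; have m0 := st_mu_gt0 s.
apply: divr_gt0; first by apply: mulr_gt0 => //; exact: exprn_gt0.
by apply: mulr_gt0 => //; apply: mulr_gt0; exact: n0.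
Qed.

Definition kappa u : R := kappa0 * rho (c0 u) ^+ n.*2 * dframe c0 u.

Lemma symp_XN u : U0 u ->
  symp (Xhat (c0 u) *m A) (lift0 (Nf (c0 u)) *m A) = - mu.
Proof.
move=> Uu; rewrite st_conf symp_Xhat dF_Nf.
have := bc_F bc Uu; rewrite /Ffun => F0.
have -> : wsq (c0 u) + tau (c0 u) ^+ 2 = 1 by lra.
by field.
Qed.

Lemma symp_Xp u : symp (Xhat (c0 u) *m A) (chat u) = 0.
Proof. by rewrite /chat sympZr st_conf symp_Xhat1 !mulr0. Qed.

Lemma symp_Xv u w : U0 u -> symp (Xhat (c0 u) *m A) ('D_w chat u) = 0.
Proof.
move=> Uu; rewrite derive_chat_lift // sympDr !sympZr !st_conf symp_Xhat1.
by rewrite symp_Xhat chart_tangent // mul0r !mulr0 addr0.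
Qed.

(** Evaluate the defining wedge product in the frame formed by P, N and the
    derivatives of the chart, where [char_coef] gives its coordinates. *)
Theorem derive_char_field u : U0 u -> 0 < dframe c0 u ->
  'D_(char_field alpha (chart_of U0 c0) u) c0 u = kappa u *: Xf (c0 u).
Proof.
move=> Uu df0; set x := c0 u.
have r0 := st_rho_gt0 s x; have m0 := st_mu_gt0 s.
have detF : \det (framemx (chat u) (lift0 (Nf x) *m A) (v u)) != 0.
  apply: lt0r_neq0; rewrite (frame_det Uu); apply: mulr_gt0; last exact: exprn_gt0.
  by apply: mulr_gt0 => //; apply: mulr_gt0 => //; exact: exprn_gt0.
have XN0 : symp (Xhat x *m A) (lift0 (Nf x) *m A) != 0.
  by rewrite symp_XN // oppr_eq0 gt_eqF.
have Xv j : symp (Xhat x *m A) (v u j) = 0 by exact: symp_Xv.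
have [V [a XE]] := @det_frame0 R n (chat u) _ (v u) _ XN0 (symp_Xp u) Xv detF.
(* Both fields are proportional to the coordinates of Xhat in the frame. *)
have charE : char_field alpha (chart_of U0 c0) u
    = (rho x * kappa u) *: V.
  apply/rowP => i; rewrite !mxE char_formE //.
  rewrite (@char_coef R n isT _ _ _ _ _ _ i XN0 (symp_Xp u) Xv XE).
  rewrite frame_det // symp_XN // /kappa /kappa0 -/x.
  have n0 : (n.*2%:R : R) != 0 by rewrite pnatr_eq0.
  have n10 : (n.+1.*2%:R : R) != 0 by rewrite pnatr_eq0.
  by field; rewrite n0 n10 gt_eqF.
have dc := smooth_diff (bc_smooth bc) Uu.
have dch := smooth_diff smooth_chat Uu.
have VE : Xhat x *m A = a *: chat u + 'D_V chat u.
  by rewrite XE (derive_sum_basis V dch).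
have Aunit : A \in unitmx by rewrite unitmxE unitfE detA gt_eqF // ?exprn_gt0.
have {}VE : Xhat x = (a * rho x + 'D_V (fun t => rho (c0 t)) u) *: lift1 1 x
    + rho x *: lift0 ('D_V c0 u).
  apply: (can_inj (mulmxK Aunit)); rewrite VE derive_chat_lift // /chat -/x.
  by rewrite mulmxDl -!scalemxAl scalerDl scalerA -addrA (addrC (rho x *: _)) addrA.
(* Comparing the first coordinates removes the radial terms. *)
have b0 : tau x = a * rho x + 'D_V (fun t => rho (c0 t)) u.
  have /(congr1 (fun z => z$0)) := VE.
  rewrite /Xhat !coordD !coordZ /lift0 !coord_lift1; lra.
have XfE : Xf x = rho x *: 'D_V c0 u.
  apply/coordP => j _; have /(congr1 (fun z => z$(j.+1))) := VE.
  rewrite -b0 /Xhat !coordD !coordZ /lift0 !coord_lift1; lra.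
by rewrite charE deriveZv // XfE scalerA mulrC.
Qed.

End Chart.
End Master.

(** * The oriented atlas *)

Lemma derive_dir0 (R : realType) (V W : normedModType R) (f : V -> W) x :
  differentiable f x -> 'D_0 f x = 0.
Proof. by move=> df; rewrite -(scale0r (0 : V)) deriveZv // scale0r. Qed.

Lemma derive_dir_sum (R : realType) (V W : normedModType R) (f : V -> W) x m
    (a : 'I_m -> R) (v : 'I_m -> V) : differentiable f x ->
  'D_(\sum_(i < m) a i *: v i) f x = \sum_(i < m) a i *: 'D_(v i) f x.
Proof.
move=> df; elim: m a v => [|m IHm] a v; first by rewrite !big_ord0 derive_dir0.
by rewrite !big_ord_recl deriveDv // deriveZv // IHm.
Qed.

Lemma left_inverse_immersion (R : realType) (V W : normedModType R) (f : V -> W)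
    (g : W -> V) (U : set V) u v :
  open U -> U u -> (forall t, U t -> g (f t) = t) -> differentiable f u ->
  differentiable g (f u) -> 'D_v f u = 0 -> v = 0.
Proof.
move=> oU Uu gf df dg fv0; rewrite -(derive_id u v).
have -> : 'D_v id u = 'D_v (fun t => g (f t)) u.
  by apply: near_eq_derive; apply: filterS (open_nbhs_nbhs (conj oU Uu)) => t /gf.
by rewrite derive_comp // fv0 derive_dir0.
Qed.

Lemma open_preimage_in (R : realType) (V W : normedModType R) (f : V -> W) (P : set V)
    (U : set W) : open P -> (forall x, P x -> differentiable f x) -> open U ->
  open (P `&` f @^-1` U).
Proof.
move=> oP df oU; rewrite openE => x [Px Ux]; apply: filterI.
  exact: open_nbhs_nbhs.
exact: (differentiable_continuous (df x Px)) (open_nbhs_nbhs (conj oU Ux)).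
Qed.

Lemma row_mx_ord0 (R : realType) m (a : 'M[R]_1) (b : 'rV[R]_m) :
  (row_mx a b : 'rV_(1 + m)) 0 ord0 = a 0 0.
Proof.
have -> : ord0 = lshift m ord0 :> 'I_(1 + m) by exact/val_inj.
by rewrite (@row_mxEl _ 1 1).
Qed.

Lemma row_mx_lift (R : realType) m (a : 'M[R]_1) (b : 'rV[R]_m) j :
  (row_mx a b : 'rV_(1 + m)) 0 (lift ord0 j) = b 0 j.
Proof.
have -> : lift ord0 j = rshift 1 j :> 'I_(1 + m) by exact/val_inj.
by rewrite (@row_mxEr _ 1 1).
Qed.

Section Orientation.
Variables (R : realType) (k : nat).
Let n := k.+2.
Let E := 'rV[R]_(n.*2.+1).
Let D := 'rV[R]_(n.*2).
Local Notation "x $ i" := (coord x i) (at level 5, format "x $ i").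
Implicit Types (x Y : E) (u v : D).

(** Charts of both kinds, with all signs; e orients. *)
Inductive std_chart : set D -> (D -> E) -> Prop :=
| StdSide e0 e1 e of e0 ^+ 2 = 1 & e1 ^+ 2 = 1 & e ^+ 2 = 1 :
    std_chart (refl k e @^-1` @bdom R k) (fun u => theta (bch e0 e1 (refl k e u)))
| StdPole e0 e of e0 ^+ 2 = 1 & e ^+ 2 = 1 :
    std_chart (refl k e @^-1` @gdom R k) (fun u => gch e0 (refl k e u)).

Lemma std_base U0 c0 : std_chart U0 c0 -> base_chart U0 c0.
Proof.
case=> [e0 e1 e e0e0 e1e1 ee|e0 e e0e0 ee].
  by apply: (base_chart_refl ee (c0 := fun u => theta (bch e0 e1 u))); exact: base_chart_bch.
by apply: (base_chart_refl ee (c0 := gch e0)); exact: base_chart_gch.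
Qed.

Lemma dFE x Y : dF x Y = 2 * symp (Xhat x) (lift0 Y).
Proof. by rewrite symp_Xhat; field. Qed.

Lemma dFD x Y Y' : dF x (Y + Y') = dF x Y + dF x Y'.
Proof. by rewrite !dFE raddfD sympDr mulrDr. Qed.

Lemma dFZ x a Y : dF x (a *: Y) = a * dF x Y.
Proof. by rewrite !dFE linearZ sympZr mulrCA. Qed.

Lemma smooth_Nf (U : set D) (c0 : D -> E) : open U -> smooth U c0 ->
  smooth U (fun u => Nf (c0 u)).
Proof.
move=> oU sc; have sj j : smooth U (fun u => (c0 u)$j) by exact: smooth_coordn.
apply: smooth_rowf => // -[|j].
  apply: smoothB => //; last exact: smooth_tau.
  by apply: smoothD => //; exact: smoothM.
case: (odd j); first exact: smoothN.
by apply: smoothN => //; apply: smoothM => //; exact: smooth_cst.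
Qed.

Lemma smooth_dframe (U : set D) (c0 : D -> E) : open U -> smooth U c0 -> smooth U (dframe c0).
Proof.
move=> oU sc; apply: smooth_det => // i j.
apply: (smooth_ext oU (f := fun u =>
    (vcons (Nf (c0 u)) (fun j => 'D_(basis R n.*2 j) c0 u) i)$j)) => [u _|].
  by rewrite mxE coord_ord.
apply: smooth_coordn => //; case: i => -[|i] ? /=; first exact: smooth_Nf.
exact: smooth_derive.
Qed.

Section Frame.
Variables (U0 : set D) (c0 : D -> E) (u : D).
Hypotheses (bc : base_chart U0 c0) (Uu : U0 u).
Let oU := bc_open bc.
Let dc : differentiable c0 u := smooth_diff (bc_smooth bc) Uu.

Lemma dF_frame_N : dF (c0 u) (Nf (c0 u)) = -2.
Proof.
rewrite dF_Nf; have := bc_F bc Uu; rewrite /Ffun => F0.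
have -> : wsq (c0 u) + tau (c0 u) ^+ 2 = 1 by lra.
by rewrite mulr1.
Qed.

Lemma base_immersion v : 'D_v c0 u = 0 -> v = 0.
Proof.
have [Or [r [oO sr rc _]]] := bc_inv bc.
apply: (left_inverse_immersion (g := r) oU) => // [t /rc[]//|].
by apply: smooth_diff sr _; have [] := rc _ Uu.
Qed.

Lemma frame_comb (w : 'rV[R]_(n.*2.+1)) :
  w *m (\matrix_(i < n.*2.+1) vcons (Nf (c0 u)) (fun j => 'D_(basis R n.*2 j) c0 u) i)
  = w 0 0 *: Nf (c0 u) + 'D_(\row_(j < n.*2) w 0 (lift ord0 j)) c0 u.
Proof.
rewrite row_mul_sum big_ord_recl derive_sum_basis //; congr (_ + _).
by apply: eq_bigr => j _; rewrite mxE.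
Qed.

Lemma frame_comb_tangent a V Y :
  Y = a *: Nf (c0 u) + 'D_V c0 u -> dF (c0 u) Y = 0 -> a = 0.
Proof.
move=> ->; rewrite dFD dFZ dF_frame_N (chart_tangent bc _ Uu) addr0.
by move/eqP; rewrite mulf_eq0 oppr_eq0 pnatr_eq0 orbF => /eqP.
Qed.

Lemma dframe_neq0 : dframe c0 u != 0.
Proof.
apply/negP => /det0P [w w0]; rewrite frame_comb => /esym H.
have a0 : w 0 0 = 0.
  by apply: (frame_comb_tangent H); rewrite -(scale0r (0 : E)) dFZ mul0r.
move: H; rewrite a0 scale0r add0r => /esym/base_immersion V0.
case/eqP: w0; apply/rowP => i; rewrite mxE.
case: (unliftP ord0 i) => [j ->|->]; last exact: a0.
by move/rowP/(_ j): V0; rewrite !mxE.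
Qed.

(** In the frame (N, D_j c0), a vector on which dF vanishes has no component along N. *)
Lemma tangent_chart Y : dF (c0 u) Y = 0 -> exists V, Y = 'D_V c0 u.
Proof.
move=> dY; set M := \matrix_(i < n.*2.+1) vcons (Nf (c0 u)) (fun j => 'D_(basis R n.*2 j) c0 u) i.
have Mu : M \in unitmx by rewrite unitmxE unitfE; exact: dframe_neq0.
have := mulmxKV Mu Y; rewrite frame_comb => /esym H.
have a0 := frame_comb_tangent H dY.
by eexists; rewrite {1}H a0 scale0r add0r.
Qed.

End Frame.

(** Each D_j c0 is tangent, hence a combination of the D_i c0'.  Adding N to both
    families shows that det B is the quotient of two positive determinants. *)
Lemma base_transition U0 c0 U0' c0' u u' :
    @base_chart R k U0 c0 -> @base_chart R k U0' c0' -> U0 u -> U0' u' ->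
    c0 u = c0' u' -> 0 < dframe c0 u -> 0 < dframe c0' u' ->
  exists2 B : 'M[R]_(n.*2), 0 < \det B & forall j : 'I_n.*2,
    'D_(basis R n.*2 j) c0 u = \sum_(i < n.*2) B j i *: 'D_(basis R n.*2 i) c0' u'.
Proof.
move=> bc bc' Uu Uu' cc d0 d0'.
have dc' := smooth_diff (bc_smooth bc') Uu'.
have /choice[V VE] (j : 'I_n.*2) : exists V, 'D_(basis R n.*2 j) c0 u = 'D_V c0' u'.
  by apply: (tangent_chart bc' Uu'); rewrite -cc; exact: (chart_tangent bc _ Uu).
pose B := \matrix_j V j.
have BE (j : 'I_n.*2) : 'D_(basis R n.*2 j) c0 u
    = \sum_(i < n.*2) B j i *: 'D_(basis R n.*2 i) c0' u'.
  by rewrite VE derive_sum_basis //; apply: eq_bigr => i _; rewrite !mxE.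
exists B => //.
suff dE : dframe c0 u = \det B * dframe c0' u' by rewrite dE pmulr_lgt0 in d0.
rewrite /dframe -[X in _ = X * _]mul1r -[X in _ = X * _ * _](det1 R 1).
rewrite -(@det_lblock _ 1 n.*2 1%:M 0 B) -det_mulmx; congr (\det _).
apply/row_matrixP => i; rewrite row_mul [LHS]rowK row_mul_sum big_ord_recl.
case: (@split_ordP 1 n.*2 i) => j ->.
  rewrite (ord1 j) (@rowKu _ 1 n.*2) row_row_mx row1 row_mx_ord0 mxE eqxx scale1r.
  rewrite big1 ?addr0 => [|a _]; first by rewrite cc.
  by rewrite row_mx_lift !mxE scale0r.
rewrite (@rowKd _ 1 n.*2) row_row_mx row0 row_mx_ord0 mxE scale0r add0r.
rewrite [LHS]BE; apply: eq_bigr => a _.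
by rewrite row_mx_lift [in RHS]mxE.
Qed.

Lemma refl_basis e j : refl k e (basis R n.*2 j) = refl_coef e j *: basis R n.*2 j.
Proof.
apply/coordP => i _; rewrite coord_refl coordZ !coord_basis.
by case: eqP => [->//|]; rewrite !mul0rn !mulr0.
Qed.

Lemma dframe_refl e (c0 : D -> E) u : differentiable c0 (refl k e u) ->
  dframe (fun t => c0 (refl k e t)) u = e * dframe c0 (refl k e u).
Proof.
move=> dc; pose Dg : 'rV[R]_(n.*2.+1) := \row_i (if (i : nat) is j.+1 then refl_coef e j else 1).
rewrite /dframe; set M := (X in _ = e * \det X).
transitivity (\det (diag_mx Dg) * \det M); last first.
  congr (_ * _); rewrite det_diag /Dg 3!big_ord_recl big1 => [|i _]; last by rewrite mxE.
  by rewrite !mxE /= mulr1 !mul1r.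
rewrite -det_mulmx; congr (\det _); apply/row_matrixP => i.
rewrite row_mul row_diag_mx -scalemxAl -rowE [LHS]rowK rowK mxE.
case: i => -[|j] ltj; first by rewrite [LHS]/= scale1r.
rewrite -[LHS]/('D_(basis R n.*2 j) (fun t => c0 (refl k e t)) u).
rewrite -[RHS]/(refl_coef e j *: 'D_(basis R n.*2 j) c0 (refl k e u)).
rewrite derive_comp //; last exact: differentiable_linear.
by rewrite derive_linear refl_basis deriveZv.
Qed.

Lemma orient_flip U0 (c0 : D -> E) u : base_chart U0 c0 -> U0 u ->
  exists2 e : R, e ^+ 2 = 1 &
    [/\ U0 (refl k e (refl k e u)), (refl k e u)$0 = u$0,
        0 < dframe (fun t => c0 (refl k e t)) (refl k e u)
      & c0 (refl k e (refl k e u)) = c0 u].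
Proof.
move=> bc Uu; have d0 := dframe_neq0 bc Uu; pose e : R := Num.sg (dframe c0 u).
have ee : e ^+ 2 = 1 by rewrite sqr_sg d0.
exists e => //; rewrite dframe_refl reflK //; last exact: smooth_diff (bc_smooth bc) Uu.
split=> //; first by rewrite coord_refl mul1r.
by rewrite -normrEsg normr_gt0.
Qed.

Lemma std_side e0 e1 u : e0 ^+ 2 = 1 -> e1 ^+ 2 = 1 -> bdom u ->
  exists U0 c0 u', [/\ std_chart U0 c0, U0 u', u'$0 = u$0, 0 < dframe c0 u'
    & c0 u' = theta (bch e0 e1 u)].
Proof.
move=> e0e0 e1e1 Uu; have bc := base_chart_bch k e0e0 e1e1.
have [e ee [H1 H2 H3 H4]] := orient_flip bc Uu.
exists (refl k e @^-1` @bdom R k), (fun u => theta (bch e0 e1 (refl k e u))), (refl k e u).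
by split; [exact: StdSide|exact: H1|exact: H2|exact: H3|exact: H4].
Qed.

Lemma std_pole e0 u : e0 ^+ 2 = 1 -> gdom u ->
  exists U0 c0 u', [/\ std_chart U0 c0, U0 u', u'$0 = u$0, 0 < dframe c0 u'
    & c0 u' = gch e0 u].
Proof.
move=> e0e0 Uu; have bc := base_chart_gch k e0e0.
have [e ee [H1 H2 H3 H4]] := orient_flip bc Uu.
exists (refl k e @^-1` @gdom R k), (fun u => gch e0 (refl k e u)), (refl k e u).
by split; [exact: StdPole|exact: H1|exact: H2|exact: H3|exact: H4].
Qed.

Lemma std_cover x : S0 x -> exists U0 c0 u,
  [/\ std_chart U0 c0, U0 u, u$0 <= 0, 0 < dframe c0 u & c0 u = x].
Proof.
move=> Sx.
have [[e0 [e1 [u [e0e0 e1e1 Uu u0 ux]]]]|[e0 e0e0 ux]] := base_cover Sx.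
  have [U0 [c0 [v [H1 H2 H3 H4 H5]]]] := std_side e0e0 e1e1 Uu.
  by exists U0, c0, v; rewrite H3 H5.
have [U0 [c0 [v [H1 H2 H3 H4 H5]]]] := std_pole e0e0 (@gdom_upole R k).
by exists U0, c0, v; rewrite H3 H5 ltW // gdom_neg //; exact: gdom_upole.
Qed.

End Orientation.

Section AtlasOf.
Variables (R : realType) (k N : nat) (s : setting R k N).
Let n := k.+2.
Let E := 'rV[R]_(n.*2.+1).
Let D := 'rV[R]_(n.*2).
Local Notation "x $ i" := (coord x i) (at level 5, format "x $ i").
Local Notation Phi := (st_Phi s).
Implicit Types (x : E) (u v : D).

Definition atlas : set (chart R N n) :=
  [set c | exists U0 c0, std_chart U0 c0 /\ c = chart_of s U0 c0].

Lemma Phi_inj : injective Phi.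
Proof. exact: can_inj (st_PhiK s). Qed.

(** The left inverse of the base chart, composed with [st_PhiV], is defined and differentiable on an open
    subset of the ambient space; this gives injectivity, immersivity and relative
    openness at once. *)
Lemma is_chart_of U0 c0 : base_chart U0 c0 -> is_chart (hypersurface s) (chart_of s U0 c0).
Proof.
move=> bc; have oU := bc_open bc; have sc := bc_smooth bc.
have sP := st_Phi_smooth s oU sc.
have [Or [r [oO sr rc cr]]] := bc_inv bc.
pose g p := r (st_PhiV s p).
have gP u : U0 u -> g (Phi (c0 u)) = u by move=> Uu; rewrite /g st_PhiK; have [] := rc _ Uu.
pose P := st_O s `&` st_PhiV s @^-1` Or.
have oP : open P by apply: open_preimage_in => //; [exact: st_O_open|exact: st_PhiV_diff].
have dg p : P p -> differentiable g p.
  move=> [Op Orp]; apply: (@differentiable_comp _ _ _ _ (st_PhiV s) r).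
    exact: st_PhiV_diff.
  exact: smooth_diff sr Orp.
have PP u : U0 u -> P (Phi (c0 u)).
  move=> Uu; split; first exact: st_PhiO.
  by rewrite /= st_PhiK; have [] := rc _ Uu.
split.
- by apply: open_pos => //; apply: smooth_dframe.
- by apply: smoothW sP => u [].
- move=> u v [Uu _] [Uv _] /= uv; by rewrite -(gP u Uu) uv gP.
- move=> u v [Uu _] /= D0.
  apply: (left_inverse_immersion (g := g) oU Uu gP _ _ D0); first exact: smooth_diff sP Uu.
  exact/dg/PP.
- move=> U oU' UU; exists (P `&` g @^-1` U); first exact: open_preimage_in.
  apply/seteqP; split=> [p [u [Uu [_ u0]] <-]|p [[x Sx <-] [[_ Px] Ug]]].
    have [U0u _] := UU _ Uu.
    split; first by exists (c0 u) => //; split; [exact: bc_F bc _ U0u|exact: bc_L bc _ U0u u0].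
    by split; [exact: PP|rewrite /= gP].
  rewrite /= st_PhiK in Px; rewrite /= /g st_PhiK in Ug.
  have [U0r _] := UU _ Ug; have [r0 cx] := cr x Sx Px U0r.
  exists (r x); last by rewrite /= cx.
  by split=> //; split=> //; exact: UU.
Qed.

Lemma atlas_oriented : oriented_hypersurface (hypersurface s) atlas.
Proof.
split.
- by move=> c [U0 [c0 [/std_base bc ->]]]; exact: is_chart_of.
- move=> p [x Sx <-]; have [U0 [c0 [u [sc Uu u0 d0 ux]]]] := std_cover Sx.
  exists (chart_of s U0 c0), u; split; first by exists U0, c0.
  + by split.
  + by rewrite /= ux.
- move=> c c' u u' [U0 [c0 [/std_base bc ->]]] [U0' [c0' [/std_base bc' ->]]].
  move=> [[Uu d0] _] [[Uu' d0'] _] /= /Phi_inj cc.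
  have [B B0 BE] := base_transition bc bc' Uu Uu' cc d0 d0'.
  exists B => //.
  have jE U1 c1 t : base_chart U1 c1 -> U1 t -> 'J (fun u => Phi (c1 u)) t
      = \matrix_(i < n.*2) 'D_('D_(basis R n.*2 i) c1 t) Phi (c1 t).
    move=> b1 U1t; have d1 := smooth_diff (bc_smooth b1) U1t.
    rewrite jacobianE; last exact: smooth_diff (st_Phi_smooth s (bc_open b1) (bc_smooth b1)) U1t.
    apply/row_matrixP => i; rewrite [LHS]rowK [RHS]rowK.
    by apply: (@derive_comp R _ _ _ c1 Phi t) => //; exact: st_Phi_diff.
  rewrite (jE U0 c0) // (jE U0' c0') //; apply/row_matrixP => i.
  rewrite rowK BE cc (derive_dir_sum _ _ (st_Phi_diff s _)).
  rewrite row_mul (row_mul_sum _ (fun i => 'D_('D_(basis R n.*2 i) c0' u') Phi (c0' u'))).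
  by apply: eq_bigr => j _; rewrite mxE.
Qed.

End AtlasOf.

(** * Tangencies and boundary *)

Section Tangencies.
Variables (R : realType) (k N : nat) (s : setting R k N).
Let n := k.+2.
Let E := 'rV[R]_(n.*2.+1).
Let D := 'rV[R]_(n.*2).
Local Notation "x $ i" := (coord x i) (at level 5, format "x $ i").
Local Notation alpha := (st_alpha s).
Local Notation Phi := (st_Phi s).
Local Notation rho := (st_rho s).
Local Notation A := (st_A s).
Local Notation mu := (st_mu s).
Implicit Types (x Y : E) (u v : D).

Lemma dLZ x a Y : dL x (a *: Y) = a * dL x Y.
Proof. by rewrite /dL /dtau !coordZ; ring. Qed.

Lemma pole_sq x : pole x -> S0 x -> x$0 ^+ 2 = 1.
Proof. by move=> px /S0_sphere; rewrite pole_wsq // pole_tau // add0r. Qed.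

Lemma pole_coord x j : pole x -> (0 < j)%N -> x$j = 0.
Proof. by case: j => // j /(_ j). Qed.

Lemma pole_om x Y : pole x -> om x Y = 0.
Proof. by move=> px; rewrite /om big1 // => i _; rewrite !(pole_coord px) // !mul0r subrr. Qed.

Lemma pole_dF x Y : pole x -> dF x Y = 2 * (x$0 * Y$0).
Proof.
move=> px; rewrite dF_om pole_Xf // pole_tau // darbouxE (pole_om Y px) addr0.
by rewrite /om big1 ?add0r // => i _; rewrite !coord0 !mul0r subrr.
Qed.

Lemma pole_dL x Y : pole x -> dL x Y = Y$0.
Proof. by move=> px; rewrite /dL /dtau !(pole_coord px) //; ring. Qed.

Definition south : E := gch (-1) (upole R k).
Definition north : E := gch 1 (upole R k).

Lemma pole_cases x : pole x -> S0 x -> x = north \/ x = south.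
Proof.
move=> px Sx; have [pn n0] := @gch_upole R k 1; have [ps s0] := @gch_upole R k (-1).
have /eqP := pole_sq px Sx; rewrite sqrf_eq1 => /orP[] /eqP x0; [left|right].
  by apply: pole_eq; rewrite // n0.
by apply: pole_eq; rewrite // s0.
Qed.

Lemma S0_gch e0 : e0 ^+ 2 = 1 -> S0 (gch e0 (upole R k)).
Proof.
move=> ee; have bc := base_chart_gch k ee.
split; first exact: bc_F bc _ (@gdom_upole R k).
by apply: bc_L bc _ (@gdom_upole R k) _; exact/ltW/gdom_neg/gdom_upole.
Qed.

Section AtPoint.
Variables (U0 : set D) (c0 : D -> E) (u : D).
Hypotheses (bc : base_chart U0 c0) (Uu : U0 u) (u0 : u$0 <= 0) (d0 : 0 < dframe c0 u).
Local Notation x := (c0 u).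
Let c := chart_of s U0 c0.

Lemma chart_S0 : S0 x.
Proof. by split; [exact: bc_F bc _ Uu|exact: bc_L bc _ Uu u0]. Qed.

Lemma kappa_gt0 : 0 < kappa s c0 u.
Proof.
by rewrite /kappa; apply: mulr_gt0 => //; apply: mulr_gt0;
  [exact: kappa0_gt0|apply: exprn_gt0; exact: st_rho_gt0].
Qed.

(** At a tangency the characteristic field vanishes, hence so does [Xf], hence also the
    derivative of L along [Xf]. *)
Lemma tangency_pole : (forall v, pullback alpha c u v = 0) -> pole x.
Proof.
move=> p0; have [//|npx] := pselect (pole x).
have cf0 : char_field alpha c u = 0.
  apply/rowP => i; rewrite !mxE (char_formE s bc _ Uu).
  rewrite bpfaff0 => [|j]; last by rewrite -(pullbackE s bc) //; exact: p0.
  by rewrite -(pullbackE s bc) // p0 mul0r mulr0.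
have := derive_char_field s bc Uu d0; rewrite cf0 derive_dir0; last first.
  exact: smooth_diff (bc_smooth bc) Uu.
have [Fx Lx] := chart_S0.
have := dL_Xf_gt0 Fx Lx npx; have k0 := kappa_gt0.
by move=> H /(congr1 (dL x)); rewrite dL0 dLZ => /esym/eqP; rewrite mulf_eq0 !gt_eqF.
Qed.

Lemma pole_derive0 v : pole x -> ('D_v c0 u)$0 = 0.
Proof.
move=> px; have := chart_tangent bc v Uu; rewrite pole_dF // => /eqP.
have := pole_sq px chart_S0; move: x$0 => t t2.
have t0 : t != 0 by apply: contra_eq_neq t2 => ->; rewrite expr0n /= eq_sym oner_eq0.
by rewrite !mulf_eq0 pnatr_eq0 (negbTE t0) /= => /eqP.
Qed.

Lemma pole_symp v : pole x -> symp (chat s c0 u) ('D_v (chat s c0) u) = 0.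
Proof.
move=> px; rewrite (derive_chat_lift s bc) // sympDr !sympZr /chat !sympZl !st_conf.
by rewrite symp_self /lift0 symp_lift1 (pole_om _ px) pole_derive0 //; ring.
Qed.

Lemma pole_pullback v : pole x -> pullback alpha c u v = 0.
Proof. by move=> px; rewrite (pullbackE s bc) // pole_symp. Qed.

(** At a pole dL vanishes on the tangent space, which [bc_bd] forbids on the boundary. *)
Lemma pole_interior : pole x -> u$0 < 0.
Proof.
move=> px; rewrite lt_neqAle u0 andbT; apply/eqP => u00.
have [a a0 /(_ (basis R n.*2 0))] := bc_bd bc Uu u00.
rewrite pole_dL // pole_derive0 // coord_basis /= mulr1 => a00.
by move: a0; rewrite -a00 ltxx.
Qed.

Lemma dlambda_powE : dlambda_pow alpha c u
  = pfaff n (fun i j => symp ('D_(basis R n.*2 i) (chat s c0) u)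
                             ('D_(basis R n.*2 j) (chat s c0) u)).
Proof.
rewrite /dlambda_pow wedge_powE.
have -> : (fun i j => extd (pullback alpha c) u (basis R n.*2 i) (basis R n.*2 j))
    = (fun i j => 2 * symp ('D_(basis R n.*2 i) (chat s c0) u)
                           ('D_(basis R n.*2 j) (chat s c0) u)).
  by apply/funext => i; apply/funext => j; rewrite (extdE s bc).
by rewrite pfaffZ mulrA -exprMn mulVf // expr1n mul1r.
Qed.

(** (d lambda)^n is the Pfaffian of the Gram matrix of the frame D_j.  These vectors
    are orthogonal to P, so the expansion of the Pfaffian of the full frame
    compares it with the oriented determinant. *)
Lemma pole_dlambda : pole x -> exists2 a : R, 0 < a & dlambda_pow alpha c u = - (a * x$0).
Proof.
move=> px; pose NA := lift0 (Nf x) *m A.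
have H := pfaff_kernel (p := chat s c0 u) NA
  (v := fun j => 'D_(basis R n.*2 j) (chat s c0) u) (fun j => pole_symp _ px).
have sN : symp (chat s c0 u) NA = - (rho x * mu * x$0).
  rewrite /chat sympZl st_conf /lift0 symp_lift1 (pole_om _ px) Nf_0 pole_tau //.
  by rewrite (px 0%N) (px 2%N); ring.
rewrite -dlambda_powE sN in H.
have dF0 : 0 < \det (framemx (chat s c0 u) NA (fun j => 'D_(basis R n.*2 j) (chat s c0) u)).
  rewrite (frame_det s bc Uu); have r0 := st_rho_gt0 s x; have m0 := st_mu_gt0 s.
  apply: mulr_gt0; last exact: exprn_gt0.
  by apply: mulr_gt0 => //; apply: mulr_gt0 => //; exact: exprn_gt0.
have n0 : (0 : R) < n.+1.*2%:R by rewrite ltr0n.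
have rm0 : 0 < rho x * mu by apply: mulr_gt0; [exact: st_rho_gt0|exact: st_mu_gt0].
have x2 := pole_sq px chart_S0.
exists (\det (framemx (chat s c0 u) NA (fun j => 'D_(basis R n.*2 j) (chat s c0) u))
   * pfaff_std R n.+1 / (n.+1.*2%:R * (rho x * mu))).
  by apply: divr_gt0; apply: mulr_gt0 => //; exact: pfaff_std_gt0.
move: H; rewrite /framemx => <-; move: x2 n0 rm0.
move: (dlambda_pow _ _ _) (n.+1.*2%:R : R) (rho x * mu) x$0 => d m r t t2 m0 r0.
transitivity (d * t ^+ 2); first by rewrite t2 mulr1.
by field; rewrite !gt_eqF.
Qed.

Lemma boundary_outward : u$0 = 0 -> 0 < (char_field alpha c u)$0.
Proof.
move=> u00; have [a a0 aP] := bc_bd bc Uu u00.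
have npx : ~ pole x by move/pole_interior; rewrite u00 ltxx.
have := aP (char_field alpha c u); rewrite (derive_char_field s bc Uu d0) dLZ => H.
have [Fx Lx] := chart_S0; have := dL_Xf_gt0 Fx Lx npx => L0.
by rewrite -(pmulr_rgt0 _ a0) -H; apply: mulr_gt0 => //; exact: kappa_gt0.
Qed.

End AtPoint.

Lemma neg_tangencyE : neg_tangency alpha (atlas s) = [set Phi north].
Proof.
apply/seteqP; split=> [p [c [u [[U0 [c0 [/std_base bc ->]]] [[Uu d0] u0] <- p0 dl]]]|_ ->].
  have px := tangency_pole bc Uu u0 d0 p0.
  have [a a0 aE] := pole_dlambda bc Uu u0 d0 px.
  have [xE|xE] := pole_cases px (chart_S0 bc Uu u0); first by rewrite /= xE.
  have [_ s0] := @gch_upole R k (-1); move: dl; rewrite aE xE s0 mulrN1 opprK.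
  by move/lt_trans/(_ a0); rewrite ltxx.
have Sn : S0 north by apply: S0_gch; rewrite expr1n.
have [U0 [c0 [u [sc Uu u0 d0 ux]]]] := std_cover Sn; have bc := std_base sc.
have [pn n0] := @gch_upole R k 1; have px : pole (c0 u) by rewrite ux.
exists (chart_of s U0 c0), u; split; first by exists U0, c0.
- by split.
- by rewrite /= ux.
- by move=> v; exact: pole_pullback.
- have [a a0 ->] := pole_dlambda bc Uu u0 d0 px.
  by rewrite ux n0 mulr1 oppr_lt0.
Qed.

Lemma pos_tangency_sub : pos_tangency alpha (atlas s) `<=` [set Phi south].
Proof.
move=> p [c [u [[U0 [c0 [/std_base bc ->]]] [[Uu d0] u0] <- p0 dl]]].
have px := tangency_pole bc Uu u0 d0 p0.
have [a a0 aE] := pole_dlambda bc Uu u0 d0 px.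
have [xE|xE] := pole_cases px (chart_S0 bc Uu u0); last by rewrite /= xE.
have [_ s0] := @gch_upole R k 1; move: dl; rewrite aE xE s0 mulr1 oppr_gt0.
by move/lt_trans/(_ a0); rewrite ltxx.
Qed.

Lemma atlas_discrete : discrete_tangencies alpha (atlas s).
Proof.
move=> p Tp; split.
  have [x [px Sx <-]] : exists x, [/\ pole x, S0 x & Phi x = p].
    case: Tp => [/pos_tangency_sub ->|]; last rewrite neg_tangencyE => ->.
      exists south; split=> //; last by apply: S0_gch; rewrite sqrrN expr1n.
      by have [] := @gch_upole R k (-1).
    exists north; split=> //; last by apply: S0_gch; rewrite expr1n.
    by have [] := @gch_upole R k 1.
  have [U0 [c0 [u [sc Uu u0 d0 ux]]]] := std_cover Sx; have bc := std_base sc.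
  exists (chart_of s U0 c0), u; split; first by exists U0, c0.
  - by split.
  - by rewrite /= ux.
  - by apply: (pole_interior bc Uu u0); rewrite ux.
split; first exact: mem_set.
set T := _ `|` _ in Tp *.
have fT : finite_set (T `\ p).
  apply: sub_finite_set (finite_set2 (Phi south) (Phi north)) => q [Tq _].
  case: Tq => [/pos_tangency_sub ->|]; [by left|rewrite neg_tangencyE => ->; by right].
exists (~` (T `\ p)).
  apply: open_nbhs_nbhs; split; last by move=> [_]; exact.
  apply: closed_openC; exact: (accessible_finite_set_closed.1 (hausdorff_accessible (@norm_hausdorff _ _))) fT.
apply/seteqP; split=> [q [nTq Tq]|_ ->]; last by split=> // -[_]; exact.
by apply: contrapT => qp; apply: nTq.
Qed.

Lemma atlas_boundary : contact_type_boundary alpha (atlas s).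
Proof.
split; last first.
  by move=> c u [U0 [c0 [/std_base bc ->]]] [[Uu d0] u0] u00; exact: boundary_outward.
have U0 : bdom (0 : D).
  split; rewrite !coord0 //; rewrite addr0 expr1n expr0n addr0.
  by apply: ltr_pwDl => //; exact: ssq_ge0.
have ee : (1 : R) ^+ 2 = 1 by rewrite expr1n.
have [V [c0 [u [sc Vu u0 d0 ux]]]] := std_side ee ee U0.
rewrite coord0 in u0.
exists (Phi (c0 u)), (chart_of s V c0), u; split=> //; first by exists V, c0.
by split=> //=; rewrite u0.
Qed.

End Tangencies.

(** * The index of the negative tangency *)

Section BlockDiagonal.
Variable R : comNzRingType.

Lemma det_block22 m (f : nat -> nat -> R) :
    (forall i j, i./2 != j./2 -> f i j = 0) ->
  \det (\matrix_(i < m.*2, j < m.*2) f i j)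
  = \prod_(i < m) (f i.*2 i.*2 * f i.*2.+1 i.*2.+1 - f i.*2 i.*2.+1 * f i.*2.+1 i.*2).
Proof.
elim: m f => [|m IHm] f f0; first by rewrite big_ord0 det_mx00.
pose B : 'M[R]_2 := \matrix_(i, j) f i j.
pose C : 'M[R]_(m.*2) := \matrix_(i, j) f i.+2 j.+2.
have -> : (\matrix_(i < m.+1.*2, j < m.+1.*2) f i j) = (block_mx B 0 0 C : 'M[R]_(2 + m.*2)).
  apply/matrixP => i j; rewrite [LHS]mxE.
  case: (@split_ordP 2 m.*2 i) => i' ->; case: (@split_ordP 2 m.*2 j) => j' ->.
  - by rewrite (@block_mxEul _ 2 m.*2 2) mxE.
  - by rewrite (@block_mxEur _ 2 m.*2 2) mxE f0 //=; case: i' => -[|[]].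
  - by rewrite (@block_mxEdl _ 2 m.*2 2) mxE f0 //=; case: j' => -[|[]].
  - by rewrite (@block_mxEdr _ 2 m.*2 2) mxE.
rewrite (@det_ublock _ 2 m.*2) (IHm (fun i j => f i.+2 j.+2)) => [|i j ij]; last exact: f0.
rewrite big_ord_recl; congr (_ * _).
rewrite (expand_det_row _ ord0) !big_ord_recl big_ord0 addr0 /cofactor.
rewrite !det_mx11 !mxE /= /bump /= !addn0 expr0 expr1 mul1r mulN1r mulrN.
by [].
Qed.

End BlockDiagonal.

Section Index.
Variables (R : realType) (k N : nat) (s : setting R k N).
Let n := k.+2.
Let E := 'rV[R]_(n.*2.+1).
Let D := 'rV[R]_(n.*2).
Local Notation "x $ i" := (coord x i) (at level 5, format "x $ i").
Local Notation alpha := (st_alpha s).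
Local Notation Phi := (st_Phi s).
Local Notation rho := (st_rho s).
Implicit Types (x Y : E) (u v : D).

Lemma smooth_Xf (U : set D) (c0 : D -> E) : open U -> smooth U c0 ->
  smooth U (fun u => Xf (c0 u)).
Proof.
move=> oU sc; have sj j : smooth U (fun u => (c0 u)$j) by exact: smooth_coordn.
have st : smooth U (fun u => tau (c0 u)) by exact: smooth_tau.
have sx i : smooth U (fun u => Xx (c0 u) i).
  apply: smoothB => //; apply: smoothM => //; first exact: smooth_cst.
  exact: smoothM.
have sy i : smooth U (fun u => Xy (c0 u) i).
  apply: smoothD => //; first by apply: smoothM => //; exact: smoothN.
  case: (1 < i)%N; first exact: smoothN.
  by apply: smoothM => //; exact: smoothB.
apply: smooth_rowf => // -[|j].
  apply: smoothN => //; apply: smooth_sum => // i.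
  by apply: smoothB => //; exact: smoothM.
by case: (odd j).
Qed.

Lemma smooth_kappa (U : set D) (c0 : D -> E) : open U -> smooth U c0 ->
  smooth U (kappa s c0).
Proof.
move=> oU sc; apply: smoothM => //; last exact: smooth_dframe.
apply: smoothM => //; first exact: smooth_cst.
by apply: smoothX => //; exact: st_rho_smooth.
Qed.

(** The linearization of [Xf] at the pole where tau = 1, in the coordinates
   other than z. *)
Definition Xlin (v : nat -> R) (j : nat) : R :=
  let i := j./2 in
  if odd j then - v i.*2.+1 + (if (1 < i)%N then - v i.*2 else v i.*2 - v i.*2.+1)
  else v i.*2.+1 - (1 < i)%N%:R * v i.*2.

Lemma isD_Xf (c0 : D -> E) u v j : differentiable c0 u -> pole (c0 u) ->
    tau (c0 u) = 1 -> (j < n.*2)%N ->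
  isD u v (fun t => (Xf (c0 t))$(j.+1)) (Xlin (fun i => ('D_v c0 u)$(i.+1)) j).
Proof.
move=> dc px t1 jn; set w := 'D_v c0 u.
have ic i : isD u v (fun t => (c0 t)$i) (w$i) by exact: isD_coord.
have it : isD u v (fun t => tau (c0 t)) (dtau (c0 u) w) by exact: isD_tau.
have in2 : (j./2 < n)%N by lia.
have jE := odd_double_half j; rewrite /Xlin; case: (boolP (odd j)) jE => oj /= jE.
  have -> : (fun t => (Xf (c0 t))$(j.+1)) = (fun t => Xy (c0 t) j./2).
    by apply/funext => t; rewrite -Xf_y // -{1}jE.
  apply: isD_eq.
    apply: isD_add; first by apply: isD_mul; [apply: isD_opp; exact: it|exact: ic].
    rewrite (_ : (fun t => if _ then _ else _) = fun t =>
      (1 < j./2)%N%:R * - (c0 t)$(j./2.*2.+1)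
      + (1 - (1 < j./2)%N%:R) * (tau (c0 t) * ((c0 t)$(j./2.*2.+1) - (c0 t)$(j./2.*2.+2)))).
      apply: isD_add; apply: isD_mul; [exact: isD_cst|apply: isD_opp; exact: ic|exact: isD_cst|].
      apply: isD_mul; first exact: it.
      by apply: isD_add; [exact: ic|apply: isD_opp; exact: ic].
    by apply/funext => t; case: (1 < j./2)%N => /=; ring.
  cbv beta; rewrite !(px _) t1; case: (1 < j./2)%N => /=; ring.
have -> : (fun t => (Xf (c0 t))$(j.+1)) = (fun t => Xx (c0 t) j./2).
  by apply/funext => t; rewrite -Xf_x // -{1}jE.
apply: isD_eq.
  apply: isD_add; first exact: ic.
  apply: isD_opp; apply: isD_mul; first exact: isD_cst.
  by apply: isD_mul; [exact: it|exact: ic].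
by cbv beta; rewrite !(px _) t1; ring.
Qed.

Section PoleChart.
Variable e : R.
Hypothesis ee : e ^+ 2 = 1.
Let c0 (u : D) := gch 1 (refl k e u) : E.
Let U0 : set D := refl k e @^-1` @gdom R k.
Let c := chart_of s U0 c0.
Let u0 : D := refl k e (upole R k).

Let bc : base_chart U0 c0.
Proof. by apply: (base_chart_refl ee (c0 := gch 1)); apply: base_chart_gch; rewrite expr1n. Qed.

Let Uu0 : U0 u0.
Proof.
have : gdom (refl k e u0) by rewrite /u0 (reflK ee); exact: gdom_upole.
by [].
Qed.

Let c0u0 : c0 u0 = north R k.
Proof. by rewrite /c0 /u0 (reflK ee). Qed.

Let pn : pole (c0 u0).
Proof. by rewrite c0u0; have [] := @gch_upole R k 1. Qed.

Let tn : tau (c0 u0) = 1.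
Proof. by rewrite pole_tau // c0u0; have [] := @gch_upole R k 1. Qed.

Let derive_c0 u v j : U0 u -> ('D_v c0 u)$(j.+1) = refl_coef e j * v$j.
Proof.
move=> Uu; rewrite derive_comp; last first.
- by apply: smooth_diff (@smooth_gch R k 1) Uu.
- exact: differentiable_linear.
by rewrite derive_gch // derive_linear coord_refl.
Qed.

Let char_coord u j : c.1 u ->
  (char_field alpha c u)$j = refl_coef e j * (kappa s c0 u * (Xf (c0 u))$(j.+1)).
Proof.
move=> [Uu d0]; have := derive_char_field s bc Uu d0.
move/(congr1 (fun x => x$(j.+1))); rewrite derive_c0 // coordZ => <-.
by rewrite mulrA (refl_coefK ee) mul1r.
Qed.

Hypothesis d0 : 0 < dframe c0 u0.

Let oc : open c.1.
Proof. by apply: open_pos; [exact: bc_open bc|exact: smooth_dframe (bc_open bc) (bc_smooth bc)]. Qed.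

Let smooth_char : smooth c.1 (char_field alpha c).
Proof.
have sc : smooth c.1 c0 by apply: smoothW (bc_smooth bc) => u [].
apply/smooth_rowP => // j.
apply: (smooth_ext oc (f := fun u => refl_coef e j * (kappa s c0 u * (Xf (c0 u))$(j.+1)))).
  by move=> u cu; rewrite char_coord.
apply: smoothM => //; first exact: smooth_cst.
apply: smoothM => //; first exact: smooth_kappa.
by apply: smooth_coordn => //; exact: smooth_Xf.
Qed.

Let char0 : char_field alpha c u0 = 0.
Proof.
apply/coordP => j _; rewrite char_coord; last by split.
by rewrite pole_Xf // !coord0 !mulr0.
Qed.

Let jac_coef (i j : nat) : R := kappa s c0 u0 *
  (refl_coef e j * Xlin (fun a => refl_coef e a * (a == i)%:R) j).

Let derive_charE (i j : 'I_n.*2) :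
  ('D_(basis R n.*2 i) (char_field alpha c) u0)$j = jac_coef i j.
Proof.
have cu : c.1 u0 by split.
rewrite -derive_coord; last exact: smooth_diff smooth_char cu.
have dc := smooth_diff (bc_smooth bc) Uu0.
have dk : differentiable (kappa s c0) u0.
  exact: smooth_diff (smooth_kappa (bc_open bc) (bc_smooth bc)) Uu0.
have [_ H] : isD u0 (basis R n.*2 i)
    (fun t => refl_coef e j * (kappa s c0 t * (Xf (c0 t))$(j.+1)))
    (0 * (kappa s c0 u0 * (Xf (c0 u0))$(j.+1))
     + refl_coef e j * ('D_(basis R n.*2 i) (kappa s c0) u0 * (Xf (c0 u0))$(j.+1)
       + kappa s c0 u0 * Xlin (fun a => ('D_(basis R n.*2 i) c0 u0)$(a.+1)) j)).
  apply: isD_mul; first exact: isD_cst.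
  by apply: isD_mul; [split|exact: isD_Xf].
transitivity ('D_(basis R n.*2 i)
    (fun t => refl_coef e j * (kappa s c0 t * (Xf (c0 t))$(j.+1))) u0).
  by apply: near_eq_derive; apply: filterS (open_nbhs_nbhs (conj oc cu)) => t /char_coord.
rewrite H pole_Xf // coord0 mulr0 mul0r mulr0 !add0r /jac_coef mulrCA.
congr (_ * (_ * Xlin _ _)); apply/funext => a; rewrite derive_c0 // coord_basis.
case: eqP => [->|_]; first by rewrite (ltn_ord i).
by rewrite mul0rn.
Qed.

Let jac_coef0 i j : i./2 != j./2 -> jac_coef i j = 0.
Proof.
move=> ij; rewrite /jac_coef /Xlin.
have -> : (j./2.*2 == i) = false by apply: contraNF ij => /eqP <-; rewrite doubleK.
have -> : (j./2.*2.+1 == i) = false.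
  by apply: contraNF ij => /eqP <-; rewrite /= uphalf_double.
by case: (odd j); case: (1 < j./2)%N => /=; ring.
Qed.

Let jac_block a : jac_coef a.*2 a.*2 * jac_coef a.*2.+1 a.*2.+1
    - jac_coef a.*2 a.*2.+1 * jac_coef a.*2.+1 a.*2
  = kappa s c0 u0 ^+ 2 * (if (1 < a)%N then 2 else -1).
Proof.
rewrite /jac_coef /Xlin /= odd_double doubleK uphalf_double /=.
rewrite !eqxx (gtn_eqF (ltnSn a.*2)) (ltn_eqF (ltnSn a.*2)).
have r0 : refl_coef e a.*2 = 1 by rewrite /refl_coef; case: eqP => // H; lia.
have r1 := refl_coefK ee a.*2.+1; rewrite r0; move: r1.
move: (refl_coef e a.*2.+1) (kappa s c0 u0) => r K r1.
have {}r1 : r ^+ 2 = 1 by rewrite expr2.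
case: (1 < a)%N => /=; ring: r1.
Qed.

(** The Jacobian at the pole is block diagonal with n blocks, the first two of
    determinant -1 and the others of determinant 2, up to a positive factor. *)
Lemma pole_index : is_vf_index c.1 (char_field alpha c) u0 1 /\
  forall i, is_vf_index c.1 (char_field alpha c) u0 i -> i = 1.
Proof.
have cu : c.1 u0 by split.
have J0 : 0 < \det ('J (char_field alpha c) u0).
  rewrite jacobianE; last exact: smooth_diff smooth_char cu.
  have -> : \matrix_(i < n.*2) 'D_(basis R n.*2 i) (char_field alpha c) u0
      = \matrix_(i < n.*2, j < n.*2) jac_coef i j.
    by apply/matrixP => i j; rewrite mxE -coord_ord derive_charE mxE.
  rewrite (det_block22 n jac_coef0) (eq_bigr _ (fun (a : 'I_n) _ => jac_block a)).
  have k2 : 0 < kappa s c0 u0 ^+ 2 by apply: exprn_gt0; exact: kappa_gt0.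
  rewrite big_ord_recl big_ord_recl mulrA mulr_gt0 //.
    by rewrite /= !mulrN1 mulrNN mulr_gt0.
  by apply: prodr_gt0 => a _; rewrite mulr_gt0.
split; first exact: (is_vf_index1 oc cu smooth_char char0 J0).
by move=> i; exact: (is_vf_index_uniq char0 J0).
Qed.

End PoleChart.

(** Side charts avoid the poles, so only graphs contain the negative tangency. *)
Lemma north_chart U0 c0 u : std_chart U0 c0 -> U0 u -> c0 u = north R k ->
  exists2 e, e ^+ 2 = 1 &
    [/\ U0 = refl k e @^-1` @gdom R k, c0 = (fun t => gch 1 (refl k e t))
      & u = refl k e (upole R k)].
Proof.
have [pn n0] := @gch_upole R k 1.
case=> [e0 e1 e e0e0 e1e1 ee Uu cu|e0 e e0e0 ee Uu cu].
  by case: (theta_bch_npole e0e0 e1e1 Uu); rewrite cu.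
have ru : refl k e u = upole R k by apply: (@pole_gch R k e0); rewrite cu.
exists e => //; split=> //; last by rewrite -ru (reflK ee).
have -> // : e0 = 1.
by have [_ <-] := @gch_upole R k e0; rewrite -ru cu n0.
Qed.

Lemma index_north : Ind alpha (atlas s) (Phi (north R k)) = 1.
Proof.
have Sn : S0 (north R k) by apply: S0_gch; rewrite expr1n.
have [U0 [c0 [u [sc Uu u0 d0 ux]]]] := std_cover Sn.
rewrite /Ind; apply: xget_unique => [|i].
  exists (chart_of s U0 c0), u; split; first by exists U0, c0.
  - by split.
  - by rewrite /= ux.
  - have [e ee [UE cE uE]] := north_chart sc Uu ux; subst U0 c0 u.
    by have [] := pole_index ee d0.
move=> [c [v [[V [b [sb ->]]] [[Vv dv] v0] bv]]].
have {}bv : b v = north R k by exact: (@Phi_inj R k N s).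
have [e ee [VE bE vE]] := north_chart sb Vv bv; subst V b v.
by have [_] := pole_index ee dv; exact.
Qed.

Lemma atlas_index_sum :
  0 < \sum_(p \in neg_tangency alpha (atlas s)) Ind alpha (atlas s) p.
Proof. by rewrite neg_tangencyE fsbig_set1 index_north. Qed.

End Index.

(** * Compactness and connectedness of the model *)

Lemma star_connected (R : realType) (V : normedModType R) (C : set V) :
  (forall x (t : R), C x -> 0 <= t <= 1 -> C (t *: x)) -> connected C.
Proof.
move=> Cs; have -> : C = \bigcup_(x in C) ((fun t : R => t *: x) @` `[0, 1]).
  apply/seteqP; split=> [x Cx|y [x Cx [t]]].
    by exists x => //; exists 1; rewrite ?scale1r //= in_itv /= ler01 lexx.
  by rewrite /= in_itv /= => t01 <-; exact: Cs.
apply: bigcup_connected.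
  by exists 0 => x Cx; exists 0; rewrite ?scale0r //= in_itv /= lexx ler01.
move=> x _; apply: connected_continuous_connected; first exact: segment_connected.
by apply: continuous_subspaceT => t; apply: scalel_continuous.
Qed.

Section BaseTopology.
Variables (R : realType) (k : nat).
Let n := k.+2.
Let E := 'rV[R]_(n.*2.+1).
Local Notation "x $ i" := (coord x i) (at level 5, format "x $ i").
Implicit Types x y : E.

Lemma continuous_F : continuous (@Ffun R k).
Proof.
move=> x; apply: differentiable_continuous.
have di : differentiable (@id E) x by [].
by have [] := isD_F 0 di.
Qed.

Lemma continuous_L : continuous (@Lfun R k).
Proof.
move=> x; apply: differentiable_continuous.
have di : differentiable (@id E) x by [].
by have [] := isD_L 0 di.
Qed.

Lemma S0_bounded x : S0 x -> `|x| <= 30.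
Proof.
move=> Sx; have sph := S0_sphere Sx; have [_ Lx] := Sx.
have sq1 (a : R) : a ^+ 2 <= 1 -> `|a| <= 1.
  by rewrite -real_normK ?num_real // expr_le1.
have t2 := sqr_ge0 (tau x); have w2 j : j \notin [:: 0; 1; 3]%N -> `|x$j| <= 1.
  move=> j3; have := wsq_coord x j3 => wj.
  by apply: sq1; lra.
have t1 : -1 <= tau x <= 1.
  have w0 : 0 <= wsq x by have := wsq_coord x (j := 2) isT; have := sqr_ge0 (x$2); lra.
  by rewrite -ler_norml; apply: sq1; lra.
have := w2 2%N isT; have := w2 4%N isT; rewrite !ler_norml => p2 p1.
have q (a p b : R) : -1 <= p <= 1 -> (a + eps R * tau x * p) ^+ 2 + b ^+ 2 <= 6 -> -4 <= a <= 4.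
  move=> pb H; have b2 := sqr_ge0 b.
  have tp : -1 <= tau x * p <= 1.
    rewrite -ler_norml normrM; apply: mulr_ile1; rewrite ?ler_norml //.
  have ep : eps R * tau x * p = (tau x * p) / 20 by rewrite /eps; field.
  rewrite ep in H; set c := tau x * p / 20 in H.
  have c1 : -1 <= c <= 1 by rewrite /c; lra.
  by apply/andP; split; nra.
have L6 : (x$1 + eps R * tau x * x$2) ^+ 2 + (x$3 + eps R * tau x * x$4) ^+ 2 <= 6.
  by move: Lx; rewrite /Lfun; lra.
have q1 : -4 <= x$1 <= 4 by exact: q p1 L6.
have q2 : -4 <= x$3 <= 4 by apply: (q _ _ _ p2); rewrite addrC; exact: L6.
have z : -30 <= x$0 <= 30.
  have -> : x$0 = tau x - x$1 * x$2 - x$3 * x$4 + (x$1 ^+ 2 + x$3 ^+ 2) / 2.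
    by rewrite /tau; field.
  have m (a p : R) : -4 <= a <= 4 -> -1 <= p <= 1 -> -4 <= a * p <= 4.
    by move=> a4 p4; apply/andP; split; nra.
  have := m _ _ q1 p1; have := m _ _ q2 p2.
  have sq (a : R) : -4 <= a <= 4 -> 0 <= a ^+ 2 <= 16.
    by move=> a4; rewrite sqr_ge0 /=; nra.
  by have := sq _ q1; have := sq _ q2; lra.
apply: normr_rowP => // j _.
case: (boolP (j \in [:: 0; 1; 3]%N)) => [|/w2]; last by lra.
rewrite !inE => /or3P[] /eqP -> ; rewrite ler_norml //; lra.
Qed.

Lemma S0_closed : closed (@S0 R k).
Proof.
have -> : @S0 R k = Ffun (k:=k) @^-1` [set 0] `&` Lfun (k:=k) @^-1` [set t | t <= 2] by [].
apply: closedI; apply: closed_comp.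
- by move=> x _; exact: continuous_F.
- exact: closed_eq.
- by move=> x _; exact: continuous_L.
- exact: closed_le.
Qed.

Lemma S0_compact : compact (@S0 R k).
Proof.
apply: (subclosed_compact S0_closed (closed_ball_compact (u := 0 : E) (r := 30))).
by move=> x /S0_bounded; rewrite /= subr0.
Qed.

Lemma wsq_ge0 x : 0 <= wsq x.
Proof. by rewrite (le_trans (sqr_ge0 (x$2))) // wsq_coord. Qed.

(** Inverse stereographic projection in all coordinates but Q = (y_1, y_3).  Unlike
   [bch], it is defined on the whole of a convex set. *)
Definition ster (e0 : R) y : E := rowf n.*2.+1 (fun j => match j with
  | 0 => e0 * ((1 - wsq y) / (1 + wsq y))
  | 1 => y$1 | 3 => y$3 | _ => 2 / (1 + wsq y) * y$j end).

Lemma coord_ster e0 y j : (ster e0 y)$j = match j with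
  | 0 => e0 * ((1 - wsq y) / (1 + wsq y))
  | 1 => y$1 | 3 => y$3 | _ => 2 / (1 + wsq y) * y$j end.
Proof.
rewrite /ster coord_rowfE // => -[|[|[|[|i]]]] // ni.
by rewrite coord_out // mulr0.
Qed.

Lemma wsq1_neq0 y : 1 + wsq y != 0.
Proof. by rewrite gt_eqF // ltr_pwDl // wsq_ge0. Qed.

Lemma ster_sphere e0 y : e0 ^+ 2 = 1 -> wsq (ster e0 y) + (ster e0 y)$0 ^+ 2 = 1.
Proof.
move=> ee; rewrite (@wsq_scale R k (2 / (1 + wsq y)) _ y); last first.
  by case=> [|[|[|[|j]]]] // _; rewrite coord_ster.
by rewrite coord_ster; field: ee; exact: wsq1_neq0.
Qed.

Definition disc : set E := [set y | y$1 ^+ 2 + y$3 ^+ 2 <= 1].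

Lemma disc_connected : connected disc.
Proof.
apply: star_connected => y t; rewrite /disc /= !coordZ => y1 /andP[t0 t1].
have : 0 <= y$1 ^+ 2 + y$3 ^+ 2 by apply: addr_ge0; exact: sqr_ge0.
have : t ^+ 2 <= 1 by nra.
have := sqr_ge0 t; move: y1; rewrite !exprMn -mulrDr.
by move: (y$1 ^+ 2 + _) (t ^+ 2) => a b; nra.
Qed.

Lemma ster_continuous e0 : e0 ^+ 2 = 1 -> continuous (fun y => theta (ster e0 y)).
Proof.
move=> ee x; apply: differentiable_continuous.
have oT := @openT E; have sj j : smooth setT (fun y : E => y$j) by exact: smooth_coord.
have scst (a : R) : smooth setT (fun _ : E => a) by exact: smooth_cst.
have sw : smooth setT (fun y : E => wsq y).
  apply: smooth_sum => // i; apply: smoothD => //; last exact: smoothX.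
  by apply: smoothM => //; exact: smoothX.
have sw1 : smooth setT (fun y : E => (1 + wsq y)^-1).
  by apply: smoothV => // [y _|]; [exact: wsq1_neq0|exact: smoothD].
have ss : smooth setT (ster e0).
  apply: smooth_rowf => // -[|[|[|[|j]]]] //.
  - by apply: smoothM => //; apply: smoothM => //; exact: smoothB.
  - by apply: smoothM => //; exact: smoothM.
  - by apply: smoothM => //; exact: smoothM.
have st := smooth_theta oT ss.
apply: (smooth_diff (st _)) => // y _.
by have := sphere_le1 (ster_sphere y ee); lra.
Qed.

Lemma ster_S0 e0 y : e0 ^+ 2 = 1 -> disc y -> S0 (theta (ster e0 y)).
Proof.
move=> ee dy; have sph := ster_sphere y ee; have t1 := sphere_le1 sph.
split; first by rewrite F_theta; lra.
rewrite L_theta; last by lra.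
move: dy; rewrite /disc /= (coord_ster _ _ 1) (coord_ster _ _ 3).
move: t1; move: (y$1 ^+ 2 + y$3 ^+ 2) (ster e0 y)$0 => a b; nra.
Qed.

Lemma S0_disc x : S0 x -> disc (thetaV x).
Proof.
move=> Sx; have x1 := S0_tau Sx; have yx : theta (thetaV x) = x by rewrite thetaVK //; lra.
have y0 : (thetaV x)$0 <= 1 by rewrite coord_thetaV.
have [_] := Sx; rewrite -{1}yx L_theta; last by lra.
by rewrite /disc /= => H; nra.
Qed.

Lemma S0_ster x : S0 x ->
  exists e0 y, [/\ e0 ^+ 2 = 1, disc y & theta (ster e0 y) = x].
Proof.
move=> Sx; have x1 := S0_tau Sx; have yx : theta (thetaV x) = x by rewrite thetaVK //; lra.
set y := thetaV x in yx *.
have sph : wsq y + y$0 ^+ 2 = 1 by rewrite /y wsq_thetaV coord_thetaV S0_sphere.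
have [e0 ee ey] : exists2 e : R, e ^+ 2 = 1 & 0 <= e * y$0.
  have [a0|a0] := leP 0 (y$0); [exists 1|exists (-1)]; rewrite ?sqrrN ?expr1n ?mul1r //.
  by rewrite mulN1r oppr_ge0 ltW.
have d0 : 1 + e0 * y$0 != 0 by rewrite gt_eqF // ltr_wpDr.
pose y' : E := rowf n.*2.+1 (fun j => match j with
  | 1 => y$1 | 3 => y$3 | _ => y$j / (1 + e0 * y$0) end).
have y'E j : y'$j = match j with
  | 1 => y$1 | 3 => y$3 | _ => y$j / (1 + e0 * y$0) end.
  rewrite coord_rowfE // => -[|[|[|[|i]]]] // ni.
  by rewrite coord_out // mul0r.
exists e0, y'; split=> //; first by rewrite /disc /= !y'E; exact: S0_disc.
have wE : wsq y' = (1 - e0 * y$0) / (1 + e0 * y$0).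
  rewrite (@wsq_scale R k (1 + e0 * y$0)^-1 _ y); last first.
    by case=> [|[|[|[|j]]]] // _; rewrite y'E mulrC.
  have -> : wsq y = (1 - e0 * y$0) * (1 + e0 * y$0).
    by have -> : wsq y = 1 - y$0 ^+ 2; [lra|ring: ee].
  by field.
have w1 : 1 + wsq y' = 2 / (1 + e0 * y$0) by rewrite wE; field.
rewrite -yx; congr theta; apply/coordP => j _; rewrite coord_ster w1 wE !y'E.
case: j => [|[|[|[|j]]]] //.
- by field: ee.
- by field.
- by field.
Qed.

(** The images of the two stereographic parametrizations meet on the equator. *)
Lemma S0_connected : connected (@S0 R k).
Proof.
pose I (e0 : R) := (fun y => theta (ster e0 y)) @` disc.
have -> : @S0 R k = \bigcup_(e0 in [set e0 : R | e0 ^+ 2 = 1]) I e0.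
  apply/seteqP; split=> [x /S0_ster[e0 [y [ee dy <-]]]|x [e0 ee [y dy <-]]].
    by exists e0 => //; exists y.
  exact: ster_S0.
apply: bigcup_connected.
  pose y : E := basis R _ 2; have wy : wsq y = 1.
    by rewrite wsqE !coord_basis /wsq2 big1 ?addr0 ?expr1n ?expr0n //= => [|i _];
      rewrite ?addr0 // !coord_basis !mul0rn expr0n addr0.
  exists (theta (ster 1 y)) => e0 ee; exists y.
    by rewrite /disc /= !coord_basis /= expr0n addr0.
  congr theta; apply/coordP => j _; rewrite !coord_ster wy subrr !mul0r !mulr0.
  by case: j => [|[|[|[|j]]]].
move=> e0 ee; apply: connected_continuous_connected; first exact: disc_connected.
exact/continuous_subspaceT/ster_continuous.
Qed.

End BaseTopology.

(** * Nonconvexity *)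

Lemma wedge11E (R : realType) (V : normedModType R) (a b : V -> R) (v : nat -> V) :
  wedge 1 1 (form1 a) (form1 b) v = a (v 0%N) * b (v 1%N) - a (v 1%N) * b (v 0%N).
Proof.
pose M : 'M[R]_2 := \matrix_(i, j) (if i == 0 :> nat then a (v j) else b (v j)).
have -> : wedge 1 1 (form1 a) (form1 b) v = \det M.
  rewrite /wedge invr1 mul1r /determinant; apply: eq_bigr => s _.
  rewrite !big_ord_recl big_ord0 mulr1 -mulrA /form1 !mxE /= /perm_nat.
  rewrite !(insubT (fun i => (i < 2)%N)) //=.
  by congr (_ * (a (v (val (s _))) * b (v (val (s _))))); exact/val_inj.
rewrite (expand_det_row _ ord0) !big_ord_recl big_ord0 addr0 /cofactor.
rewrite !det_mx11 !mxE /= expr0 expr1 mul1r mulN1r mulrN; congr (_ - _ * b (v _)).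
Qed.

Lemma derive_pos_near (R : realType) (V : normedModType R) (f : V -> R) u w :
  differentiable f u -> 0 < 'D_w f u -> \forall t \near 0^'+, f u < f (u + t *: w).
Proof.
move=> df Dw.
have H : \forall t \near 0^', 0 < t^-1 *: ((f \o shift u) (t *: w) - f u).
  by apply: (@cvgr_gt _ _ _ _ _ ('D_w f u)) => //; exact: diff_derivable.
apply: (@filterS _ (nbhs (0 : R)) _ _ _ _ H) => t /= Ht t0.
have {}Ht := Ht (lt0r_neq0 t0); move: Ht.
by rewrite -[_ *: _]/(_ * _) pmulr_rgt0 ?invr_gt0 // subr_gt0 addrC.
Qed.

Section RowDeterminant.
Variables (R : realType) (n : nat).
Let L := 'rV[R]_(n.+1.*2).

(** As functions of Z, both sides are linear, vanish on p and on the v_j, and agree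
    at N. *)
Lemma det_frame_row (p N Z X : L) v : \det (framemx p N v) != 0 ->
    symp X p = 0 -> (forall j, symp X (v j) = 0) ->
  \det (framemx p Z v) * symp X N = symp X Z * \det (framemx p N v).
Proof.
move=> M0 Xp Xv; set M := framemx p N v in M0 *.
have i1 : (1 < n.+1.*2)%N by [].
pose o1 := Ordinal i1; pose K j := cofactor M o1 j.
have detE Y : \det (framemx p Y v) = \sum_j Y 0 j * K j.
  rewrite (expand_det_row _ o1); apply: eq_bigr => j _; rewrite !mxE /=; congr (_ * _).
  rewrite /K /cofactor; congr (_ * \det _); apply/matrixP => i l; rewrite !mxE.
  by case: (lift o1 i) (neq_lift o1 i) => -[|[|m]].
have det0 Y (i : 'I_n.+1.*2) : o1 != i -> (forall Y', row i (framemx p Y' v) = Y) ->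
    \det (framemx p Y v) = 0.
  move=> oi rY; apply: (determinant_alternate oi) => j.
  by move/rowP/(_ j): (rY Y); rewrite !mxE.
have detp : \det (framemx p p v) = 0.
  by apply: (det0 p ord0) => // Y'; rewrite rowK.
have detv (j : 'I_n.*2) : \det (framemx p (v j) v) = 0.
  have jn : (j.+2 < n.+1.*2)%N by rewrite doubleS !ltnS.
  by apply: (det0 _ (Ordinal jn)) => // Y'; rewrite rowK.
have Mu : M \in unitmx by rewrite unitmxE unitfE.
pose W : 'rV[R]_(2 + n.*2) := Z *m invmx M.
have [a [b [V ZE]]] : exists a b (V : 'rV[R]_(n.*2)),
    Z = a *: p + b *: N + \sum_(j < n.*2) V 0 j *: v j.
  have ZE : Z = lsubmx W *m headmx p N + \sum_(j < n.*2) rsubmx W 0 j *: v j.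
    rewrite -row_mul_sum -mul_row_col hsubmxK -framemxE -/M.
    by rewrite /W mulmxKV.
  exists (lsubmx W 0 0), (lsubmx W 0 (lift ord0 ord0)), (rsubmx W).
  rewrite {1}ZE; congr (_ + _); rewrite mulmx_sum_row !big_ord_recl big_ord0 addr0.
  by rewrite !rowK.
have dN : \det (framemx p Z v) = b * \det M.
  pose T (Y : L) := \sum_j Y 0 j * K j.
  have TD Y Y' : T (Y + Y') = T Y + T Y'.
    by rewrite /T -big_split; apply: eq_bigr => j _; rewrite mxE mulrDl.
  have TZ c Y : T (c *: Y) = c * T Y.
    by rewrite /T mulr_sumr; apply: eq_bigr => j _; rewrite mxE mulrA.
  have T0 : T 0 = 0 by rewrite /T big1 // => j _; rewrite mxE mul0r.
  have TS : T (\sum_(j < n.*2) V 0 j *: v j) = 0.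
    elim/big_rec: _ => [//|j Y _ TY].
    by rewrite TD TZ TY /T -detE detv mulr0 addr0.
  by rewrite detE -/(T Z) ZE !TD !TZ TS addr0 /T -!detE detp mulr0 add0r.
have sZ : symp X Z = b * symp X N.
  rewrite ZE !sympDr !sympZr Xp mulr0 add0r (_ : symp X (\sum_(j < n.*2) _) = 0) ?addr0 //.
  elim/big_rec: _ => [|j y _ IH]; first exact: symp0r.
  by rewrite sympDr IH sympZr Xv mulr0 addr0.
by rewrite dN sZ mulrAC.
Qed.

End RowDeterminant.

Section NotConvex.
Variables (R : realType) (k N : nat) (s : setting R k N).
Let n := k.+2.
Let E := 'rV[R]_(n.*2.+1).
Let D := 'rV[R]_(n.*2).
Local Notation "x $ i" := (coord x i) (at level 5, format "x $ i").
Local Notation alpha := (st_alpha s).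
Local Notation Phi := (st_Phi s).
Local Notation rho := (st_rho s).
Local Notation A := (st_A s).
Local Notation mu := (st_mu s).
Local Notation H := (st_H s).
Local Notation h0 := (st_h0 s).
Implicit Types (x : E) (u : D).

Lemma derive_alpha (p v w : 'rV[R]_N) : 'D_v (fun y => alpha y w) p = symp (H v) (H w).
Proof.
have dH q : differentiable H q by exact: differentiable_linear.
have da : differentiable (fun y => h0 + H y) p.
  by apply: differentiableD; [exact: differentiable_cst|exact: dH].
have Da : 'D_v (fun y => h0 + H y) p = H v.
  rewrite [LHS](@deriveD _ _ _ (fun=> h0) H).
  - by rewrite derive_cst add0r derive_linear.
  - exact: derivable_cst.
  - exact: diff_derivable.
have [_] := isD_symp v da (@differentiable_cst _ _ _ (H w) p).
rewrite derive_cst symp0r addr0 Da => <-.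
by congr ('D_v _ p); apply/funext => y; rewrite st_alphaE.
Qed.

Lemma extd_alpha p v w : extd alpha p v w = 2 * symp (H v) (H w).
Proof. by rewrite /extd !derive_alpha (sympC (H w)); ring. Qed.

Variables (W : set 'rV[R]_N) (Z : 'rV[R]_N -> 'rV[R]_N).
Hypotheses (oW : open W) (SW : hypersurface s `<=` W).
Hypothesis ZC : contact_field (st_M s) alpha W Z.
Hypothesis Zpos : forall c u, atlas s c -> chart_dom c u ->
  let p := c.2 u in
  0 < wedge 1 n.*2 (form1 (alpha p)) (wedge_pow (form2 (extd alpha p)) n)
        (vcons (Z p) (fun i => 'D_(basis R n.*2 i) c.2 u)).
Hypothesis Zbd : forall p, hs_boundary (atlas s) p -> 0 < alpha p (Z p).

Lemma lieE p v : lie Z alpha p v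
  = symp (H (Z p)) (H v) + symp (h0 + H p) (H ('D_v Z p)).
Proof. by rewrite /lie derive_alpha st_alphaE. Qed.

(** The Lie derivative of alpha is proportional to alpha on M. *)
Lemma contact_lie p a b : (st_M s `&` W) p -> tangent (st_M s) p a ->
  tangent (st_M s) p b -> alpha p b = 0 -> alpha p a <> 0 -> lie Z alpha p b = 0.
Proof.
have [_ _ ZP] := ZC => Mp ta tb b0 a0.
have := ZP p Mp (fun j => if j is 0%N then a else b) ta tb.
rewrite wedge11E b0 mul0r subr0 => /eqP.
by rewrite mulf_eq0 => /orP[/eqP//|/eqP].
Qed.

(** The contact Hamiltonian of Z. *)
Definition ham x : R := alpha (Phi x) (Z (Phi x)).

Lemma diff_ham x : S0 x -> differentiable ham x.
Proof.
move=> Sx; have [sZ _ _] := ZC.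
have dP := st_Phi_diff s x.
have dH q : differentiable H q by exact: differentiable_linear.
have dZ : differentiable Z (Phi x) by apply: smooth_diff sZ _; apply: SW; exists x.
have da : differentiable (fun y => h0 + H (Phi y)) x.
  apply: differentiableD; first exact: differentiable_cst.
  by apply: (@differentiable_comp _ _ _ _ Phi H) => //; exact: dH.
have db : differentiable (fun y => H (Z (Phi y))) x.
  apply: (@differentiable_comp _ _ _ _ (fun y => Z (Phi y)) H); last exact: dH.
  exact: (@differentiable_comp _ _ _ _ Phi Z).
have [+ _] := isD_symp 0 da db.
congr (differentiable _ x); apply/funext => y.
by rewrite /ham st_alphaE.
Qed.

Section AtPoint.
Variables (U0 : set D) (c0 : D -> E) (u : D).
Hypotheses (sc : std_chart U0 c0) (Uu : U0 u) (u0 : u$0 <= 0) (d0 : 0 < dframe c0 u).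
Local Notation x := (c0 u).
Let c := chart_of s U0 c0.
Let bc : base_chart U0 c0 := std_base sc.
Local Notation Zh := (H (Z (Phi x))).
Let dc : differentiable c0 u := smooth_diff (bc_smooth bc) Uu.
Let dch : differentiable (chat s c0) u := smooth_diff (smooth_chat s bc) Uu.
Let dPc : differentiable (fun t => Phi (c0 t)) u := smooth_diff (smooth_PhiC s bc) Uu.
Let Sx : S0 x := chart_S0 bc Uu u0.

Lemma ham_chat : ham x = symp (chat s c0 u) Zh.
Proof. by rewrite /ham st_alphaE -chatE. Qed.

(** Positive transversality says that (P, Z, D_0, D_1, ...) and (P, N, D_0, D_1, ...)
    induce the same orientation; the functional symp(Xhat, -) vanishes on P and
    on the D_j, and is negative on N. *)
Lemma transverse_neg : symp (Xhat x *m A) Zh < 0.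
Proof.
have Ac : atlas s c by exists U0, c0.
have cdu : chart_dom c u by [].
have := Zpos Ac cdu; cbv zeta; rewrite wedge1E.
pose w := vcons Zh (fun j => 'D_(basis R n.*2 j) (chat s c0) u).
have wE j : w j = H (vcons (Z (Phi x)) (fun i => 'D_(basis R n.*2 i) c.2 u) j).
  by case: j => [//|j]; rewrite /w /= (derive_chat s bc).
have -> : (fun j => alpha (c.2 u) (vcons (Z (c.2 u)) (fun i => 'D_(basis R n.*2 i) c.2 u) j))
    = (fun j => symp (chat s c0 u) (w j)).
  by apply/funext => j; rewrite st_alphaE -chatE wE.
have -> : (fun i j => extd alpha (c.2 u)
       (vcons (Z (c.2 u)) (fun i => 'D_(basis R n.*2 i) c.2 u) i)
       (vcons (Z (c.2 u)) (fun i => 'D_(basis R n.*2 i) c.2 u) j))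
    = (fun i j => 2 * symp (w i) (w j)).
  by apply/funext => i; apply/funext => j; rewrite extd_alpha !wE.
rewrite bpfaffZ mulrA -exprMn mulVf // expr1n mul1r => b0.
have dZ0 : 0 < \det (framemx (chat s c0 u) Zh (fun j => 'D_(basis R n.*2 j) (chat s c0) u)).
  have n0 : (0 : R) < n.+1.*2%:R by rewrite ltr0n.
  have := mulr_gt0 n0 b0; rewrite bpfaff_det pmulr_lgt0 //; exact: pfaff_std_gt0.
have dN0 : 0 < \det (framemx (chat s c0 u) (lift0 (Nf x) *m A)
                       (fun j => 'D_(basis R n.*2 j) (chat s c0) u)).
  rewrite (frame_det s bc Uu); have r0 := st_rho_gt0 s x; have m0 := st_mu_gt0 s.
  apply: mulr_gt0; last exact: exprn_gt0.
  by apply: mulr_gt0 => //; apply: mulr_gt0 => //; exact: exprn_gt0.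
have := det_frame_row Zh (lt0r_neq0 dN0) (symp_Xp s c0 u) (fun j => symp_Xv s bc _ Uu).
rewrite (symp_XN s bc Uu) mulrN => HH.
by rewrite -(pmulr_llt0 _ dN0) -HH oppr_lt0; apply: mulr_gt0 => //; exact: st_mu_gt0.
Qed.

(** At a pole [Xhat] is tau times (1, x), so [transverse_neg] gives the sign of alpha(Z). *)
Lemma ham_pole : pole x -> x$0 * ham x < 0.
Proof.
move=> px; have := transverse_neg.
have -> : Xhat x = x$0 *: lift1 1 x by rewrite /Xhat pole_Xf // raddf0 add0r pole_tau.
rewrite ham_chat /chat -scalemxAl !sympZl mulrCA => H1.
by rewrite pmulr_rlt0 //; exact: st_rho_gt0.
Qed.

Let V := char_field alpha c u.
Let w := 'D_V c.2 u.

Lemma derive_chat_char : exists b, 'D_V (chat s c0) u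
  = (rho x * kappa s c0 u) *: (Xhat x *m A) + b *: chat s c0 u.
Proof.
have r0 : rho x != 0 by rewrite gt_eqF // st_rho_gt0.
exists ('D_V (fun t => rho (c0 t)) u / rho x - kappa s c0 u * tau x).
rewrite (derive_chat_lift s bc) // (derive_char_field s bc Uu d0) /chat.
have -> : lift0 (kappa s c0 u *: Xf x)
    = kappa s c0 u *: (Xhat x - tau x *: lift1 1 x).
  by rewrite linearZ /Xhat addrK.
rewrite -scalemxAl mulmxBl -scalemxAl; apply/coordP => j _.
by rewrite !(coordB, coordD, coordN, coordZ); field.
Qed.

(** Where alpha(Z) vanishes, the contact condition gives the derivative
    2 symp(X, Z) along the characteristic field X; [transverse_neg] gives its sign. *)
Lemma ham_derive_neg : ~ pole x -> ham x = 0 -> 'D_V (fun t => ham (c0 t)) u < 0.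
Proof.
move=> npx hx; have [sZ _ Zcontact] := ZC; have p0 : (st_M s `&` W) (Phi x).
  by split; [exact: st_MPhi|apply: SW; exists x].
have dZ : differentiable Z (Phi x) by apply: smooth_diff sZ _; case: p0.
have Hw : H w = 'D_V (chat s c0) u by rewrite (derive_chat s bc).
have [b wE] := derive_chat_char.
have aw : symp (chat s c0 u) (H w) = 0.
  have cX := symp_Xp s c0 u; rewrite Hw wE.
  move: (chat s c0 u) (Xhat x *m A) cX => a X aX.
  by rewrite sympDr !sympZr symp_self sympC aX; ring.
have tan v : tangent (st_M s) (Phi x) ('D_v c.2 u).
  have -> : 'D_v c.2 u = 'D_('D_v c0 u) Phi x.
    by apply: (@derive_comp R _ _ _ c0 Phi u) => //; exact: st_Phi_diff.
  exact: st_tangent.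
have [v0 v0P] : exists v0, pullback alpha c u v0 <> 0.
  apply: contrapT => nv; apply: npx; apply: (tangency_pole bc Uu u0 d0) => v.
  by apply: contrapT => pv; apply: nv; exists v; exact: pv.
have dw : H ('D_w Z (Phi x)) = 'D_V (fun t => H (Z (Phi (c0 t)))) u.
  rewrite derive_linear_comp; last exact: (@differentiable_comp _ _ _ _ (fun t => Phi (c0 t)) Z).
  by rewrite (@derive_comp R _ _ _ (fun t => Phi (c0 t)) Z u).
have aE v : alpha (Phi x) v = symp (chat s c0 u) (H v) by rewrite st_alphaE -chatE.
have lw : symp (chat s c0 u) (H ('D_w Z (Phi x))) = symp (H w) Zh.
  have C := contact_lie p0 (tan v0) (tan V) (etrans (aE w) aw).
  have {}C : lie Z alpha (Phi x) w = 0.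
    by apply: C => a0; apply: v0P; exact: a0.
  have := etrans (esym (lieE _ _)) C; rewrite -chatE => /eqP.
  by rewrite (sympC Zh) addrC subr_eq0 => /eqP.
have db : differentiable (fun t => H (Z (Phi (c0 t)))) u.
  apply: (@differentiable_comp _ _ _ _ (fun t => Z (Phi (c0 t))) H); last exact: differentiable_linear.
  exact: (@differentiable_comp _ _ _ _ (fun t => Phi (c0 t)) Z).
have [_ DE] := isD_symp V dch db.
have -> : (fun t => ham (c0 t)) = (fun t => symp (chat s c0 t) (H (Z (Phi (c0 t))))).
  by apply/funext => t; rewrite /ham st_alphaE -chatE.
rewrite DE -dw lw Hw wE; have tn := transverse_neg.
have rk : 0 < rho x * kappa s c0 u.
  by apply: mulr_gt0; [exact: st_rho_gt0|exact: kappa_gt0].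
have := ham_chat; rewrite hx.
move: (chat s c0 u) (Xhat x *m A) tn rk => a X tn rk /esym aZ.
rewrite sympDl !sympZl aZ mulr0 addr0 -mulr2n pmulrn_llt0 //.
by rewrite pmulr_rlt0.
Qed.

End AtPoint.

Definition neg_part : set E := [set x | S0 x /\ ham x <= 0].

Lemma neg_part_compact : compact neg_part.
Proof.
apply: subclosed_compact (@S0_compact R k) _; last by move=> x [].
rewrite -[neg_part]setCK; apply: open_closedC; rewrite openE => x nx.
have [Sx|nSx] := pselect (S0 x); last first.
  have oS : open (~` @S0 R k) by apply: closed_openC; exact: S0_closed.
  by apply: filterS (open_nbhs_nbhs (conj oS nSx)) => y nSy [].
have hx : 0 < ham x by rewrite ltNge; apply/negP => hx; apply: nx.
have ch := differentiable_continuous (diff_ham Sx).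
have H1 : \forall y \near x, 0 < ham y.
  exact: ch _ (open_nbhs_nbhs (conj (@open_gt R 0) hx)).
by apply: filterS H1 => y /= hy [_]; rewrite leNgt hy.
Qed.

Lemma near_line (P : set D) u (v : D) : nbhs u P -> \forall t \near 0^'+, P (u + t *: v).
Proof.
move=> Pu; apply: (@cvg_at_right_filter _ _ (fun t : R => u + t *: v) 0).
  apply: cvgD; first exact: cvg_cst.
  exact: scalel_continuous.
by rewrite scale0r addr0.
Qed.

Lemma L_push (t : R) : 0 < t ->
  Lfun (north R k) < Lfun (gch 1 (upole R k + t *: basis R n.*2 0)).
Proof.
move=> t0; have [pn n0] := @gch_upole R k 1.
have e_c j : (upole R k + t *: basis R n.*2 0)$j = if j == 0%N then t - 5 else 0.
  rewrite coordD coord_upole coordZ coord_basis.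
  by case: j => [|j] /=; rewrite ?mulr1 ?mul0rn ?mulr0 ?addr0 // addrC.
have s0 : ssq (upole R k + t *: basis R n.*2 0) = 0.
  rewrite /ssq big1 // => i _; rewrite !e_c /= expr0n addr0.
  by case: (val i) => [|j]; rewrite ?mul0r //= expr0n mulr0.
rewrite /Lfun pole_tau // n0 tau_gch s0 subr0 sqrtr1 !(pole_coord pn) //.
rewrite !coord_gch !e_c /=.
have t2 : 0 < t ^+ 2 by apply: exprn_gt0.
by rewrite !mulr0 !addr0 subrK expr0n /= addr0 mulr1; lra.
Qed.

(** Outside the poles, follow the characteristic foliation; from the pole tau = 1,
   move in the direction of q_0. *)
Lemma neg_part_increase x : neg_part x -> exists2 y, neg_part y & Lfun x < Lfun y.
Proof.
move=> [Sx hx]; have [U0 [c0 [u [sc Uu u0 d0 ux]]]] := std_cover Sx.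
have bc := std_base sc; subst x.
have uneg : u$0 < 0.
  rewrite lt_neqAle u0 andbT; apply/eqP => u00.
  have : 0 < ham (c0 u).
    apply: Zbd; exists (chart_of s U0 c0), u.
    by split; [exists U0, c0|split|by []|exact: u00].
  by rewrite ltNge hx.
have dh V b : base_chart V b -> forall t, V t -> t$0 <= 0 ->
    differentiable (fun t => ham (b t)) t.
  move=> bb t Vt t0; apply: (@differentiable_comp _ _ _ _ b ham).
    exact: smooth_diff (bc_smooth bb) Vt.
  by apply: diff_ham; exact: chart_S0 bb Vt t0.
have oneg : open [set t : D | t$0 < 0].
  have -> : [set t : D | t$0 < 0] = (fun t : D => t$0) @^-1` [set r | r < 0] by [].
  apply: open_comp; last exact: open_lt.
  by move=> t _; apply: differentiable_continuous; exact: differentiable_coordn.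
have [px|npx] := pselect (pole (c0 u)).
  have hp := ham_pole sc Uu u0 d0 px.
  have [xn|xs] := pole_cases px Sx; last first.
    have [_ s0] := @gch_upole R k (-1).
    by move: hp; rewrite xs s0 mulN1r oppr_lt0 ltNge -xs hx.
  have ee : (1 : R) ^+ 2 = 1 by rewrite expr1n.
  have bn := base_chart_gch k ee; have gu := @gdom_upole R k.
  have hn : ham (gch 1 (upole R k)) < 0.
    have [_ n0] := @gch_upole R k 1.
    by move: hp; rewrite xn n0 mul1r.
  have /differentiable_continuous ch := dh _ _ bn _ gu (ltW (gdom_neg gu)).
  have H1 := near_line (basis R n.*2 0) (open_nbhs_nbhs (conj (bc_open bn) gu)).
  have H2 : \forall t \near 0^'+, ham (gch 1 (upole R k + t *: basis R n.*2 0)) < 0.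
    exact: near_line (ch _ (open_nbhs_nbhs (conj (@open_lt R 0) hn))).
  have [t [[t0 g1] g2]] := filter_ex (filterI (filterI (nbhs_right_gt (0 : R)) H1) H2).
  exists (gch 1 (upole R k + t *: basis R n.*2 0)).
    by split; [exact: chart_S0 bn g1 (ltW (gdom_neg g1))|exact: ltW].
  by rewrite xn; exact: L_push.
have [Fx Lx] := Sx; have L0 := dL_Xf_gt0 Fx Lx npx.
pose V := char_field alpha (chart_of s U0 c0) u.
have dc := smooth_diff (bc_smooth bc) Uu.
have H1 := near_line V (open_nbhs_nbhs (conj (bc_open bc) Uu)).
have H2 := near_line V (open_nbhs_nbhs (conj oneg uneg)).
have H3 : \forall t \near 0^'+, Lfun (c0 u) < Lfun (c0 (u + t *: V)).
  have [dLc DL] := isD_L V dc.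
  apply: (derive_pos_near (f := fun t => Lfun (c0 t)) dLc); rewrite DL.
  rewrite (derive_char_field s bc Uu d0) dLZ; apply: mulr_gt0 => //; exact: kappa_gt0.
have dhc := dh _ _ bc _ Uu u0.
have H4 : \forall t \near 0^'+, ham (c0 (u + t *: V)) <= 0.
  move: hx; rewrite le_eqVlt => /orP[/eqP hx|hx].
    have := ham_derive_neg sc Uu u0 d0 npx hx; rewrite -oppr_gt0 -deriveN; last exact: diff_derivable.
    move=> /(derive_pos_near (differentiableN dhc)); apply: filterS => t /=.
    by rewrite ltrN2 hx => /ltW.
  have ch := differentiable_continuous dhc.
  have := near_line V (ch _ (open_nbhs_nbhs (conj (@open_lt R 0) hx))).
  by apply: filterS => t; exact: ltW.
have [t [[[t1 t2] t3] t4]] := filter_ex (filterI (filterI (filterI H1 H2) H3) H4).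
exists (c0 (u + t *: V)) => //; split=> //; exact: chart_S0 bc t1 (ltW t2).
Qed.

Lemma convex_absurd : False.
Proof.
have Sn : S0 (north R k) by apply: S0_gch; rewrite expr1n.
have n0 : neg_part !=set0.
  have [U0 [c0 [u [sc Uu u0 d0 ux]]]] := std_cover Sn.
  exists (north R k); split=> //; rewrite -ux.
  have [pn nn] := @gch_upole R k 1.
  have px : pole (c0 u) by rewrite ux.
  by have := ham_pole sc Uu u0 d0 px; rewrite {1}ux nn mul1r => /ltW.
have cL : {within neg_part, continuous (@Lfun R k)}.
  exact/continuous_subspaceT/continuous_L.
have [m /set_mem mK mP] := compact_EVT_max n0 neg_part_compact cL.
have [y yK my] := neg_part_increase mK.
by have := mP y (mem_set yK); rewrite leNgt my.
Qed.

End NotConvex.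

Theorem atlas_nonconvex (R : realType) (k N : nat) (s : setting R k N) :
  ~ convex_hypersurface (st_alpha s) (atlas s) (st_M s) (hypersurface s).
Proof. by move=> [W [Z [oW SW ZC Zpos Zbd]]]; exact: (convex_absurd SW ZC Zpos Zbd). Qed.

(** * Contact similarities of the Darboux space *)

Lemma tangent_curve (R : realType) (V W : normedModType R) (M : set W) (f : V -> W) x v :
  (\forall t \near (0 : R), M (f (x + t *: v))) -> differentiable f x ->
  tangent M (f x) ('D_v f x).
Proof.
move=> Mf df; exists (fun t : R => f (x + t *: v)); split=> //.
  by rewrite scale0r addr0.
have := @is_derive_line R V W f x v 0; rewrite scale0r addr0; exact.
Qed.

Lemma setting_example (R : realType) (k N : nat) (s : setting R k N) (e : R) :
    (forall x y, S0 x -> S0 y -> `|st_Phi s x - st_Phi s y| < e) ->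
  let S := hypersurface s in let A := atlas s in
  [/\ S `<=` st_M s, forall p q, S p -> S q -> `|p - q| < e,
      compact S, connected S & oriented_hypersurface S A] /\
  [/\ discrete_tangencies (st_alpha s) A, contact_type_boundary (st_alpha s) A,
      0 < \sum_(p \in neg_tangency (st_alpha s) A) Ind (st_alpha s) A p
    & ~ convex_hypersurface (st_alpha s) A (st_M s) S].
Proof.
move=> small S A; have cP : continuous (st_Phi s).
  by move=> x; apply: differentiable_continuous; exact: st_Phi_diff.
split; split.
- by move=> p [x Sx <-]; exact: st_MPhi.
- by move=> p q [x Sx <-] [y Sy <-]; exact: small.
- by apply: continuous_compact; [exact: continuous_subspaceT|exact: S0_compact].
- by apply: connected_continuous_connected; [exact: S0_connected|exact: continuous_subspaceT].
- exact: atlas_oriented.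
- exact: atlas_discrete.
- exact: atlas_boundary.
- exact: atlas_index_sum.
- exact: atlas_nonconvex.
Qed.

Section Heisenberg.
Variables (R : realType) (k : nat).
Let n := k.+2.
Let E := 'rV[R]_(n.*2.+1).
Let L := 'rV[R]_(n.+1.*2).
Local Notation "x $ i" := (coord x i) (at level 5, format "x $ i").
Implicit Types (x y : E).

Lemma om_lift0 x y : om x y = symp (lift0 x) (lift0 y).
Proof. by rewrite /lift0 symp_lift1 mul0r mulr0 subr0 add0r. Qed.

Lemma omDr x y y' : om x (y + y') = om x y + om x y'.
Proof. by rewrite !om_lift0 raddfD sympDr. Qed.

Lemma omZr x a y : om x (a *: y) = a * om x y.
Proof. by rewrite !om_lift0 linearZ sympZr. Qed.

Lemma omDl x x' y : om (x + x') y = om x y + om x' y.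
Proof. by rewrite !om_lift0 raddfD sympDl. Qed.

Lemma omZl a x y : om (a *: x) y = a * om x y.
Proof. by rewrite !om_lift0 linearZ sympZl. Qed.

Lemma om_self x : om x x = 0.
Proof. by rewrite om_lift0 symp_self. Qed.

Lemma om_ext a b x y x' y' : (forall j, x$(j.+1) = a * x'$(j.+1)) ->
  (forall j, y$(j.+1) = b * y'$(j.+1)) -> om x y = a * b * om x' y'.
Proof.
by move=> xx yy; rewrite /om mulr_sumr; apply: eq_bigr => i _; rewrite !xx !yy; ring.
Qed.

Variables (x0 : E) (d : R).

(** x0 + heis x is the image of x under a contact transformation: a
   dilation followed by a left translation of the Heisenberg group. *)
Definition heis x : E := rowf n.*2.+1 (fun j =>
  if j is _.+1 then d * x$j else d ^+ 2 * x$0 - d * om x0 x).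

Definition heisV x : E := rowf n.*2.+1 (fun j =>
  if j is _.+1 then x$j / d else (x$0 + om x0 x) / d ^+ 2).

Lemma coord_heis x j : (heis x)$j =
  if j is _.+1 then d * x$j else d ^+ 2 * x$0 - d * om x0 x.
Proof. by rewrite /heis coord_rowfE // => -[|i] // ni; rewrite coord_out // mulr0. Qed.

Lemma coord_heisV x j : (heisV x)$j =
  if j is _.+1 then x$j / d else (x$0 + om x0 x) / d ^+ 2.
Proof. by rewrite /heisV coord_rowfE // => -[|i] // ni; rewrite coord_out // mul0r. Qed.

Lemma heis_is_linear : linear heis.
Proof.
move=> a x y; apply/coordP => j _; rewrite coordD coordZ !coord_heis.
by case: j => [|j]; rewrite !(coordD, coordZ, omDr, omZr); ring.
Qed.

HB.instance Definition _ := GRing.isLinear.Build R E E _ heis heis_is_linear.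

Lemma heisV_is_linear : linear heisV.
Proof.
move=> a x y; apply/coordP => j _; rewrite coordD coordZ !coord_heisV.
by case: j => [|j]; rewrite !(coordD, coordZ, omDr, omZr); ring.
Qed.

HB.instance Definition _ := GRing.isLinear.Build R E E _ heisV heisV_is_linear.

Hypothesis d0 : 0 < d.

Lemma om_heis x y : om (heis x) (heis y) = d ^+ 2 * om x y.
Proof. by rewrite (om_ext (a := d) (b := d) (x' := x) (y' := y)) // => j; rewrite coord_heis. Qed.

Lemma om_heisr x y : om x (heis y) = d * om x y.
Proof. by rewrite (om_ext (a := 1) (b := d) (x' := x) (y' := y)) ?mul1r // => j; rewrite ?coord_heis ?mul1r. Qed.

Lemma om_heisl x y : om (heis x) y = - (d * om y x).
Proof. by rewrite om_anti om_heisr. Qed.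

Lemma heisK x : heisV (heis x) = x.
Proof.
have d0' : d != 0 by rewrite gt_eqF.
apply/coordP => -[|j] _; rewrite coord_heisV ?om_heisr !coord_heis; by field.
Qed.

Definition tailE (a : L) : E := rowf n.*2.+1 (fun j => a$(j.+1)).

Lemma coord_tailE a j : (tailE a)$j = a$(j.+1).
Proof. by rewrite /tailE coord_rowfE // => i ni; rewrite coord_out. Qed.

Lemma tailE_lift1 c x : tailE (lift1 c x) = x.
Proof. by apply/coordP => j _; rewrite coord_tailE coord_lift1. Qed.

Lemma lift1_tailE a : lift1 (a$0) (tailE a) = a.
Proof. by apply/coordP => -[|j] _; rewrite coord_lift1 ?coord_tailE. Qed.

Definition heis_lift (a : L) : L := lift1 (a$0) (a$0 *: x0 + heis (tailE a)).

Lemma heis_lift_is_linear : linear heis_lift.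
Proof.
move=> c a b; rewrite /heis_lift -lift1Z -lift1D !coordD !coordZ; congr lift1.
have -> : tailE (c *: a + b) = c *: tailE a + tailE b.
  by apply/coordP => j _; rewrite !(coordD, coordZ, coord_tailE).
by rewrite linearD linearZ scalerDl scalerDr !scalerA addrACA.
Qed.

HB.instance Definition _ := GRing.isLinear.Build R L L _ heis_lift heis_lift_is_linear.

Definition heis_mx : 'M[R]_(n.+1.*2) := lin1_mx heis_lift.

Lemma lift1_heis_mx x : lift1 1 x *m heis_mx = lift1 1 (x0 + heis x).
Proof.
rewrite mul_rV_lin1 -[LHS]/(heis_lift (lift1 1 x)) /heis_lift.
by rewrite tailE_lift1 coord_lift1 scale1r.
Qed.

(** Contact similarities lift to conformally symplectic linear maps. *)
Lemma symp_heis_mx (a b : L) : symp (a *m heis_mx) (b *m heis_mx) = d ^+ 2 * symp a b.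
Proof.
rewrite !mul_rV_lin1 -[LHS]/(symp (heis_lift a) (heis_lift b)).
suff H r t x y : symp (heis_lift (lift1 r x)) (heis_lift (lift1 t y))
    = d ^+ 2 * symp (lift1 r x) (lift1 t y).
  by rewrite -[a]lift1_tailE -[b]lift1_tailE.
rewrite /heis_lift !tailE_lift1 !coord_lift1 !symp_lift1 !coordD !coordZ.
rewrite !(omDl, omDr, omZl, omZr) om_self om_heis om_heisr om_heisl.
by rewrite !(coord_heis _ 0); ring.
Qed.

End Heisenberg.

(** * Small embeddings in a Darboux chart and in the sphere *)

Section Settings.
Variables (R : realType) (k : nat).
Let n := k.+2.
Let E := 'rV[R]_(n.*2.+1).
Let L := 'rV[R]_(n.+1.*2).
Local Notation "x $ i" := (coord x i) (at level 5, format "x $ i").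
Implicit Types (x : E).

Lemma smooth_heis (V : normedModType R) (U : set V) (c : V -> E) x0 d : open U ->
  smooth U c -> smooth U (fun t => heis x0 d (c t)).
Proof. by move=> oU sc; exact: (smooth_linear_comp (heis x0 d : {linear E -> E})). Qed.

Lemma diff_heisV x0 d x : differentiable (heisV x0 d) x.
Proof. exact: (differentiable_linear (heisV x0 d : {linear E -> E})). Qed.

Lemma om_bound x y : `|om x y| <= n%:R * (2 * (`|x| * `|y|)).
Proof.
have -> : n%:R * (2 * (`|x| * `|y|)) = \sum_(i < n) 2 * (`|x| * `|y|).
  by rewrite sumr_const card_ord mulr_natl.
apply: (le_trans (ler_norm_sum _ _ _)); apply: ler_sum => i _.
rewrite (le_trans (ler_normB _ _)) // !normrM mulrDl mul1r.
by apply: lerD; apply: ler_pM => //; exact: normr_coord.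
Qed.

Lemma heis_bound x0 d x : 0 < d -> d <= 1 -> S0 x ->
  `|heis x0 d x| <= d * (30 + n%:R * (2 * (`|x0| * 30))).
Proof.
move=> d0 d1 Sx; have x30 := S0_bounded Sx.
have o0 : 0 <= n%:R * (2 * (`|x0| * 30)) by rewrite !mulr_ge0.
have ob : `|om x0 x| <= n%:R * (2 * (`|x0| * 30)).
  rewrite (le_trans (om_bound _ _)) // ler_wpM2l // ler_wpM2l // ler_wpM2l //.
have xj j : `|x$j| <= 30 by rewrite (le_trans (normr_coord _ _)).
apply: normr_rowP => [|j _]; first by rewrite mulr_ge0 // ltW // ltr_wpDr.
rewrite coord_heis; case: j => [|j]; last first.
  by rewrite normrM gtr0_norm // ler_pM2l // (le_trans (xj _)) // lerDl.
rewrite expr2 -mulrA -mulrBr normrM gtr0_norm // ler_pM2l //.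
rewrite (le_trans (ler_normB _ _)) // lerD // normrM gtr0_norm //.
by rewrite (le_trans _ (xj 0%N)) // ler_piMl.
Qed.

Section Darboux.
Variables (V : set E) (x0 : E) (d : R).
Hypotheses (oV : open V) (d0 : 0 < d).
Hypothesis SV : forall x, S0 x -> V (x0 + heis x0 d x).

Let Phi x : E := x0 + heis x0 d x.
Let PhiV (p : E) : E := heisV x0 d (p - x0).

Let alphaE (p v : E) :
  darboux_form p v = symp (lift1 1 0 + lift0 p) (lift0 v).
Proof. by rewrite -lift1E /lift0 symp_lift1 darbouxE mul1r mulr0 subr0. Qed.

Let liftE x : lift1 1 0 + lift0 (Phi x) = (1 : R) *: (lift1 1 x *m heis_mx x0 d).
Proof. by rewrite scale1r lift1_heis_mx -lift1E. Qed.

Let smooth_Phi (W : normedModType R) (U : set W) (c : W -> E) : open U -> smooth U c ->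
  smooth U (fun u => Phi (c u)).
Proof. by move=> oU sc; apply: smoothD => //; [exact: smooth_cst|exact: smooth_heis]. Qed.

Let diff_Phi x : differentiable Phi x.
Proof. by apply: smooth_diff (smooth_Phi openT (smooth_id openT)) _. Qed.

Let diff_PhiV p : setT p -> differentiable PhiV p.
Proof.
move=> _; apply: (@differentiable_comp _ _ _ _ (fun p => p - x0) (heisV x0 d)).
  by apply: differentiableD => //; exact: differentiable_cst.
exact: diff_heisV.
Qed.

Let PhiK x : PhiV (Phi x) = x.
Proof. by rewrite /PhiV /Phi addrC addKr heisK. Qed.

Let tangent_Phi x v : S0 x -> tangent V (Phi x) ('D_v Phi x).
Proof.
move=> Sx; apply: tangent_curve => //.
have cP : {for 0, continuous (fun t : R => Phi (x + t *: v))}.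
  apply: differentiable_continuous.
  apply: (@differentiable_comp _ _ _ _ (fun t : R => x + t *: v) Phi) => //.
by apply: cP; rewrite /= scale0r addr0; apply: open_nbhs_nbhs; split => //; exact: SV.
Qed.

Definition darboux_setting : setting R k n.*2.+1 :=
  @Setting R k _ (@darboux_form R n) V Phi PhiV setT (lift1 1 0)
    (@lift0 R k : {linear E -> L}) (fun=> 1) (heis_mx x0 d) (d ^+ 2)
    alphaE liftE (fun=> ltr01) (exprn_gt0 2 d0) (symp_heis_mx x0 d)
    (fun U c _ _ => smooth_cst U (1 : R)) (@smooth_Phi _) diff_Phi openT diff_PhiV
    (fun=> I) PhiK SV tangent_Phi.

End Darboux.

Section Sphere.
Variable d : R.
Hypothesis d0 : 0 < d.

Definition nsq (a : L) : R := \sum_i (a 0 i) ^+ 2.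

Lemma nsqZ c a : nsq (c *: a) = c ^+ 2 * nsq a.
Proof. by rewrite /nsq mulr_sumr; apply: eq_bigr => i _; rewrite mxE exprMn. Qed.

Lemma nsq_lift1 y : nsq (lift1 1 y) = 1 + \sum_(i < n.*2.+1) (y$i) ^+ 2.
Proof.
rewrite /nsq big_ord_recl -(coord_ord (lift1 1 y)) coord_lift1 /= expr1n; congr (_ + _).
by apply: eq_bigr => i _; rewrite -(coord_ord (lift1 1 y)) coord_lift1.
Qed.

Lemma nsq_lift1_ge1 y : 1 <= nsq (lift1 1 y).
Proof. by rewrite nsq_lift1 lerDl sumr_ge0 // => i _; exact: sqr_ge0. Qed.

Let rho x : R := (Num.sqrt (nsq (lift1 1 (heis 0 d x))))^-1.
Let Phi x : L := rho x *: lift1 1 (heis 0 d x).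
Let PhiV (p : L) : E := heisV 0 d ((p$0)^-1 *: tailE p).
Let O : set L := [set p | 0 < p$0].

Let nsq_gt0 x : 0 < nsq (lift1 1 (heis 0 d x)).
Proof. exact: lt_le_trans ltr01 (nsq_lift1_ge1 _). Qed.

Let rho_gt0 x : 0 < rho x.
Proof. by rewrite invr_gt0 sqrtr_gt0. Qed.

Let alphaE (p v : L) : @sphere_form R n p v = symp (0 + p) v.
Proof. by rewrite add0r. Qed.

Let liftE x : 0 + Phi x = rho x *: (lift1 1 x *m heis_mx 0 d).
Proof. by rewrite add0r lift1_heis_mx add0r. Qed.

Let smooth_lift1 (W : normedModType R) (U : set W) (c : W -> E) : open U -> smooth U c ->
  smooth U (fun u => lift1 1 (heis 0 d (c u))).
Proof.
move=> oU sc; apply/smooth_rowP => // j.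
apply: (smooth_ext oU (f := fun t => if j is i.+1 then (heis 0 d (c t))$i else 1 : R)) => [t _|].
  by rewrite coord_lift1.
case: j => [|j]; first exact: smooth_cst.
by apply: smooth_coordn => //; exact: smooth_heis.
Qed.

Let smooth_rho (W : normedModType R) (U : set W) (c : W -> E) : open U -> smooth U c ->
  smooth U (fun u => rho (c u)).
Proof.
move=> oU sc; have sl := smooth_lift1 oU sc.
apply: smoothV => // [t _|]; first by rewrite gt_eqF // sqrtr_gt0.
apply: smooth_sqrt => //; apply: smooth_sum => // i; apply: smoothX => //.
apply: (smooth_ext oU _ (smooth_coordn i oU sl)) => t _.
by rewrite coord_ord.
Qed.

Let smooth_Phi (W : normedModType R) (U : set W) (c : W -> E) : open U -> smooth U c ->
  smooth U (fun u => Phi (c u)).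
Proof.
move=> oU sc; apply/smooth_rowP => // j.
apply: (smooth_ext oU (f := fun t => rho (c t) * (lift1 1 (heis 0 d (c t)))$j)) => [t _|].
  by rewrite coordZ.
apply: smoothM => //; first exact: smooth_rho.
by apply: smooth_coordn => //; exact: smooth_lift1.
Qed.

Let diff_Phi x : differentiable Phi x.
Proof. by apply: smooth_diff (smooth_Phi openT (smooth_id openT)) _. Qed.

Let O_open : open O.
Proof.
have -> : O = (fun p : L => p$0) @^-1` [set r | 0 < r] by [].
apply: open_comp; last exact: open_gt.
by move=> t _; apply: differentiable_continuous; exact: differentiable_coordn.
Qed.

Let diff_PhiV p : O p -> differentiable PhiV p.
Proof.
move=> Op; suff sP : smooth O PhiV by exact: smooth_diff sP Op.
apply: (smooth_linear_comp (heisV 0 d : {linear E -> E}) O_open).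
have sj j : smooth O (fun p : L => p$j) by exact: smooth_coord.
apply/smooth_rowP => // j.
apply: (smooth_ext O_open (f := fun p => (p$0)^-1 * p$(j.+1))) => [q _|].
  by rewrite coordZ coord_tailE.
by apply: smoothM => //; apply: smoothV => // q; rewrite /O /= => /lt0r_neq0.
Qed.

Let PhiO x : O (Phi x).
Proof. by rewrite /O /= coordZ coord_lift1 mulr1. Qed.

Let PhiK x : PhiV (Phi x) = x.
Proof.
have r0 : rho x != 0 by rewrite gt_eqF.
rewrite /PhiV (_ : _ *: _ = heis 0 d x) ?heisK //.
apply/coordP => j _; rewrite coordZ coord_tailE !coordZ !coord_lift1 mulr1.
by rewrite mulrA mulVf // mul1r.
Qed.

Let Phi_sphere x : sphere R n (Phi x).
Proof.
rewrite /sphere /= -/(nsq _) nsqZ exprVn sqr_sqrtr ?ltW //.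
by rewrite mulVf // gt_eqF.
Qed.

Let tangent_Phi x v : S0 x -> tangent (sphere R n) (Phi x) ('D_v Phi x).
Proof.
move=> Sx; apply: tangent_curve; last exact: diff_Phi.
by near=> t; exact: Phi_sphere.
Unshelve. all: by end_near. Qed.

Definition sphere_setting : setting R k n.*2.+2 :=
  @Setting R k _ (@sphere_form R n) (sphere R n) Phi PhiV O 0
    (idfun : {linear L -> L}) rho (heis_mx 0 d) (d ^+ 2)
    alphaE liftE rho_gt0 (exprn_gt0 2 d0) (symp_heis_mx 0 d)
    (@smooth_rho _) (@smooth_Phi _) diff_Phi O_open diff_PhiV
    PhiO PhiK (fun x _ => Phi_sphere x) tangent_Phi.

Lemma sphere_small x : d <= 1 -> S0 x ->
  `|st_Phi sphere_setting x - lift1 1 0| <= d * (30 + n.*2.+1%:R * 900).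
Proof.
move=> d1 Sx; have hb : `|heis 0 d x| <= d * 30.
  by have := heis_bound 0 d0 d1 Sx; rewrite normr0 mul0r !mulr0 addr0.
have hj j : `|(heis 0 d x)$j| <= d * 30 by rewrite (le_trans (normr_coord _ _)).
have n0 : (0 : R) <= n.*2.+1%:R by rewrite ler0n.
set B := n.*2.+1%:R in n0 *.
have nb : nsq (lift1 1 (heis 0 d x)) <= 1 + d * (B * 900).
  rewrite nsq_lift1 lerD2l.
  have -> : d * (B * 900) = \sum_(i < n.*2.+1) d * 900.
    by rewrite sumr_const card_ord -/B -mulr_natl; ring.
  apply: ler_sum => i _; rewrite -real_normK ?num_real //.
  have := hj i; have := normr_ge0 ((heis 0 d x)$i); move: `|_| => t t0 t1.
  rewrite (@le_trans _ _ ((d * 30) ^+ 2)) //; first by rewrite ler_sqr ?nnegrE // mulr_ge0 // ltW.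
  by rewrite exprMn; nra.
have n1 := nsq_lift1_ge1 (heis 0 d x).
have r0 := rho_gt0 x; have r2 : rho x ^+ 2 * nsq (lift1 1 (heis 0 d x)) = 1.
  by rewrite exprVn sqr_sqrtr ?ltW // mulVf // gt_eqF.
have r1 : rho x <= 1.
  by move: (rho x) (nsq _) r0 r2 n1 => r m r0 rm m1; nra.
have C0 : 0 <= 30 + B * 900 by lra.
apply: normr_rowP => [|j _]; first exact: mulr_ge0 (ltW d0) C0.
rewrite coordB coordZ !coord_lift1; case: j => [|j].
  rewrite mulr1 ler0_norm ?subr_le0 // opprB.
  have Bd : 0 <= d * 30 := mulr_ge0 (ltW d0) (ler0n R 30).
  rewrite mulrDr.
  move: (rho x) (nsq _) (d * (B * 900)) r0 r1 r2 nb n1 => r m b r0 r1 rm mb m1.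
  have r2 : r ^+ 2 <= 1 by rewrite expr_le1 // ltW.
  have m0 : 0 <= m - 1 by rewrite subr_ge0.
  (* 1 - r <= 1 - r^2 = r^2 (m - 1) <= m - 1 *)
  have H1 : 1 - r <= 1 - r ^+ 2 by rewrite lerD2l lerN2 expr2 ler_piMl // ltW.
  have H2 : 1 - r ^+ 2 = r ^+ 2 * (m - 1) by rewrite mulrBr rm mulr1.
  have H3 : r ^+ 2 * (m - 1) <= m - 1 by exact: ler_piMl.
  lra.
rewrite coord0 subr0 normrM (gtr0_norm r0).
apply: le_trans (ler_piMl (normr_ge0 _) r1) _; apply: le_trans (hj j) _.
by rewrite ler_pM2l //; lra.
Qed.

End Sphere.
End Settings.

(** * The theorem *)

Lemma exists_scale (R : realType) (C e : R) : 0 < C -> 0 < e ->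
  exists d : R, [/\ 0 < d, d <= 1 & d * C < e].
Proof.
move=> C0 e0; have Ce : 0 < C + e by exact: addr_gt0.
exists (e / (C + e)); split; first exact: divr_gt0.
  by rewrite ler_pdivrMr // mul1r lerDr ltW.
by rewrite mulrAC ltr_pdivrMr // ltr_pM2l // ltrDl.
Qed.

Theorem mainTheorem7 (R : realType) (n : nat) (hn : (1 < n)%N) :
  (forall V : set 'rV[R]_(n.*2.+1), open V -> V !=set0 ->
   forall eps : R, 0 < eps ->
   exists (S : set 'rV[R]_(n.*2.+1)) (A : set (chart R n.*2.+1 n)),
     [/\ S `<=` V,
         forall p q, S p -> S q -> `|p - q| < eps,
         compact S, connected S & oriented_hypersurface S A] /\
     [/\ discrete_tangencies (@darboux_form R n) A,
         contact_type_boundary (@darboux_form R n) A,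
         0 < \sum_(p \in neg_tangency (@darboux_form R n) A)
               Ind (@darboux_form R n) A p
       & ~ convex_hypersurface (@darboux_form R n) A V S])
  /\
  (forall eps : R, 0 < eps ->
   exists (S : set 'rV[R]_(n.*2.+2)) (A : set (chart R n.*2.+2 n)),
     [/\ S `<=` sphere R n,
         forall p q, S p -> S q -> `|p - q| < eps,
         compact S, connected S & oriented_hypersurface S A] /\
     [/\ discrete_tangencies (@sphere_form R n) A,
         contact_type_boundary (@sphere_form R n) A,
         0 < \sum_(p \in neg_tangency (@sphere_form R n) A)
               Ind (@sphere_form R n) A p
       & ~ convex_hypersurface (@sphere_form R n) A (sphere R n) S]).
Proof.
case: n hn => [|[|k]] // _; split=> [V oV [x0 Vx0] e e0|e e0].
  (* On the model, C bounds the norm of heis divided by d. *)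
  pose C : R := 30 + k.+2%:R * (2 * (`|x0| * 30)).
  have C0 : 0 < C.
    rewrite /C; apply: ltr_pwDl; first by rewrite ltr0n.
    apply: mulr_ge0; first exact: ler0n.
    by apply: mulr_ge0 => //; exact: mulr_ge0.
  have [r /= r0 rV] := (nbhs_ballP _ _).1 (open_nbhs_nbhs (conj oV Vx0)).
  have m0 : 0 < Num.min r (e / 2) by rewrite lt_min r0 divr_gt0.
  have [d [d0 d1]] := exists_scale C0 m0; rewrite lt_min => /andP[dr de].
  have hb x : S0 x -> `|heis x0 d x| <= d * C by exact: heis_bound.
  have SV x : S0 x -> V (x0 + heis x0 d x).
    move=> Sx; apply: rV; rewrite -ball_normE /ball_ /= opprD addNKr normrN.
    exact: le_lt_trans (hb x Sx) dr.
  exists (hypersurface (darboux_setting oV d0 SV)), (atlas (darboux_setting oV d0 SV)).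
  apply: (setting_example (s := darboux_setting oV d0 SV)) => x y Sx Sy.
  rewrite /= opprD addrACA subrr add0r (le_lt_trans (ler_normB _ _)) //.
  rewrite (splitr e); apply: ltrD; [exact: le_lt_trans (hb x Sx) de|exact: le_lt_trans (hb y Sy) de].
pose C : R := 30 + k.+2.*2.+1%:R * 900.
have C0 : 0 < C.
  by rewrite /C; apply: ltr_pwDl; [rewrite ltr0n|apply: mulr_ge0; exact: ler0n].
have e20 : 0 < e / 2 by exact: divr_gt0.
have [d [d0 d1 de]] := exists_scale C0 e20.
exists (hypersurface (sphere_setting k d0)), (atlas (sphere_setting k d0)).
apply: (setting_example (s := sphere_setting k d0)) => x y Sx Sy.
have hx := le_lt_trans (sphere_small d0 d1 Sx) de.
have hy := le_lt_trans (sphere_small d0 d1 Sy) de.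
rewrite (splitr e); apply: le_lt_trans (ltrD hx hy).
rewrite [X in _ <= _ + X]distrC; exact: ler_distD.
Qed.
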